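(* Let $d\ge3$, $h,i\in\{0,1\}$, $n\ge2$, $j\in\{1,\dots,n-1\}$, $t>0$, $c>0$. Conditionally on $\mathcal N(t)=n$, the position $\underline{\mathbf X}_d^{h,i,j}(t)$ has probability density function $$p_n^j(\underline{\mathbf x}_d,t)=\frac{\Gamma\left((n+1)\left(\frac d2-1\right)+\frac j2+1\right)}{\Gamma\left(n\left(\frac d2-1\right)+\frac j2\right)}\,\frac{(c^2t^2-\|\underline{\mathbf x}_d\|^2)^{n\left(\frac d2-1\right)+\frac j2-1}}{\pi^{d/2}(ct)^{2(n+1)\left(\frac d2-1\right)+j}},\qquad \underline{\mathbf x}_d\in\mathcal B_{ct}^d.$$
   Context: Setting. A particle starts at the origin of $\mathbb R^d$ and moves with constant speed $c>0$. $\mathcal N(t)$ is the number of changes of direction in $[0,t]$; given $\mathcal N(t)=n$, $n\ge1$, its position is $c\sum_{k=1}^{n+1}\underline{\mathbf V}_k\tau_k$, where $\tau_{n+1}=t-\sum_{k=1}^n\tau_k$, the directions $\underline{\mathbf V}_1,\dots,\underline{\mathbf V}_{n+1}$ are i.i.d. uniformly distributed on the unit sphere of $\mathbb R^d$, and the directions, $\underline\tau_n=(\tau_1,\dots,\tau_n)$ and $\mathcal N(t)$ are independent. Generalized Dirichlet law $GD(\underline{\mathbf a}_n;\underline{\mathbf b}_n)$, $\underline{\mathbf a}_n=(a_1,\dots,a_n)$, $\underline{\mathbf b}_n=(b_1,\dots,b_n)$: the probability distribution on the simplex $S_n=\{(\tau_1,\dots,\tau_n): \tau_k>0\ \forall k,\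 \sum_{k=1}^n\tau_k<t\}$ with density proportional to $\prod_{k=1}^n\big[\tau_k^{a_k-1}(t-\sum_{l=1}^k\tau_l)^{b_k-1}\big]$. Definition of $\underline{\mathbf X}_d^{h,i,j}$, for $n>j$ (the only case used here): it is the motion above in which, given $\mathcal N(t)=n$, $\underline\tau_n$ has law $GD(\underline{\mathbf a}_n;\underline{\mathbf b}_n)$ with $a_k=d-1$ for $k\in\{1,\dots,j\}$ and $a_k=\frac d2-1$ for $k\in\{j+1,\dots,n\}$; $b_k=1$ for $k\in\{1,\dots,n-1\}\setminus\{j\}$, $b_j=(n-j+1)\left(\frac d2-1\right)+i+h+1$, and $b_n=\frac d2-i$. $\mathcal B_{ct}^d=\{x\in\mathbb R^d:\|x\|<ct\}$, with $\|\cdot\|$ the Euclidean norm. *)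

(* Defs.v *)
From HB Require Import structures.
From mathcomp Require Export all_boot all_order all_algebra.
From mathcomp Require Export all_classical all_reals all_analysis.

Set Implicit Arguments.
Unset Strict Implicit.
Unset Printing Implicit Defensive.
Import Order.TTheory GRing.Theory Num.Theory.
Import numFieldNormedType.Exports.
Local Open Scope classical_set_scope.
Local Open Scope ring_scope.

Lemma product_sigma_finite (R : realType) d1 d2
    (T1 : measurableType d1) (T2 : measurableType d2)
    (m1 : {sigma_finite_measure set T1 -> \bar R})
    (m2 : {sigma_finite_measure set T2 -> \bar R}) :
  sigma_finite setT (m1 \x m2)%E.
Proof.
have /sigma_finiteP[F [TF ndF Foo]] := sigma_finiteT m1.
have /sigma_finiteP[G [TG ndG Goo]] := sigma_finiteT m2.
exists (fun n => F n `*` G n).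
  rewrite -setXTT TF TG predeqE => -[x y]; split.
    move=> [/= [n _ Fnx] [k _ Gky]]; exists (maxn n k) => //; split.
    - by move: x Fnx; exact/subsetPset/ndF/leq_maxl.
    - by move: y Gky; exact/subsetPset/ndG/leq_maxr.
  by move=> [n _ []/= ? ?]; split; exists n.
move=> k; have [? ?] := Foo k; have [? ?] := Goo k.
split; first exact: measurableX.
by rewrite product_measure1E// lte_mul_pinfty// ge0_fin_numE.
Qed.

Section lebesgue_tuple.
Context (R : realType).

Definition tcons m (p : R * m.-tuple R) : m.+1.-tuple R :=
  [tuple of p.1 :: p.2].

Lemma measurable_tcons m : measurable_fun [set: R * m.-tuple R] (@tcons m).
Proof. exact: measurable_cons. Qed.

Section step.
Context m (mu : {sigma_finite_measure set (m.-tuple R) -> \bar R}).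

Definition tuple_product : set (m.+1.-tuple R) -> \bar R :=
  pushforward (lebesgue_measure \x mu)%E (@tcons m).

Let mt := @measurable_tcons m.

Let tuple_product0 : tuple_product set0 = 0%E.
Proof. by rewrite /tuple_product /pushforward preimage_set0 measure0. Qed.

Let tuple_product_ge0 A : (0 <= tuple_product A)%E.
Proof. exact: measure_ge0. Qed.

Let tuple_product_sigma_additive : semi_sigma_additive tuple_product.
Proof.
move=> F mF tF mUF; rewrite /tuple_product /pushforward preimage_bigcup.
apply: measure_semi_sigma_additive.
- by move=> n; rewrite -[X in measurable X]setTI; exact: mt.
- apply/trivIsetP => /= i j _ _ ij; rewrite -preimage_setI.
  by move/trivIsetP : tF => /(_ _ _ _ _ ij) ->//; rewrite preimage_set0.
- by rewrite -preimage_bigcup -[X in measurable X]setTI; exact: mt.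
Qed.

HB.instance Definition _ := isMeasure.Build _ _ _
  tuple_product tuple_product0 tuple_product_ge0 tuple_product_sigma_additive.

Let tuple_product_sigma_finite : sigma_finite setT tuple_product.
Proof.
have [F FT Ffin] := product_sigma_finite (@lebesgue_measure R) mu.
pose u (x : m.+1.-tuple R) : R * m.-tuple R := (thead x, [tuple of behead x]).
have uK : cancel (@tcons m) u.
  by move=> [x t]; congr (_, _); apply/val_inj.
have tK : cancel u (@tcons m) by move=> x; rewrite [RHS]tuple_eta.
have mu_ : measurable_fun [set: m.+1.-tuple R] u.
  apply/measurable_fun_pair; first exact: measurable_tnth.
  exact: measurable_behead.
exists (fun n => u @^-1` (F n)).
  by rewrite -preimage_bigcup -FT preimage_setT.
move=> n; have [mFn oon] := Ffin n; split.
  by rewrite -[X in measurable X]setTI; exact: mu_.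
rewrite /tuple_product /pushforward -comp_preimage.
by rewrite (_ : u \o _ = id) //; apply/funext => x /=; rewrite uK.
Qed.

HB.instance Definition _ := Measure_isSigmaFinite.Build _ _ _
  tuple_product tuple_product_sigma_finite.

End step.

(* Lebesgue measure on R^m, seen as m.-tuple R. *)
Fixpoint lebesgue_tuple (m : nat)
    : {sigma_finite_measure set (m.-tuple R) -> \bar R} :=
  match m with
  | 0 => \d_([tuple] : 0.-tuple R)
  | m'.+1 => tuple_product (lebesgue_tuple m')
  end.

End lebesgue_tuple.
Arguments lebesgue_tuple {R} m.

Section motion.
Context (R : realType).

(* Meaningful for x > 0, where the integral converges. *)
Definition Gamma (x : R) : R :=
  \int[lebesgue_measure]_(u in `]0, +oo[) (u `^ (x - 1) * expR (- u)).

Definition enorm d (x : d.-tuple R) : R :=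
  Num.sqrt (\sum_(l < d) tnth x l ^+ 2).

Definition eball d (r : R) : set (d.-tuple R) := [set x | enorm x < r].

(* Normalized surface measure of the unit sphere: the proportion of the unit
   ball occupied by the cone {r u : 0 < r < 1, u in A} over A. *)
Definition sphere_uniform d (A : set (d.-tuple R)) : \bar R :=
  (fine (lebesgue_tuple d
       [set x | 0 < enorm x < 1 /\ A [tuple tnth x l / enorm x | l < d]])
   / fine (lebesgue_tuple d (@eball d 1)))%:E.

Definition has_density m (law : set (m.-tuple R) -> \bar R)
    (f : m.-tuple R -> R) : Prop :=
  [/\ measurable_fun [set: m.-tuple R] f,
      forall x, 0 <= f x &
      forall A, measurable A -> law A = (\int[lebesgue_tuple m]_(x in A) (f x)%:E)%E].

Definition simplex n (t : R) : set (n.-tuple R) :=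
  [set s | (forall k, 0 < tnth s k) /\ \sum_(k < n) tnth s k < t].

(* The parameter vectors are indexed by k = 1, ..., n; the k-th coordinate of a
   tuple is the one of ordinal k - 1. *)
Definition GD_weight n (t : R) (a b : nat -> R) (s : n.-tuple R) : R :=
  \prod_(k < n) (tnth s k `^ (a k.+1 - 1) *
                 (t - \sum_(l < n | (l <= k)%N) tnth s l) `^ (b k.+1 - 1)).

Definition generalized_dirichlet n (t : R) (a b : nat -> R)
    (law : set (n.-tuple R) -> \bar R) : Prop :=
  exists K : R,
    has_density law (fun s => \1_(simplex t) s * (K * GD_weight t a b s)).

Definition GD_a (d j : nat) (k : nat) : R :=
  if (k <= j)%N then d%:R - 1 else d%:R / 2 - 1.

Definition GD_b (d h i n j : nat) (k : nat) : R :=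
  if k == j then (n - j + 1)%:R * (d%:R / 2 - 1) + i%:R + h%:R + 1
  else if k == n then d%:R / 2 - i%:R
  else 1.

(* (tau_1, ..., tau_n, tau_(n+1)) with tau_(n+1) the remaining time. *)
Definition durations n (t : R) (s : n.-tuple R) : n.+1.-tuple R :=
  [tuple of rcons s (t - \sum_(k < n) tnth s k)].

Definition position d n (c t : R) (v : 'I_n.+1 -> d.-tuple R)
    (s : n.-tuple R) : d.-tuple R :=
  [tuple c * \sum_(k < n.+1) tnth (v k) l * tnth (durations t s) k | l < d].

Context {dO : measure_display} {Omega : measurableType dO}
  (P : probability Omega R).

(* Law of X under P conditioned on the event E, for P E > 0. *)
Definition cond_law d' (T : measurableType d') (X : {RV P >-> T})
    (E : set Omega) (A : set T) : \bar R :=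
  (fine (P (X @^-1` A `&` E)) / fine (P E))%:E.

(* Mutual independence of V_1, ..., V_(n+1), tau and N; subfamilies are
   covered by taking some of the sets to be full. *)
Definition mutually_independent d n (V : 'I_n.+1 -> {RV P >-> d.-tuple R})
    (tau : {RV P >-> n.-tuple R}) (N : {RV P >-> nat}) : Prop :=
  forall (B : 'I_n.+1 -> set (d.-tuple R)) (C : set (n.-tuple R)) (D : set nat),
    (forall k, measurable (B k)) -> measurable C -> measurable D ->
    P ((\bigcap_k (V k @^-1` B k)) `&` tau @^-1` C `&` N @^-1` D) =
    ((\prod_(k < n.+1) P (V k @^-1` B k)) * P (tau @^-1` C) * P (N @^-1` D))%E.

End motion.

Definition conditional_density (R : realType) (d n j : nat) (c t : R)
    (x : d.-tuple R) : R :=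
  Gamma ((n.+1)%:R * (d%:R / 2 - 1) + j%:R / 2 + 1)
  / Gamma (n%:R * (d%:R / 2 - 1) + j%:R / 2)
  * ((c ^+ 2 * t ^+ 2 - enorm x ^+ 2)
       `^ (n%:R * (d%:R / 2 - 1) + j%:R / 2 - 1)
     / (pi `^ (d%:R / 2) *
        (c * t) `^ (2 * (n.+1)%:R * (d%:R / 2 - 1) + j%:R))).

(* Main.v *)
(* All laws are compared through the transform f |-> E exp <f, X>. For V uniform
   on the sphere of R^d, E exp (u <f, V>) = Psi_d(u), where
     Psi_D(u) = sum_m (|f|^2 / 4)^m u^(2 m) / (m! (D/2)_m)
   is a modified Bessel function; conditionally on the durations the transform of
   the position is therefore prod_k Psi_d(c tau_k). Averaging over a generalized
   Dirichlet law amounts to iterated convolutions of functions u^(k/2-1) Psi_D(u),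
   and this family is stable under them for the relevant pairs (k, D), which comes
   down, coefficient by coefficient, to identities of Vandermonde, Rothe and Hagen.
   The transform of X is thus Psi_D(c t) with D = (n + 1) (d - 2) + j + 2. The same
   holds for the density proportional to (c^2 t^2 - |x|^2)^(l/2-1), where
   d + l = D. Finally the transform determines a law supported by a cube, because
   the indicator of x <= a is the limit on bounded sets of the combinations of
   exponentials (1 - e^(k^2 (x - a) - k) / N_k)^N_k for large N_k. *)
From HB Require Import structures.
Require Import Defs.
From mathcomp Require Import measurable_realfun ring lra zify.

Set Implicit Arguments.
Unset Strict Implicit.
Unset Printing Implicit Defensive.
Import Order.TTheory GRing.Theory Num.Theory.
Import numFieldNormedType.Exports.
Local Open Scope classical_set_scope.
Local Open Scope ring_scope.

(** * Rising factorials and Bessel coefficients *)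

(** Let [nhpow k t] be t^(k/2-1) / Gamma(k/2), extended by 0. Convolution adds the indices of these
    kernels, and u^(k/2-1) Psi_D(u) expands along [nhpow (k + 4 m)] with coefficients
    [bessel_coef (D/2) (k/2)], so a convolution becomes a Cauchy product. That product closes up in
    two regimes: k = D - 2 or k = D (Rothe, Hagen), and k = 2 D - 2 or k = 2 D (Vandermonde). The
    durations after the j-th are handled in the first regime, the first j in the second; the
    exponent b_j is exactly what carries k from one regime to the other, while i and h select the
    variant inside each. The same addition of indices replaces polar coordinates: integrals over R^d
    are computed one coordinate at a time, each square x_l^2 contributing the kernel of index 1. No
    Dirichlet normalizing constant is evaluated. Transforms are found up to a factor, which the
    value 1 at f = 0 then fixes. All exponents are half-integers, hence the indexing by doubled
    natural numbers. *)

Section rising.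
Context {R : numFieldType}.
Implicit Types (x y p q z : R) (m n r : nat).

Definition rising x m : R := \prod_(i < m) (x + i%:R).

Lemma rising0 x : rising x 0 = 1. Proof. exact: big_ord0. Qed.

Lemma risingSr x m : rising x m.+1 = rising x m * (x + m%:R).
Proof. by rewrite /rising big_ord_recr. Qed.

Lemma risingSl x m : rising x m.+1 = x * rising (x + 1) m.
Proof.
rewrite /rising big_ord_recl addr0; congr (_ * _); apply: eq_bigr => i _.
by rewrite lift0 -addn1 natrD; ring.
Qed.

Lemma risingD x m n : rising x (m + n) = rising x m * rising (x + m%:R) n.
Proof.
elim: n => [|n IH]; first by rewrite addn0 rising0 mulr1.
by rewrite addnS !risingSr IH natrD -mulrA addrA.
Qed.

Lemma rising_gt0 x m : 0 < x -> 0 < rising x m.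
Proof. by move=> x0; apply: prodr_gt0 => i _; rewrite ltr_wpDr. Qed.

Lemma rising_double x m :
  rising (2 * x) (2 * m) = 4 ^+ m * rising x m * rising (x + 2^-1) m.
Proof.
elim: m => [|m IH]; first by rewrite !rising0 !mulr1.
rewrite (_ : (2 * m.+1 = (2 * m).+2)%N); last by rewrite mulnS.
rewrite !risingSr IH exprS (_ : (2 * m).+1%:R = 2 * m%:R + 1); last first.
  by rewrite -addn1 natrD natrM.
by rewrite natrM; field.
Qed.

(* Abel-type addition theorem: both families solve the same difference
   equation in the parameter, so the two sides agree at all natural p, hence,
   being polynomial in p, everywhere. *)
Lemma poly_convolution (a F : nat -> {poly R}) (s : R) :
  a 0 = 1 -> (forall m, (a m.+1).[0] = 0) -> F 0 = 1 ->
  (forall m x, (a m.+1).[x] - (a m.+1).[x - 1] = (a m).[x + s]) ->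
  (forall m x, (F m.+1).[x] - (F m.+1).[x - 1] = (F m).[x + s]) ->
  forall m p q, \sum_(r < m.+1) (a r).[p] * (F (m - r)%N).[q] = (F m).[p + q].
Proof.
move=> a0 aS0 F0 ha hF; elim=> [|m IH] p q.
  by rewrite big_ord1 subnn a0 F0 !hornerC mulr1.
pose P := \sum_(r < m.+2) (F (m.+1 - r)%N).[q] *: a r - (F m.+1 \Po ('X + q%:P)).
have PE x : P.[x] =
    \sum_(r < m.+2) (a r).[x] * (F (m.+1 - r)%N).[q] - (F m.+1).[x + q].
  rewrite /P hornerD hornerN horner_sum horner_comp hornerD hornerX hornerC; congr (_ - _).
  by apply: eq_bigr => r _; rewrite hornerZ mulrC.
have PB x : P.[x] = P.[x - 1].
  have -> : P.[x] = P.[x - 1] + (P.[x] - P.[x - 1]) by ring.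
  rewrite !PE; set S' := \sum_(_ < _) _; set S := \sum_(_ < _) _.
  have SE : S - S' = (F m).[x + q + s].
    rewrite /S /S' -sumrB big_ord_recl a0 !hornerC subrr add0r.
    under eq_bigr => i _ do rewrite lift0 -mulrBl ha subSS.
    by rewrite IH addrAC.
  have := hF m (x + q); rewrite -SE => /eqP; rewrite subr_eq => /eqP ->.
  by rewrite [x - 1 + q]addrAC; ring.
have P0 (n : nat) : P.[n%:R] = 0.
  elim: n => [|n IHn]; last by rewrite PB -natr1 addrK.
  rewrite PE big_ord_recl a0 hornerC mul1r subn0 add0r.
  by rewrite big1 ?addr0 ?subrr// => i _; rewrite lift0 aS0 mul0r.
suff P0E : P = 0 by apply/eqP; rewrite -subr_eq0 -PE P0E horner0.
apply/eqP; case: (eqVneq P 0) => // Pn0.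
have := @max_poly_roots _ P [seq i%:R | i <- iota 0 (size P)] Pn0.
rewrite size_map size_iota ltnn; apply.
  by apply/allP => _ /mapP[i _ ->]; rewrite rootE P0.
rewrite map_inj_uniq ?iota_uniq// => i j /eqP.
by rewrite eqr_nat => /eqP.
Qed.

Definition rising_poly (c : R) m : {poly R} := \prod_(i < m) ('X + (c + i%:R)%:P).

Lemma horner_rising_poly c m x : (rising_poly c m).[x] = rising (x + c) m.
Proof.
rewrite /rising_poly horner_prod; apply: eq_bigr => i _.
by rewrite hornerD hornerX hornerC addrA.
Qed.

(** The difference equation a_(m+1)(x) - a_(m+1)(x-1) = a_m(x+s) is solved by the coefficients of
    B(w)^x with 1 - 1/B = w B^s. For s = 0 this is (1-w)^(-x), the Vandermonde family. For s = 1, B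
    is the Catalan series: B^x gives Rothe's x/(x+2m) C(x+2m, m), and B^x / sqrt(1-4w) gives Hagen's
    C(x+2m, m). *)
Let vandermonde_poly m := m`!%:R^-1 *: rising_poly 0 m.
Let rothe_poly m := if m is m'.+1 then
  m`!%:R^-1 *: ('X * rising_poly m.+1%:R m') else 1.
Let hagen_poly m := m`!%:R^-1 *: rising_poly m.+1%:R m.

Let fact_neq0 m : m`!%:R != 0 :> R.
Proof. by rewrite pnatr_eq0 -lt0n fact_gt0. Qed.

Let vandermonde_polyE m x : (vandermonde_poly m).[x] = rising x m / m`!%:R.
Proof. by rewrite hornerZ horner_rising_poly addr0 mulrC. Qed.

Let hagen_polyE m x : (hagen_poly m).[x] = rising (x + m.+1%:R) m / m`!%:R.
Proof. by rewrite hornerZ horner_rising_poly mulrC. Qed.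

Let rothe_polyE m x : (rothe_poly m.+1).[x] =
  x * rising (x + m.+2%:R) m / m.+1`!%:R.
Proof. by rewrite hornerZ hornerM hornerX horner_rising_poly mulrC. Qed.

Let vandermonde_diff m x :
  (vandermonde_poly m.+1).[x] - (vandermonde_poly m.+1).[x - 1] =
  (vandermonde_poly m).[x + 0].
Proof.
rewrite !vandermonde_polyE addr0 risingSr risingSl subrK factS natrM.
by field; rewrite fact_neq0 addrC natr1 pnatr_eq0.
Qed.

Let hagen_diff m x :
  (hagen_poly m.+1).[x] - (hagen_poly m.+1).[x - 1] = (hagen_poly m).[x + 1].
Proof.
rewrite !hagen_polyE risingSr risingSl factS natrM.
have -> : x - 1 + m.+2%:R + 1 = x + m.+2%:R by ring.
have -> : x + 1 + m.+1%:R = x + m.+2%:R by rewrite -[m.+2%:R]natr1; ring.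
rewrite -[m.+2%:R]natr1 -[m.+1%:R]natr1.
by field; rewrite fact_neq0 natr1 pnatr_eq0.
Qed.

Let rothe_diff m x :
  (rothe_poly m.+1).[x] - (rothe_poly m.+1).[x - 1] = (rothe_poly m).[x + 1].
Proof.
case: m => [|m]; first by rewrite !rothe_polyE hornerC !rising0 factS fact0 muln1; field.
rewrite !rothe_polyE risingSr risingSl.
rewrite factS natrM.
have -> : x - 1 + m.+3%:R + 1 = x + m.+3%:R by ring.
have -> : x + 1 + m.+2%:R = x + m.+3%:R by rewrite -[m.+3%:R]natr1; ring.
rewrite -[m.+3%:R]natr1 -[m.+2%:R]natr1 -[m.+1%:R]natr1.
by field; rewrite fact_neq0 !natr1 pnatr_eq0.
Qed.

(* m-th coefficient of [E (1 - <f, Y>)^(- x)], z = |f|^2, when Y has the law of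
   the projection of a uniform point of the sphere of dimension 2 y. *)
Definition bessel_coef (y x z : R) m : R :=
  rising x (2 * m) * (z / 4) ^+ m / (m`!%:R * rising y m).

(** Duplication splits (x)_(2m) into 4^m (x/2)_m (x/2+1/2)_m. In the two cases allowed one of the
    factors is (y)_m and cancels the denominator; 4^m cancels the 4 under z. *)
Let bessel_coef_vandermonde y x z m : 0 < y ->
    x = 2 * y - 1 \/ x = 2 * y ->
  bessel_coef y x z m = z ^+ m * (vandermonde_poly m).[x - y + 2^-1].
Proof.
move=> y0 xy; have ym : rising y m != 0 by rewrite gt_eqF// rising_gt0.
rewrite vandermonde_polyE /bessel_coef expr_div_n.
have n4 : 4 ^+ m != 0 :> R by rewrite expf_neq0// pnatr_eq0.
case: xy => ->.
  have -> : 2 * y - 1 = 2 * (y - 2^-1) :> R by field.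
  rewrite rising_double subrK.
  have -> : 2 * (y - 2^-1) - y + 2^-1 = y - 2^-1 by field.
  by move: (4 ^+ m) (z ^+ m) n4 => u v n4; field; rewrite ym n4 fact_neq0.
rewrite rising_double.
have -> : 2 * y - y + 2^-1 = y + 2^-1 by field.
by move: (4 ^+ m) (z ^+ m) n4 => u v n4; field; rewrite ym n4 fact_neq0.
Qed.

(** Here (p)_(2m) = p (p+1)_m (p+m+1)_(m-1) for m > 0, and the middle factor is the denominator. *)
Let bessel_coef_rothe p z m : 0 < p ->
  bessel_coef (p + 1) p z m = (z / 4) ^+ m * (rothe_poly m).[p].
Proof.
move=> p0; have ym k : rising (p + 1) k != 0 by rewrite gt_eqF// rising_gt0// addr_gt0.
case: m => [|m]; first by rewrite /bessel_coef hornerC !rising0 fact0; field.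
rewrite rothe_polyE /bessel_coef mulnS addSn risingSl.
have -> : (1 + 2 * m = m.+1 + m)%N by rewrite mul2n -addnn addnA.
have := ym m.+1.
rewrite risingD -addrA -[1 + m.+1%:R]addrC natr1 => h.
by field; rewrite h fact_neq0.
Qed.

Let bessel_coef_hagen p z m : 0 <= p ->
  bessel_coef (p + 1) (p + 1) z m = (z / 4) ^+ m * (hagen_poly m).[p].
Proof.
move=> p0; have ym k : rising (p + 1) k != 0.
  by rewrite gt_eqF// rising_gt0// ltr_wpDl.
have := ym m; rewrite hagen_polyE /bessel_coef mul2n -addnn risingD => h.
rewrite -addrA -[1 + m%:R]addrC natr1.
by field; rewrite h fact_neq0.
Qed.

Let bessel_coef_convolution y1 x1 y2 x2 y3 x3 z w (a F : nat -> {poly R}) p q s :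
  (forall m, bessel_coef y1 x1 z m = w ^+ m * (a m).[p]) ->
  (forall m, bessel_coef y2 x2 z m = w ^+ m * (F m).[q]) ->
  (forall m, bessel_coef y3 x3 z m = w ^+ m * (F m).[p + q]) ->
  a 0 = 1 -> (forall m, (a m.+1).[0] = 0) -> F 0 = 1 ->
  (forall m x, (a m.+1).[x] - (a m.+1).[x - 1] = (a m).[x + s]) ->
  (forall m x, (F m.+1).[x] - (F m.+1).[x - 1] = (F m).[x + s]) ->
  forall m, \sum_(r < m.+1) bessel_coef y1 x1 z r * bessel_coef y2 x2 z (m - r) =
  bessel_coef y3 x3 z m.
Proof.
move=> h1 h2 h3 a0 aS0 F0 ha hF m.
rewrite h3 -(poly_convolution a0 aS0 F0 ha hF) mulr_sumr.
apply: eq_bigr => r _; rewrite h1 h2 mulrACA -exprD subnKC//.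
by rewrite -ltnS ltn_ord.
Qed.

Let vandermonde_poly0 : vandermonde_poly 0 = 1.
Proof. by rewrite /vandermonde_poly /rising_poly big_ord0 fact0 invr1 scale1r. Qed.

Let vandermonde_polyS0 m : (vandermonde_poly m.+1).[0] = 0.
Proof. by rewrite vandermonde_polyE risingSl !mul0r. Qed.

Let hagen_poly0 : hagen_poly 0 = 1.
Proof. by rewrite /hagen_poly /rising_poly big_ord0 fact0 invr1 scale1r. Qed.

Let rothe_polyS0 m : (rothe_poly m.+1).[0] = 0.
Proof. by rewrite rothe_polyE !mul0r. Qed.

(** Rothe with Rothe: the regime k = D - 2 is stable. *)
Lemma bessel_coef_addl p q z m : 0 < p -> 0 < q ->
  \sum_(r < m.+1) bessel_coef (p + 1) p z r * bessel_coef (q + 1) q z (m - r) =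
  bessel_coef (p + q + 1) (p + q) z m.
Proof.
move=> p0 q0; apply: (bessel_coef_convolution (p := p) (q := q) (s := 1) (w := z / 4)
  (a := rothe_poly) (F := rothe_poly)) => // k.
- exact: bessel_coef_rothe.
- exact: bessel_coef_rothe.
- by apply: bessel_coef_rothe; rewrite addr_gt0.
Qed.

(** Rothe with Hagen: k = D - 2 against k = D gives k = D. *)
Lemma bessel_coef_addr p q z m : 0 < p -> 0 <= q ->
  \sum_(r < m.+1) bessel_coef (p + 1) p z r *
                  bessel_coef (q + 1) (q + 1) z (m - r) =
  bessel_coef (p + q + 1) (p + q + 1) z m.
Proof.
move=> p0 q0; apply: (bessel_coef_convolution (p := p) (q := q) (s := 1) (w := z / 4)
  (a := rothe_poly) (F := hagen_poly)) => // k.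
- exact: bessel_coef_rothe.
- exact: bessel_coef_hagen.
- by apply: bessel_coef_hagen; rewrite addr_ge0// ltW.
Qed.

(** Vandermonde: k = 2 D - 2 against k = 2 D - 2 or k = 2 D reproduces the type of the second
    factor. *)
Lemma bessel_coef_double y1 y2 x2 z m : 2^-1 < y1 -> 0 < y2 ->
  x2 = 2 * y2 - 1 \/ x2 = 2 * y2 ->
  \sum_(r < m.+1) bessel_coef y1 (2 * y1 - 1) z r * bessel_coef y2 x2 z (m - r) =
  bessel_coef (y1 + y2 - 2^-1) (2 * y1 - 1 + x2) z m.
Proof.
move=> y10 y20 hx2; have i20 : 0 < 2^-1 :> R by rewrite invr_gt0.
pose p := (2 * y1 - 1) - y1 + 2^-1; pose q := x2 - y2 + 2^-1.
apply: (bessel_coef_convolution (p := p) (q := q) (s := 0) (w := z)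
  (a := vandermonde_poly) (F := vandermonde_poly)) => // k.
- by apply: bessel_coef_vandermonde; [rewrite (lt_trans _ y10)|left].
- exact: bessel_coef_vandermonde.
- have -> : p + q = 2 * y1 - 1 + x2 - (y1 + y2 - 2^-1) + 2^-1.
    by rewrite /p /q; field.
  apply: bessel_coef_vandermonde.
    by rewrite addrAC addr_gt0// subr_gt0.
  by case: hx2 => ->; [left|right]; field.
Qed.

End rising.

(** * Measures with a density *)

Section density.
Local Open Scope ereal_scope.
Context d (T : measurableType d) (R : realType).
Variables (mu : {measure set T -> \bar R}) (f : T -> R).
Hypotheses (mf : measurable_fun [set: T] f) (f0 : forall x, (0 <= f x)%R).

(** The two proofs are arguments, so that the term itself carries what its measure structure
    requires. *)
Definition density_measure of measurable_fun [set: T] f & (forall x, (0 <= f x)%R) :=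
  fun A => \int[mu]_(x in A) (f x)%:E.
Local Notation nu := (density_measure mf f0).

Let nu0 : nu set0 = 0. Proof. exact: integral_set0. Qed.

Let nu_ge0 A : 0 <= nu A.
Proof. by apply: integral_ge0 => x _; rewrite lee_fin. Qed.

Let nu_sigma_additive : semi_sigma_additive nu.
Proof.
move=> F mF tF mUF; rewrite /density_measure ge0_integral_bigcup//=.
- by apply: is_cvg_ereal_nneg_natsum => n _; exact: nu_ge0.
- exact/measurable_funTS/measurable_EFinP.
- by move=> x _; rewrite lee_fin.
Qed.

HB.instance Definition _ := isMeasure.Build _ _ _ nu nu0 nu_ge0 nu_sigma_additive.


Import HBNNSimple.

Lemma ge0_integral_density (g : T -> \bar R) : measurable_fun [set: T] g ->
  (forall x, 0 <= g x) -> \int[nu]_x g x = \int[mu]_x (g x * (f x)%:E).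
Proof.
move=> mg g0; pose h := nnsfun_approx measurableT mg.
have gE x : g x = lim ((h n x)%:E @[n --> \oo]).
  by apply/esym/cvg_lim => //; exact: cvg_nnsfun_approx.
have h_nd x : {homo (fun n => (h n x)%:E) : m n / (m <= n)%N >-> m <= n}.
  by move=> m n mn; rewrite lee_fin; exact/lefP/nd_nnsfun_approx.
have -> : \int[nu]_x g x = limn (fun n => \int[nu]_x (h n x)%:E).
  under eq_integral do rewrite gE.
  apply: monotone_convergence => //.
  - by move=> n; exact/measurable_EFinP.
  - by move=> n x _; rewrite lee_fin.
transitivity (\int[mu]_x lim ((h n x)%:E * (f x)%:E @[n --> \oo])); last first.
  apply: eq_integral => x _; apply/cvg_lim => //.
  by apply: cvgeZr => //; exact: cvg_nnsfun_approx.
have -> : \int[mu]_x limn (fun n => (h n x)%:E * (f x)%:E) =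
    limn (fun n => \int[mu]_x ((h n x)%:E * (f x)%:E)).
  apply: monotone_convergence => //.
  - by move=> n; apply: emeasurable_funM; exact/measurable_EFinP.
  - by move=> n x _; rewrite mule_ge0// lee_fin.
  - by move=> x _ m n mn; rewrite lee_wpmul2r ?lee_fin// -lee_fin; exact: h_nd.
apply/congr_lim/funext => n.
transitivity (\int[nu]_x (\sum_(y \in range (h n))
   (y * \1_(h n @^-1` [set y]) x)%:E)).
  by apply: eq_integral => t tE; rewrite fimfunE -fsumEFin.
have mind r : measurable_fun [set: T] (fun x => (r * \1_(h n @^-1` [set r]) x)%:E).
  by apply/measurable_EFinP; exact: measurable_funM.
rewrite ge0_integral_fsum//; last by move=> y x _; exact: nnfun_muleindic_ge0.
transitivity (\int[mu]_x (\sum_(y \in range (h n))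
    ((y * \1_(h n @^-1` [set y]) x)%:E * (f x)%:E))); last first.
  apply: eq_integral => x _; rewrite -ge0_mule_fsuml => [|y]; last first.
    exact: nnfun_muleindic_ge0.
  by rewrite fsumEFin// -fimfunE.
rewrite ge0_integral_fsum//; last 2 first.
- by move=> y; apply: emeasurable_funM => //; exact/measurable_EFinP.
- by move=> y x _; rewrite mule_ge0 ?lee_fin// -lee_fin EFinM nnfun_muleindic_ge0.
apply: eq_fsbigr => r rhn.
have r0 : (0 <= r)%R by move: rhn; rewrite inE => -[x _ <-].
rewrite integralZl_indic_nnsfun// integral_indic// setIT.
under eq_integral do rewrite EFinM -muleA.
rewrite ge0_integralZl//; last 2 first.
- by apply: emeasurable_funM; exact/measurable_EFinP.
- by move=> x _; rewrite mule_ge0// lee_fin.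
congr (_ * _); rewrite /= /density_measure integral_mkcond.
apply: eq_integral => x _; rewrite epatch_indic muleC.
by [].
Qed.

End density.

Section density_transfer.
Local Open Scope ereal_scope.
Context d1 d2 (T1 : measurableType d1) (T2 : measurableType d2) (R : realType).
Variables (mu : {measure set T1 -> \bar R}) (nu : {measure set T2 -> \bar R}).

(** Change of measure and change of variable at once: [nu] is the image under [phi] of the measure
    with density [f]. *)
Lemma ge0_integral_density_transfer (phi : T1 -> T2) (f : T1 -> R)
    (g : T2 -> \bar R) :
  measurable_fun [set: T1] phi ->
  measurable_fun [set: T1] f -> (forall x, (0 <= f x)%R) ->
  (forall A, measurable A -> nu A = \int[mu]_(x in phi @^-1` A) (f x)%:E) ->
  measurable_fun [set: T2] g -> (forall x, 0 <= g x) ->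
  \int[nu]_y g y = \int[mu]_x (g (phi x) * (f x)%:E).
Proof.
move=> mphi mf f0 nuE mg g0.
pose D : {measure set T1 -> \bar R} := density_measure mu mf f0.
transitivity (\int[pushforward D phi]_y g y).
  by apply: eq_measure_integral => A mA _; rewrite nuE.
rewrite ge0_integral_pushforward// preimage_setT.
rewrite /D ge0_integral_density//; first exact: measurableT_comp.
by move=> x; exact: g0.
Qed.

Lemma ge0_integral_transfer (phi : T1 -> T2) (g : T2 -> \bar R) :
  measurable_fun [set: T1] phi ->
  (forall A, measurable A -> nu A = mu (phi @^-1` A)) ->
  measurable_fun [set: T2] g -> (forall x, 0 <= g x) ->
  \int[nu]_y g y = \int[mu]_x g (phi x).
Proof.
move=> mphi nuE mg g0.
transitivity (\int[pushforward mu phi]_y g y).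
  by apply: eq_measure_integral => A mA _; rewrite nuE.
by rewrite ge0_integral_pushforward// preimage_setT.
Qed.

End density_transfer.

Lemma tonelli_swap d1 d2 (T1 : measurableType d1) (T2 : measurableType d2)
    (R : realType) (m1 : {sigma_finite_measure set T1 -> \bar R})
    (m2 : {sigma_finite_measure set T2 -> \bar R}) (f : T1 -> T2 -> \bar R) :
  measurable_fun [set: T1 * T2] (fun p => f p.1 p.2) ->
  (forall x y, 0 <= f x y)%E ->
  (\int[m1]_x \int[m2]_y f x y = \int[m2]_y \int[m1]_x f x y)%E.
Proof.
by move=> mf f0; apply: (fubini_tonelli (fun p => f p.1 p.2)) => // -[].
Qed.

(** * Changes of variable on the line *)

Section substitution.
Context (R : realType).
Local Notation mu := (@lebesgue_measure R).
Implicit Types g : R -> \bar R.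

(** Lebesgue measure is determined by its values on the intervals ]a, b]. The hypothesis on these
    thus identifies it with the image under [phi] of f dx, and every nonnegative [g] follows. *)
Lemma ge0_integral_substitution (phi f : R -> R) g :
  measurable_fun [set: R] phi -> measurable_fun [set: R] f ->
  (forall x, 0 <= f x) ->
  (forall a b, a < b ->
    (\int[mu]_(x in phi @^-1` `]a, b]) (f x)%:E = (b - a)%:E)%E) ->
  measurable_fun [set: R] g -> (forall x, 0 <= g x)%E ->
  (\int[mu]_y g y = \int[mu]_x (g (phi x) * (f x)%:E))%E.
Proof.
move=> mphi mf f0 hab mg g0.
apply: ge0_integral_density_transfer => // A mA.
pose D : {measure set (measurableTypeR R) -> \bar R} := density_measure mu mf f0.
have mphi' : measurable_fun [set: measurableTypeR R]
  (phi : measurableTypeR R -> measurableTypeR R) by [].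
transitivity (pushforward D (phi : measurableTypeR R -> measurableTypeR R) A) => //.
apply: lebesgue_measure_unique => //= _ [[a b]] _ <-.
rewrite /pushforward /D /density_measure/= lebesgue_measure_itv/= lte_fin.
case: ltP => [ab|ba]; first by rewrite hab.
by rewrite set_itv_ge ?preimage_set0 ?integral_set0// bnd_simp -leNgt.
Qed.

Lemma ge0_integral_shift g a :
  measurable_fun [set: R] g -> (forall x, 0 <= g x)%E ->
  (\int[mu]_x g (x + a)%R = \int[mu]_x g x)%E.
Proof.
move=> mg g0; rewrite [RHS](@ge0_integral_substitution (+%R^~ a) (cst 1))//=.
- by apply: eq_integral => x _; rewrite mule1.
- exact: measurable_funD.
- move=> p q pq; rewrite integral_cst/=; last first.
    by rewrite -[X in measurable X]setTI; apply: measurable_funD.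
  rewrite (_ : _ @^-1` _ = `]p - a, q - a]%classic); last first.
    by apply/seteqP; split => x /=; rewrite !in_itv/= ltrBlDr lerBrDr.
  rewrite mul1e lebesgue_measure_itv/= lte_fin ltrD2r pq -EFinB.
  by congr _%:E; ring.
Qed.

Lemma ge0_integral_opp g :
  measurable_fun [set: R] g -> (forall x, 0 <= g x)%E ->
  (\int[mu]_x g (- x)%R = \int[mu]_x g x)%E.
Proof.
move=> mg g0; rewrite [RHS](@ge0_integral_substitution -%R (cst 1))//=.
- by apply: eq_integral => x _; rewrite mule1.
- move=> p q pq; rewrite integral_cst/=; last first.
    by rewrite -[X in measurable X]setTI; exact: oppr_measurable.
  rewrite opp_preimage_itvbndbnd/= mul1e lebesgue_measure_itv/= lte_fin.
  by rewrite ltrN2 pq opprK addrC.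
Qed.

Lemma ge0_integral_scale g c : 0 < c ->
  measurable_fun [set: R] g -> (forall x, 0 <= g x)%E ->
  (\int[mu]_x (g (c * x)%R * c%:E) = \int[mu]_x g x)%E.
Proof.
move=> c0 mg g0; rewrite [RHS](@ge0_integral_substitution ( *%R c) (cst c))//=.
- by move=> _; exact: ltW.
- move=> p q pq; rewrite integral_cst/=; last first.
    by rewrite -[X in measurable X]setTI; apply: mulrl_measurable.
  rewrite (_ : _ @^-1` _ = `]p / c, q / c]%classic); last first.
    by apply/seteqP; split => x /=; rewrite !in_itv/= ltr_pdivrMr// ler_pdivlMr// ![x * c]mulrC.
  rewrite lebesgue_measure_itv/= lte_fin ltr_pM2r ?invr_gt0// pq -EFinB -EFinM.
  by rewrite mulrBr ![c * _]mulrC !divfK ?gt_eqF.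
Qed.

(** A signed square is an increasing bijection of the whole line, so y = x^2 becomes a global
    substitution, with density 2|x|. *)
Definition ssqr (x : R) : R := x * `|x|.

Lemma is_derive_ssqr (x : R) : is_derive x 1 ssqr (2 * `|x|).
Proof.
have sq c : is_derive x 1 (fun y : R => c * y ^+ 2) (2 * c * x).
  have := is_deriveZ c (is_deriveX 2 (is_derive_id x (1 : R))).
  by rewrite (_ : c *: _ = 2 * c * x)// /GRing.scale/= expr1 mulr1; ring.
have [x0|x0|x0] := ltgtP x 0.
- rewrite ltr0_norm// mulrN -mulNr -[- 2]mulrN1.
  apply: near_eq_is_derive (sq (- 1)).
  near=> y; rewrite /ssqr ltr0_norm ?mulrN ?mulN1r//.
  by near: y; exact: lt_nbhsl.
- rewrite gtr0_norm//; have := sq 1; rewrite mulr1.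
  apply: near_eq_is_derive.
  near=> y; rewrite /ssqr gtr0_norm ?mul1r//.
  by near: y; exact: lt_nbhsr.
(* At 0 the difference quotient is exactly |h|. *)
- have lim : (fun h : R => h^-1 *: (ssqr (h *: 1 + x) - ssqr x)) @ 0^' --> (2 * `|x| : R).
    rewrite x0 normr0 mulr0 /ssqr mul0r.
    apply: (@cvg_trans _ ((fun h : R => `|h|) @ 0^')).
      apply: near_eq_cvg; near=> h; rewrite subr0 addr0 [_%:A]mulr1.
      rewrite /GRing.scale/= mulKf//.
      by near: h; exact: nbhs_dnbhs_neq.
    apply: (@cvg_trans _ ((fun h : R => `|h|) @ nbhs (0 : R))).
      exact/cvg_app/cvg_within.
    by have := @norm_continuous _ _ (0 : R); rewrite /continuous_at normr0.
  by split; [apply/cvg_ex; exists (2 * `|x|)|exact/cvg_lim].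
Unshelve. all: by end_near. Qed.

Lemma ssqr_le : {mono ssqr : x y / x <= y}.
Proof.
move=> x y; rewrite /ssqr.
case: (leP 0 x) => x0; case: (leP 0 y) => y0.
- by rewrite !ger0_norm// -!expr2 ler_sqr.
- rewrite ger0_norm// ltr0_norm// leNgt [RHS]leNgt (lt_le_trans y0 x0).
  by rewrite mulrN (@lt_le_trans _ _ 0)// ?mulr_ge0// oppr_lt0 nmulr_rgt0.
- rewrite ltr0_norm// ger0_norm// (ltW (lt_le_trans x0 y0)).
  by rewrite mulrN (@le_trans _ _ 0)// ?mulr_ge0// oppr_le0 nmulr_rge0// ltW.
- rewrite !ltr0_norm// !mulrN lerN2 -!expr2 -[y ^+ 2]sqrrN -[x ^+ 2]sqrrN.
  by rewrite ler_sqr ?lerN2// nnegrE oppr_ge0 ltW.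
Qed.

Lemma ssqr_lt : {mono ssqr : x y / x < y}.
Proof. exact/leW_mono/ssqr_le. Qed.

Lemma ssqr_surj y : exists x, ssqr x = y.
Proof.
exists (Num.sg y * Num.sqrt `|y|); rewrite /ssqr normrM normr_sg.
have [->|y0] := eqVneq y 0; first by rewrite sgr0 !mul0r.
rewrite mul1r [`|Num.sqrt _|]ger0_norm ?sqrtr_ge0// -mulrA -expr2 sqr_sqrtr//.
by rewrite -numEsg.
Qed.

Lemma ge0_integral_ssqr g :
  measurable_fun [set: R] g -> (forall x, 0 <= g x)%E ->
  (\int[mu]_y g y = \int[mu]_x (g (ssqr x) * (2 * `|x|)%:E))%E.
Proof.
move=> mg g0; apply: ge0_integral_substitution => //.
- exact: measurable_funM.
- by apply: measurable_funM => //; exact: normr_measurable.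
- move=> a b; have [p <-] := ssqr_surj a; have [q <-] := ssqr_surj b.
  rewrite ssqr_lt => pq.
  rewrite (_ : _ @^-1` _ = `]p, q]%classic); last first.
    by apply/seteqP; split => x /=; rewrite !in_itv/= ssqr_lt ssqr_le.
  rewrite integral_itv_obnd_cbnd; last first.
    apply/measurable_funTS/measurable_EFinP.
    by apply: measurable_funM => //; exact: normr_measurable.
  rewrite EFinB; apply: continuous_FTC2 => //.
  - apply: continuous_subspaceT => x.
    by apply: cvgM; [exact: cvg_cst|exact: norm_continuous].
  - have cF x : {for x, continuous ssqr}.
      apply/differentiable_continuous/derivable1_diffP.
      by have [] := is_derive_ssqr x.
    split.
    + by move=> x _; have [] := is_derive_ssqr x.
    + exact/cvg_at_right_filter/cF.
    + exact/cvg_at_left_filter/cF.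
  - move=> x _; rewrite derive1E.
    by have [_ ->] := is_derive_ssqr x.
Qed.

End substitution.

(** * Half-integer Gamma and Beta integrals *)

(* Half-integer parameters are represented by their doubles; the definitions are
   locked because comparing two instances up to conversion is very slow. *)
HB.lock Definition hpow (R : realType) (k : nat) (x : R) : R :=
  if 0 < x then x `^ (k%:R / 2 - 1) else 0.

HB.lock Definition eGamma (R : realType) (k : nat) : \bar R :=
  (\int[@lebesgue_measure R]_u (hpow k u * expR (- u))%:E)%E.

HB.lock Definition eBeta (R : realType) (k l : nat) : \bar R :=
  (\int[@lebesgue_measure R]_s (hpow k s * hpow l (1 - s))%:E)%E.

Section half_powers.
Context (R : realType).
Local Notation mu := (@lebesgue_measure R).
Implicit Types (x s t : R) (k l m : nat).

(** Strict positivity of the Gamma and Beta integrals is needed before finiteness is known, in order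
    to cancel them in the extended reals. *)
Lemma ge0_integral_gt0 (f : R -> R) (a b : R) : a < b ->
  measurable_fun [set: R] f -> (forall x, 0 <= f x) ->
  (forall x, a < x < b -> 0 < f x) -> (0 < \int[mu]_x (f x)%:E)%E.
Proof.
move=> ab mf f0 fab; rewrite lt0e integral_ge0 ?andbT; last first.
  by move=> x _; rewrite lee_fin.
apply/eqP => int0.
have mEf : measurable_fun [set: R] (EFin \o f) by exact/measurable_EFinP.
have [+ _] := ae_eq_integral_abs mu measurableT mEf.
under eq_integral do rewrite /= ger0_norm//.
move=> /(_ int0) ae0.
have : mu.-negligible `]a, b[%classic.
  apply: negligibleS ae0 => x /=; rewrite in_itv/= => /fab fx.
  by apply/not_implyP; split => //= -[] /eqP; rewrite gt_eqF.
move=> ab0; have : mu `]a, b[%classic = 0%E by apply: measure_negligible.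
rewrite lebesgue_measure_itv/= lte_fin ab => /eqP.
by rewrite -EFinB eqe subr_eq0 gt_eqF.
Qed.

Lemma hpowE k x : hpow k x = if 0 < x then x `^ (k%:R / 2 - 1) else 0.
Proof. by rewrite hpow.unlock. Qed.

Lemma hpow_ge0 k x : 0 <= hpow k x.
Proof. by rewrite hpowE; case: ifP => // _; exact: powR_ge0. Qed.

Lemma hpow_gt0 k x : 0 < x -> 0 < hpow k x.
Proof. by move=> x0; rewrite hpowE x0 powR_gt0. Qed.

Lemma hpow_le0 k x : x <= 0 -> hpow k x = 0.
Proof. by rewrite hpowE leNgt => /negbTE ->. Qed.

Lemma measurable_hpow k : measurable_fun [set: R] (hpow k).
Proof.
rewrite (_ : hpow k = fun x => if 0 < x then x `^ (k%:R / 2 - 1) else 0).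
  by apply: measurable_fun_ifT => //; exact: measurable_fun_ltr.
by apply/funext => x; rewrite hpowE.
Qed.

(** Index 2 is the indicator of the positive half-line; the constraints of the simplex and of the
    ball are written with it. *)
Lemma hpow2 x : hpow 2 x = (0 < x)%R%:R.
Proof. by rewrite hpowE divff// subrr powRr0; case: ifP. Qed.

Lemma hpowM k l m x : (k + l = m + 2)%N -> hpow k x * hpow l x = hpow m x.
Proof.
move=> klm; rewrite !hpowE; case: ltP => x0; last by rewrite mulr0.
rewrite -powRD; last by rewrite (gt_eqF x0) implybT.
have : k%:R + l%:R = m%:R + 2 :> R by rewrite -!natrD klm.
by move=> h; congr (_ `^ _); lra.
Qed.

Lemma hpowX k m x : hpow k x * x ^+ m = hpow (k + 2 * m) x.
Proof.
rewrite -(@hpowM k (2 * m).+2 (k + 2 * m)); last by lia.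
rewrite !hpowE; case: ltP => x0; last by rewrite !mul0r.
rewrite -powR_mulrn ?(ltW x0)//; congr (_ * _ `^ _).
by rewrite -[in RHS]addn2 natrD natrM; field.
Qed.

Lemma hpowS2 k x : hpow k.+2 x = hpow k x * x.
Proof. by rewrite -[in RHS](expr1 x) hpowX -addn2 muln1. Qed.

Lemma hpow_scale k t x : 0 < t -> hpow k (t * x) = t `^ (k%:R / 2 - 1) * hpow k x.
Proof.
move=> t0; rewrite !hpowE pmulr_rgt0//; case: ltP => x0; last by rewrite mulr0.
by rewrite powRM// ltW.
Qed.

(** Each half-line contributes half of the right-hand side under y = x^2, and x^(2m) dx produces the
    exponent m - 1/2 = (2m+1)/2 - 1. *)
Lemma ge0_integral_even_sqr m (phi : R -> \bar R) :
  measurable_fun [set: R] phi -> (forall x, 0 <= phi x)%E ->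
  (\int[mu]_x ((x ^+ (2 * m))%:E * phi (x ^+ 2)%R) =
   \int[mu]_y ((hpow (2 * m).+1 y)%:E * phi y))%E.
Proof.
move=> mphi phi0.
pose F (x : R) := ((x ^+ (2 * m))%:E * phi (x ^+ 2)%R)%E.
have F0 x : (0 <= F x)%E by rewrite mule_ge0// lee_fin exprM exprn_ge0// sqr_ge0.
have mF : measurable_fun [set: R] F.
  apply: emeasurable_funM; first exact/measurable_EFinP.
  exact: measurableT_comp.
pose P (x : R) := ((if 0 < x then 1 else 0)%:E * F x)%E.
have mP : measurable_fun [set: R] P.
  apply: emeasurable_funM => //; apply/measurable_EFinP.
  by apply: measurable_fun_ifT => //; exact: measurable_fun_ltr.
have P0 x : (0 <= P x)%E by rewrite mule_ge0// lee_fin; case: ifP.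
transitivity (\int[mu]_x (P x + P (- x)%R))%E.
  (* The origin belongs to neither half-line and is removed as a null set. *)
  rewrite -[LHS](@integral_setD1 _ _ 0) ?setTD//; last 2 first.
    exact: measurableC.
    exact: measurable_funTS.
  rewrite integral_mkcond; apply: eq_integral => x _; rewrite patchE.
  have [->|x0] := eqVneq x 0.
    rewrite /P ltxx oppr0 ltxx !mul0e adde0.
    by rewrite memNset// => /(_ erefl).
  rewrite ifT; last by rewrite inE/=; exact/eqP.
  rewrite /P /F sqrrN (exprM (- x)) sqrrN -exprM oppr_gt0.
  by case: (ltgtP x 0) x0 => // x0 _; rewrite mul1e mul0e ?(adde0, add0e).
have mPN : measurable_fun [set: R] (P \o -%R) by exact: measurableT_comp.
rewrite ge0_integralD// ge0_integral_opp//.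
rewrite [RHS]ge0_integral_ssqr; last 2 first.
- apply: emeasurable_funM => //; apply/measurable_EFinP.
  exact: measurable_hpow.
- by move=> y; rewrite mule_ge0// lee_fin hpow_ge0.
rewrite -ge0_integralD//; apply: eq_integral => x _.
rewrite /P /F; case: ltP => x0; last first.
  by rewrite hpow_le0 ?mul0e ?adde0// mulr_le0_ge0.
rewrite mul1e /ssqr gtr0_norm// -expr2 muleAC -EFinM.
rewrite (_ : hpow _ _ * _ = 2 * x ^+ (2 * m)); last first.
  rewrite -addn1 addnC -(@hpowX 1) -exprM mulrAC mulrA; congr (_ * _).
  rewrite hpowE exprn_gt0// mulrAC mul1r (_ : 2^-1 - 1 = - 2^-1); last by field.
  rewrite powRN powR12_sqrt ?sqr_ge0// sqrtr_sqr gtr0_norm// mulVf ?gt_eqF//.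
  by rewrite mul1r.
by rewrite -ge0_muleDl ?lee_fin ?exprn_ge0 ?(ltW x0)// -EFinD mulr_natl.
Qed.

Let eGammaE k : eGamma R k = (\int[mu]_u (hpow k u * expR (- u))%:E)%E.
Proof. by rewrite eGamma.unlock. Qed.

Let eBetaE' k l : eBeta R k l = (\int[mu]_s (hpow k s * hpow l (1 - s))%:E)%E.
Proof. by rewrite eBeta.unlock. Qed.

Definition hGamma k : R := fine (eGamma R k).

Let measurable_hpowB l t : measurable_fun [set: R] (fun s => hpow l (t - s)).
Proof.
apply: (measurableT_comp (@measurable_hpow l)).
by apply: measurable_funB.
Qed.

Let measurable_hpowBM k l t :
  measurable_fun [set: R] (fun s => hpow k s * hpow l (t - s)).
Proof. by apply: measurable_funM => //; exact: measurable_hpow. Qed.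

Let measurable_exphpow k : measurable_fun [set: R] (fun u => hpow k u * expR (- u)).
Proof.
apply: measurable_funM; first exact: measurable_hpow.
by apply: measurableT_comp.
Qed.

Let mconv k l t :
  measurable_fun [set: R] (fun s => (hpow k s * hpow l (t - s))%:E).
Proof. by apply/measurable_EFinP; exact: measurable_hpowBM. Qed.

Let conv_ge0 k l t s : (0 <= (hpow k s * hpow l (t - s))%:E)%E.
Proof. by rewrite lee_fin mulr_ge0 ?hpow_ge0. Qed.

Let mgam k : measurable_fun [set: R] (fun u => (hpow k u * expR (- u))%:E).
Proof. by apply/measurable_EFinP; exact: measurable_exphpow. Qed.

Let gam_ge0 k s : (0 <= (hpow k s * expR (- s))%:E)%E.
Proof. by rewrite lee_fin mulr_ge0 ?hpow_ge0 ?expR_ge0. Qed.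

Lemma hpow_conv_eBeta k l t :
  (\int[mu]_s (hpow k s * hpow l (t - s))%:E = (hpow (k + l) t)%:E * eBeta R k l)%E.
Proof.
have [t0|t0] := ltP 0 t; last first.
  rewrite hpow_le0// mul0e integral0_eq// => s _; congr EFin.
  have [s0|s0] := leP s 0; first by rewrite hpow_le0 ?mul0r.
  by rewrite [hpow l _]hpow_le0 ?mulr0// subr_le0 (le_trans t0)// ltW.
rewrite -[LHS](@ge0_integral_scale _ _ t)//.
rewrite eBetaE' -ge0_integralZl//; [|exact: mconv|by rewrite lee_fin hpow_ge0].
apply: eq_integral => s _; rewrite -!EFinM; congr EFin.
rewrite -{2}[t]mulr1 -mulrBr !hpow_scale//.
rewrite -(@hpowM k l.+2 (k + l)); last by lia.
have tE j : t `^ (j%:R / 2 - 1) = hpow j t by rewrite !hpowE t0.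
rewrite (hpowS2 l t) !tE.
move: (hpow k t) (hpow l t) (hpow k s) (hpow l _) => a b u v.
by ring.
Qed.

(** In the double integral defining the product, the sum of the two variables becomes the outer
    variable; the inner integral is then the convolution computed above. The identity lives in the
    extended reals, where it needs no finiteness. *)
Lemma eGammaM k l : (eGamma R k * eGamma R l = eBeta R k l * eGamma R (k + l))%E.
Proof.
have m3 : measurable_fun [set: R * R] (fun p : R * R =>
    (hpow k p.1 * hpow l (p.2 - p.1) * expR (- p.2))%:E).
  apply/measurable_EFinP; apply: measurable_funM; last first.
    by apply: measurableT_comp => //; exact: measurableT_comp.
  apply: measurable_funM; first exact: (measurableT_comp (@measurable_hpow k)).
  apply: (measurableT_comp (@measurable_hpow l)).
  exact: measurable_funB.
transitivity (\int[mu]_x \int[mu]_y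
    (hpow k x * hpow l (y - x) * expR (- y))%:E)%E.
  rewrite !eGammaE -ge0_integralZr//; [|exact: mgam|exact: integral_ge0].
  apply: eq_integral => x _; rewrite -ge0_integralZl//; [|exact: mgam].
  rewrite -[LHS](@ge0_integral_shift _ _ (- x)); last 2 first.
  - by apply: emeasurable_funM; [exact: measurable_cst|exact: mgam].
  - by move=> s; exact: mule_ge0.
  apply: eq_integral => y _; rewrite -EFinM; congr EFin.
  by rewrite mulrACA -expRD opprB addKr.
rewrite tonelli_swap; [|exact: m3|]; last first.
  by move=> x y; rewrite lee_fin !mulr_ge0 ?hpow_ge0 ?expR_ge0.
rewrite eGammaE -ge0_integralZl//; [|exact: mgam|by rewrite eBetaE'; exact: integral_ge0].
apply: eq_integral => y _.
under eq_integral do rewrite EFinM.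
rewrite ge0_integralZr//; [|exact: mconv].
by rewrite hpow_conv_eBeta muleAC [in RHS]muleC EFinM muleAC.
Qed.

Lemma eGamma_gt0 k : (0 < eGamma R k)%E.
Proof.
rewrite eGammaE.
apply: (@ge0_integral_gt0 _ 0 1 ltr01) => // [x|x /andP[x0 _]].
  by rewrite mulr_ge0 ?hpow_ge0 ?expR_ge0.
by rewrite mulr_gt0 ?hpow_gt0 ?expR_gt0.
Qed.

Lemma eBeta_gt0 k l : (0 < eBeta R k l)%E.
Proof.
rewrite eBetaE'.
apply: (@ge0_integral_gt0 _ 0 1 ltr01) => // [x|x /andP[x0 x1]].
  by rewrite mulr_ge0 ?hpow_ge0.
by rewrite mulr_gt0 ?hpow_gt0// subr_gt0.
Qed.

Lemma eBeta_rec k l : (eBeta R k.+2 l + eBeta R k l.+2 = eBeta R k l)%E.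
Proof.
rewrite !eBetaE' -ge0_integralD//; [|exact: mconv..].
by apply: eq_integral => s _; rewrite -EFinD !hpowS2; congr EFin; ring.
Qed.

Lemma eGamma1 : eGamma R 1 = (Num.sqrt pi)%:E.
Proof.
rewrite -integralT_gauss eGammaE.
under eq_integral do rewrite EFinM.
rewrite -(@ge0_integral_even_sqr 0 (fun y => (expR (- y))%:E)); last 2 first.
- exact/measurable_EFinP/measurableT_comp.
- by move=> x; rewrite lee_fin expR_ge0.
by apply: eq_integral => x _; rewrite expr0 mul1e.
Qed.

Lemma eGamma2 : eGamma R 2 = 1%E.
Proof.
rewrite -(@integral_exponential_pdf R 1 ltr01).
rewrite eGammaE [RHS](_ : _ = \int[mu]_(x in `[0%R : R, +oo[) (expR (- x))%:E)%E; last first.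
  rewrite [RHS]integral_mkcond; apply: eq_integral => x _.
  rewrite /exponential_pdf !patchE; case: ifP => // _.
  by rewrite mul1r mulN1r.
rewrite -integral_itv_obnd_cbnd; last first.
  by apply/measurable_funTS/measurable_EFinP/measurableT_comp.
rewrite [RHS]integral_mkcond; apply: eq_integral => x _.
rewrite patchE hpow2 mem_setE in_itv/= andbT.
by case: ltP; rewrite ?mul1r ?mul0r.
Qed.

Lemma eBeta22 : eBeta R 2 2 = 1%E.
Proof.
transitivity (mu `]0, 1[%classic); last first.
  by rewrite lebesgue_measure_itv/= lte_fin ltr01 sube0.
rewrite eBetaE' -(setIT `]0, 1[%classic) -integral_indic//; apply: eq_integral => x _; congr EFin.
rewrite !hpow2 subr_gt0 indicE mem_setE in_itv/=.
by case: ltP; case: ltP; rewrite ?(mulr0, mul0r, mul1r).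
Qed.

Lemma GammaE k : Gamma (k%:R / 2 : R) = hGamma k.
Proof.
rewrite /Gamma /hGamma /Rintegral eGammaE integral_mkcond; congr fine.
apply: eq_integral => u _; rewrite patchE mem_setE in_itv/= andbT hpowE.
by case: ltP => //; rewrite mul0r.
Qed.

(** The indices 1 and 2 are the Gaussian and exponential integrals. As Gamma(2/2) = 1, an infinite
    value at index k + 3 would, the Beta factor being positive, force one at index k + 1. *)
Lemma eGamma_fin k : (eGamma R k.+1 < +oo)%E.
Proof.
suff : (eGamma R k.+1 < +oo)%E /\ (eGamma R k.+2 < +oo)%E by case.
elim: k => [|k [IH1 IH2]]; first by rewrite eGamma1 eGamma2 !ltry.
split => //; have := eGammaM k.+1 2; rewrite eGamma2 mule1 addn2 => h.
rewrite ltey; apply/eqP => oo; move: IH1; rewrite h oo gt0_muley ?ltxx//.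
exact: eBeta_gt0.
Qed.

Lemma hGammaE k : eGamma R k.+1 = (hGamma k.+1)%:E.
Proof.
by rewrite /hGamma fineK// ge0_fin_numE ?eGamma_fin// ltW// eGamma_gt0.
Qed.

Lemma hGamma_gt0 k : 0 < hGamma k.+1.
Proof. by rewrite -lte_fin -hGammaE eGamma_gt0. Qed.

Lemma hGamma1 : hGamma 1 = Num.sqrt pi.
Proof. by rewrite /hGamma eGamma1. Qed.

Lemma hGamma2 : hGamma 2 = 1.
Proof. by rewrite /hGamma eGamma2. Qed.

Lemma eBetaE k l :
  eBeta R k.+1 l.+1 = (hGamma k.+1 * hGamma l.+1 / hGamma (k.+1 + l.+1))%:E.
Proof.
have := eGammaM k.+1 l.+1; rewrite !hGammaE -EFinM.
have := eBeta_gt0 k.+1 l.+1; case: eBeta => [b|_|//]; last first.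
  by rewrite gt0_mulye// lte_fin hGamma_gt0.
move=> _ [h]; congr EFin; rewrite h mulfK// gt_eqF//.
exact: hGamma_gt0.
Qed.

(** Gamma(x+1) = x Gamma(x) without integration by parts: B(x+1,y) + B(x,y+1) = B(x,y) makes the
    ratio Gamma(x+1)/Gamma(x) additive in x, and B(1,1) = 1 fixes its value 1 at x = 1. *)
Lemma hGammaS2 k : hGamma k.+3 = (k.+1)%:R / 2 * hGamma k.+1.
Proof.
have H j : hGamma j.+1 != 0 by rewrite gt_eqF// hGamma_gt0.
pose g j := hGamma j.+3 / hGamma j.+1.
have gD i j : g (i + j).+1 = g i + g j.
  have := eBeta_rec i.+1 j.+1.
  rewrite !eBetaE -EFinD => -[]; rewrite /g.
  rewrite !addSn !addnS => /(congr1 (fun x =>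
    x * hGamma (i + j).+4 / (hGamma i.+1 * hGamma j.+1))) h.
  apply: etrans (etrans (esym h) _); last by field; rewrite !H.
  by field; rewrite !H.
have g1 : g 1 = 1.
  have := eBetaE 1 1; rewrite eBeta22 hGamma2 => -[] h.
  by rewrite /g hGamma2; apply: (mulIf (H 3)); rewrite -{1}[_ * _]mul1r {1}h; field; rewrite H.
have g0 : g 0 = 2^-1 by have := gD 0 0; rewrite g1 => h; lra.
have gE j : g j = j.+1%:R / 2.
  elim: j => [|j IH]; first by rewrite g0 mul1r.
  by rewrite -[j in LHS]addn0 gD IH g0 -[j.+2%:R]natr1; field.
by rewrite -gE /g divfK.
Qed.

Lemma hGamma_rising k m :
  hGamma (k.+1 + 2 * m) = rising (k.+1%:R / 2) m * hGamma k.+1.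
Proof.
elim: m => [|m IH]; first by rewrite addn0 rising0 mul1r.
rewrite risingSr mulrAC -IH (_ : (_ + _ = (k + 2 * m).+3)%N); last by lia.
rewrite hGammaS2 mulrC addSn; congr (_ * _).
by rewrite -addSn natrD natrM; field.
Qed.

(** The Riemann-Liouville kernel of order k/2, normalized so that convolution adds indices without
    any constant. *)
Definition nhpow k x : R := hpow k x / hGamma k.

Lemma nhpow_ge0 k x : 0 <= nhpow k.+1 x.
Proof. by rewrite divr_ge0 ?hpow_ge0// ltW// hGamma_gt0. Qed.

Lemma measurable_nhpow k : measurable_fun [set: R] (nhpow k).
Proof. by apply: measurable_funM => //; exact: measurable_hpow. Qed.

Lemma nhpow_conv k l t :
  (\int[mu]_s (nhpow k.+1 s * nhpow l.+1 (t - s))%:E =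
   (nhpow (k.+1 + l.+1) t)%:E)%E.
Proof.
have H j : hGamma j.+1 != 0 by rewrite gt_eqF// hGamma_gt0.
transitivity (\int[mu]_s ((hGamma k.+1 * hGamma l.+1)^-1%:E *
    (hpow k.+1 s * hpow l.+1 (t - s))%:E))%E.
  by apply: eq_integral => s _; rewrite -EFinM /nhpow; congr EFin; field; rewrite !H.
rewrite ge0_integralZl//; last 2 first.
- exact: mconv.
- by rewrite lee_fin invr_ge0 mulr_ge0// ltW// hGamma_gt0.
rewrite hpow_conv_eBeta eBetaE -!EFinM /nhpow; congr EFin.
by rewrite addSn; field; rewrite !H.
Qed.

End half_powers.

(** * Spherical Laplace transforms *)

Section series.
Local Open Scope ereal_scope.
Context (R : realType).
Local Notation mu := (@lebesgue_measure R).

Lemma cosh_series (x : R) :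
  (expR x + expR (- x))%:E =
  \sum_(0 <= m <oo) (2 * x ^+ (2 * m) / ((2 * m)`!)%:R)%:E.
Proof.
(* The exponential series are cut at the even indices 2n, where the odd terms of x and -x have
   cancelled. *)
have -> : (fun n => \sum_(0 <= m < n) (2 * x ^+ (2 * m) / ((2 * m)`!)%:R)%:E) =
    EFin \o (fun n => (series (exp_coeff x) n + series (exp_coeff (- x)) n)%R)
      \o (fun n => (2 * n)%N).
  apply/funext => n /=; rewrite sumEFin; congr EFin.
  elim: n => [|n IH]; first by rewrite !seriesEnat/= !big_geq// addr0.
  rewrite mulnS addSn add1n !seriesSr big_nat_recr//= IH /exp_coeff/=.
  have e1 : ((- x) ^+ (2 * n) = x ^+ (2 * n))%R by rewrite exprM sqrrN -exprM.
  have e2 : ((- x) ^+ (2 * n).+1 = - x ^+ (2 * n).+1)%R.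
    by rewrite exprS e1 mulNr -exprS.
  by rewrite e1 e2; ring.
symmetry; apply: cvg_lim => //.
apply: (@cvg_comp _ _ _ (fun n => (2 * n)%N)
  (EFin \o (fun n => (series (exp_coeff x) n + series (exp_coeff (- x)) n)%R))
  _ \oo).
  by apply: cvg_mulnl.
apply: cvg_EFin; first by near=> n.
by apply: cvgD; exact: is_cvg_series_exp_coeff.
Unshelve. all: by end_near. Qed.

Lemma nneseries_cauchy (u : nat -> nat -> \bar R) : (forall i j, 0 <= u i j) ->
  \sum_(0 <= r <oo) \sum_(0 <= q <oo) u r q =
  \sum_(0 <= m <oo) \sum_(r < m.+1) u r (m - r)%N.
Proof.
move=> u0.
transitivity (\sum_(0 <= r <oo) \sum_(0 <= m <oo)
    (if (r <= m)%N then u r (m - r)%N else 0)).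
  apply: eq_eseriesr => r _; rewrite -eseries_mkcond -ereal_series.
  rewrite -(nneseries_addn (f := fun m => u r (m - r)%N))//.
  by apply: eq_eseriesr => q _; rewrite addnK.
rewrite (nneseries_interchange xpredT xpredT); last by move=> i j; case: ifP.
apply: eq_eseriesr => m _.
rewrite (nneseries_split 0 m.+1); last by move=> k _; case: ifP.
rewrite eseries0 ?adde0; last first.
  by move=> i mi _; rewrite leqNgt -[(m < i)%N]/(m.+1 <= i)%N -(add0n m.+1) mi.
rewrite add0n big_mkord; apply: eq_bigr => i _.
by rewrite -ltnS ltn_ord.
Qed.

Lemma ge0_nneseriesZl (x : \bar R) (f : nat -> \bar R) :
  0 <= x -> (forall n, 0 <= f n) ->
  \sum_(0 <= n <oo) (x * f n) = x * \sum_(0 <= n <oo) f n.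
Proof.
move=> x0 f0; rewrite -!ge0_integral_count//; last first.
  by move=> n; rewrite mule_ge0.
by rewrite ge0_integralZl.
Qed.

Lemma nneseries_mul (a b : nat -> R) :
  (forall n, (0 <= a n)%R) -> (forall n, (0 <= b n)%R) ->
  (\sum_(0 <= r <oo) (a r)%:E) * (\sum_(0 <= q <oo) (b q)%:E) =
  \sum_(0 <= m <oo) \sum_(r < m.+1) (a r * b (m - r)%N)%:E.
Proof.
move=> a0 b0.
rewrite -(nneseries_cauchy (u := fun r q => (a r * b q)%:E)); last first.
  by move=> i j; rewrite lee_fin mulr_ge0.
rewrite muleC -ge0_nneseriesZl; last 2 first.
- by apply: nneseries_ge0 => n _ _; rewrite lee_fin.
- by move=> n; rewrite lee_fin.
apply: eq_eseriesr => r _; rewrite muleC -ge0_nneseriesZl; last 2 first.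
- by rewrite lee_fin.
- by move=> n; rewrite lee_fin.
by apply: eq_eseriesr => q _; rewrite EFinM.
Qed.

(** The step 4 comes from t^(2m), which raises a doubled exponent by 4m. *)
Definition hseries (a : nat -> R) k t : \bar R :=
  \sum_(0 <= m <oo) (a m * nhpow (k + 4 * m) t)%:E.

Lemma hseries_term_ge0 a k t m : (forall m, (0 <= a m)%R) ->
  (0 <= a m * nhpow (k.+1 + 4 * m) t :> R)%R.
Proof. by move=> a0; rewrite mulr_ge0// addSn nhpow_ge0. Qed.

Lemma hseries_conv a b k l t :
  (forall m, (0 <= a m)%R) -> (forall m, (0 <= b m)%R) ->
  \int[mu]_s (hseries a k.+1 s * hseries b l.+1 (t - s)) =
  hseries (fun m => \sum_(r < m.+1) a r * b (m - r)%N)%R (k.+1 + l.+1) t.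
Proof.
move=> a0 b0.
under eq_integral => s _.
  rewrite nneseries_mul; [|by move=> n; exact: hseries_term_ge0..].
  under eq_eseriesr => m _ do rewrite sumEFin.
  over.
have mterm m r : measurable_fun [set: R] (fun s =>
    (a r * nhpow (k.+1 + 4 * r) s * (b m * nhpow (l.+1 + 4 * m) (t - s)))%R).
  apply: measurable_funM; apply: measurable_funM => //.
    exact: measurable_nhpow.
  apply: (measurableT_comp (@measurable_nhpow R _)).
  exact: measurable_funB.
rewrite integral_nneseries//; last 2 first.
- by move=> m; apply/measurable_EFinP; apply: measurable_sum => r; exact: mterm.
- move=> m s _; rewrite lee_fin; apply: sumr_ge0 => r _.
  by rewrite mulr_ge0// hseries_term_ge0.
apply: eq_eseriesr => m _.
under eq_integral do rewrite -sumEFin.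
rewrite ge0_integral_sum//; last 2 first.
- by move=> r; apply/measurable_EFinP; exact: mterm.
- by move=> r s _; rewrite lee_fin mulr_ge0// hseries_term_ge0.
rewrite mulr_suml -sumEFin; apply: eq_bigr => r _.
transitivity (\int[mu]_s ((a r * b (m - r)%N)%:E *
    (nhpow (k.+1 + 4 * r) s * nhpow (l.+1 + 4 * (m - r)) (t - s))%:E)).
  by apply: eq_integral => s _; rewrite -EFinM mulrACA.
rewrite ge0_integralZl//; last 3 first.
- apply/measurable_EFinP; apply: measurable_funM.
    exact: measurable_nhpow.
  apply: (measurableT_comp (@measurable_nhpow R _)).
  exact: measurable_funB.
- by move=> s _; rewrite lee_fin mulr_ge0// addSn nhpow_ge0.
- by rewrite lee_fin mulr_ge0.
rewrite !addSn nhpow_conv -EFinM; congr (_ * nhpow _ _)%:E.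
by have := ltn_ord r; lia.
Qed.

(* E exp(t <f, Y>) for Y uniform on the sphere of dimension D, or a projection
   of such a Y, with z = |f|^2. *)
Definition sphere_laplace D (z t : R) : \bar R :=
  \sum_(0 <= m <oo)
    ((z / 4) ^+ m * t ^+ (2 * m) / (m`!%:R * rising (D%:R / 2) m))%:E.

Lemma sphere_laplace_term_ge0 D (z t : R) m : (0 < D)%N -> (0 <= z)%R ->
  (0 <= (z / 4) ^+ m * t ^+ (2 * m) / (m`!%:R * rising (D%:R / 2) m))%R.
Proof.
move=> D0 z0; have t0 : (0 <= t ^+ (2 * m))%R by rewrite exprM exprn_ge0 ?sqr_ge0.
have r0 : (0 <= rising (D%:R / 2) m :> R)%R.
  by rewrite ltW// rising_gt0// divr_gt0// ltr0n.
by rewrite divr_ge0 ?mulr_ge0// exprn_ge0// divr_ge0.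
Qed.

Lemma sphere_laplace_ge0 D z t : (0 < D)%N -> (0 <= z)%R ->
  0 <= sphere_laplace D z t.
Proof.
by move=> D0 z0; apply: nneseries_ge0 => m _ _; rewrite lee_fin sphere_laplace_term_ge0.
Qed.

Lemma sphere_laplace0 D t : sphere_laplace D 0 t = 1.
Proof.
rewrite /sphere_laplace.
have h m : ((0 / 4) ^+ m * t ^+ (2 * m) / (m`!%:R * rising (D%:R / 2) m) =
    (m == 0)%N%:R :> R)%R.
  rewrite mul0r expr0n; case: m => [|m]; last by rewrite !mul0r.
  by rewrite !eqxx rising0 muln0 expr0 fact0 /=; field.
rewrite (nneseries_split 0 1); last by move=> k _; rewrite h.
rewrite add0n big_nat1 eseries0; first by rewrite h adde0.
by move=> [|k]// _ _; rewrite h.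
Qed.

Lemma bessel_coef_ge0 D k z m : (0 < D)%N -> (0 <= z)%R ->
  (0 <= bessel_coef (D%:R / 2) (k.+1%:R / 2) z m :> R)%R.
Proof.
move=> D0 z0; rewrite !mulr_ge0 ?exprn_ge0 ?divr_ge0//.
  by rewrite ltW// rising_gt0// divr_gt0.
by rewrite invr_ge0 mulr_ge0// ltW// rising_gt0// divr_gt0// ltr0n.
Qed.

(** Absorbing t^(2m) into [nhpow k] costs the factor (k/2)_(2m), the numerator of [bessel_coef]. *)
Lemma hpow_sphere_laplace D k (z t : R) : (0 < D)%N -> (0 <= z)%R ->
  (nhpow k.+1 t)%:E * sphere_laplace D z t =
  hseries (bessel_coef (D%:R / 2) (k.+1%:R / 2) z) k.+1 t.
Proof.
move=> D0 z0; rewrite -nneseriesZl; last first.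
  by move=> m _; rewrite lee_fin sphere_laplace_term_ge0.
apply: eq_eseriesr => m _; rewrite -EFinM; congr EFin.
rewrite /nhpow (_ : (4 * m = 2 * (2 * m))%N); last by lia.
rewrite -hpowX hGamma_rising /bessel_coef.
have := rising_gt0 (2 * m) (x := k.+1%:R / 2 : R); rewrite divr_gt0// => /(_ isT).
have := rising_gt0 m (x := D%:R / 2 : R); rewrite divr_gt0 ?ltr0n// => /(_ isT).
have := hGamma_gt0 R k.
have : (m`!%:R != 0 :> R)%R by rewrite pnatr_eq0 -lt0n fact_gt0.
move: (hGamma _ _) (rising (D%:R / 2) m)%R (rising _ (2 * m))%R (hpow _ _) (t ^+ _)%R (m`!%:R) ((z / 4) ^+ m)%R.
move=> a b c e u v w v0 a0 b0 c0.
by field; rewrite v0 !gt_eqF.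
Qed.

(** With D = q + 2, the flag [e] distinguishes k = D - 2 (Rothe) from k = D (Hagen). *)
Lemma sphere_laplace_conv_half p q e (z t : R) : (0 < p)%N -> (0 < q + e)%N ->
  (e <= 1)%N -> (0 <= z)%R ->
  \int[mu]_s ((nhpow p s)%:E * sphere_laplace p.+2 z s *
     ((nhpow (q + 2 * e) (t - s))%:E * sphere_laplace q.+2 z (t - s))) =
  (nhpow (p + q + 2 * e) t)%:E * sphere_laplace (p + q).+2 z t.
Proof.
case: p => // p _ qe0 e1 z0.
have [k kE] : exists k, (q + 2 * e)%N = k.+1.
  by exists (q + 2 * e).-1; rewrite prednK//; lia.
rewrite -[(p.+1 + q + 2 * e)%N]addnA kE addSn.
under eq_integral do rewrite !hpow_sphere_laplace//.
rewrite hseries_conv; [|by move=> m; exact: bessel_coef_ge0..].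
rewrite hpow_sphere_laplace// addSn; congr (hseries _ _ _).
apply/funext => m.
have h2 (n : nat) : (n.+2%:R / 2 = n%:R / 2 + 1 :> R)%R.
  by rewrite -addn2 natrD mulrDl divff.
have kE' : (k.+1%:R / 2 = q%:R / 2 + e%:R :> R)%R.
  by rewrite -kE natrD natrM; field.
have -> : ((p + k.+1).+1%:R / 2 = p.+1%:R / 2 + q%:R / 2 + e%:R :> R)%R.
  by rewrite -addSn natrD mulrDl kE' addrA.
rewrite !h2 kE'.
have -> : ((p.+1 + q)%:R / 2 = p.+1%:R / 2 + q%:R / 2 :> R)%R.
  by rewrite natrD mulrDl.
case: e e1 qe0 {kE kE'} => [|[|//]] _ qe0.
  by rewrite !addr0 bessel_coef_addl// divr_gt0// ltr0n -(addn0 q).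
by rewrite bessel_coef_addr// divr_ge0.
Qed.

(** With D = q + 1, the flag [e] distinguishes k = 2 D - 2 from k = 2 D, both of Vandermonde
    type. *)
Lemma sphere_laplace_conv_double p q e (z t : R) : (e <= 1)%N -> (0 < q + e)%N ->
  (0 <= z)%R -> (0 < p)%N ->
  \int[mu]_s ((nhpow (2 * p) s)%:E * sphere_laplace p.+1 z s *
     ((nhpow (2 * (q + e)) (t - s))%:E * sphere_laplace q.+1 z (t - s))) =
  (nhpow (2 * (p + q + e)) t)%:E * sphere_laplace (p + q).+1 z t.
Proof.
move=> e1 qe0 z0; case: p => // p _.
have [k kE] : exists k, (2 * (q + e))%N = k.+1.
  by exists (2 * (q + e)).-1; rewrite prednK//; lia.
rewrite -[(p.+1 + q + e)%N]addnA [(2 * (p.+1 + _))%N]mulnDr !kE (_ : (2 * p.+1 = (2 * p).+2)%N); last by lia.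
under eq_integral do rewrite !hpow_sphere_laplace//.
rewrite hseries_conv; [|by move=> m; exact: bessel_coef_ge0..].
rewrite addSn hpow_sphere_laplace//; congr (hseries _ _ _).
apply/funext => m.
have kE' : (k.+1%:R / 2 = 2 * (q.+1%:R / 2) - 1 + e%:R :> R)%R.
  by rewrite -kE natrM natrD -[q.+1%:R]natr1; field.
have pE : ((2 * p).+2%:R / 2 = 2 * (p.+2%:R / 2) - 1 :> R)%R.
  by rewrite (_ : (2 * p).+2 = 2 * p.+1)%N ?natrM -?[p.+2%:R]natr1; [field|lia].
have -> : (((2 * p).+1 + k.+1).+1%:R / 2 = 2 * (p.+2%:R / 2) - 1 +
    (2 * (q.+1%:R / 2) - 1 + e%:R) :> R)%R.
  by rewrite -addSn natrD mulrDl kE' pE.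
have -> : ((p.+1 + q).+1%:R / 2 = p.+2%:R / 2 + q.+1%:R / 2 - 2^-1 :> R)%R.
  by rewrite -[(_ + _).+1%:R]natr1 natrD -[p.+2%:R]natr1 -[q.+1%:R]natr1; field.
rewrite kE' pE bessel_coef_double//.
- by rewrite ltr_pdivlMr// mulVf// ltr1n.
- by case: e e1 {qe0 kE kE'} => [|[|//]] _; [left|right]; rewrite ?addr0// subrK.
Qed.

End series.

(** * Integration on tuples of reals *)

Section tuple_integral.
Context (R : realType).
Local Notation mu := (@lebesgue_measure R).

Lemma measurable_inner_integral m (F : m.+1.-tuple R -> \bar R) :
  measurable_fun [set: m.+1.-tuple R] F -> (forall x, 0 <= F x)%E ->
  measurable_fun [set: R]
    (fun x => (\int[lebesgue_tuple m]_y F (tcons (x, y)))%E).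
Proof.
move=> mF F0; have mt := @measurable_tcons R m.
apply: (@measurable_fun_fubini_tonelli_F _ _ _ _ _ (lebesgue_tuple m)
  (fun p => F (tcons p))) => //.
exact: (measurableT_comp mF mt).
Qed.

Lemma measurable_tconsr m (x : R) :
  measurable_fun [set: m.-tuple R] (fun y => tcons (x, y)).
Proof.
by apply: (measurableT_comp (@measurable_tcons R m)); exact: measurable_fun_pair.
Qed.

Lemma ge0_integral_tcons m (F : m.+1.-tuple R -> \bar R) :
  measurable_fun [set: m.+1.-tuple R] F -> (forall x, 0 <= F x)%E ->
  (\int[lebesgue_tuple m.+1]_x F x =
   \int[mu]_x \int[lebesgue_tuple m]_y F (tcons (x, y)))%E.
Proof.
move=> mF F0; have mt := @measurable_tcons R m.
rewrite (@ge0_integral_transfer _ _ _ _ _ (mu \x lebesgue_tuple m)%E _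
  (@tcons R m))//.
have /= <- := @fubini_tonelli1 _ _ _ _ _ mu (lebesgue_tuple m)
  (fun p => F (tcons p)) (measurableT_comp mF mt) (fun p => F0 _).
by [].
Qed.

Lemma ge0_integral_tuple0 (F : 0.-tuple R -> \bar R) :
  measurable_fun [set: 0.-tuple R] F ->
  (\int[lebesgue_tuple 0]_x F x = F [tuple])%E.
Proof. by move=> mF; rewrite /= integral_dirac// diracT mul1e. Qed.

Lemma tnth_tcons0 m (p : R * m.-tuple R) : tnth (tcons p) ord0 = p.1.
Proof. exact: tnth0. Qed.

Lemma tnth_tconsS m (p : R * m.-tuple R) i :
  tnth (tcons p) (lift ord0 i) = tnth p.2 i.
Proof. by rewrite tnthS; congr tnth; exact/val_inj. Qed.

Definition topp m (x : m.-tuple R) : m.-tuple R := [tuple - tnth x l | l < m].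

Lemma topp_tcons m x (y : m.-tuple R) :
  topp (tcons (x, y)) = tcons (- x, topp y).
Proof.
apply: eq_from_tnth => i; rewrite tnth_mktuple.
by case: (unliftP ord0 i) => [k ->|->];
  rewrite ?tnth_tconsS ?tnth_tcons0 ?tnth_mktuple.
Qed.

Lemma measurable_topp m : measurable_fun [set: m.-tuple R] (@topp m).
Proof.
apply/measurable_fun_tnthP => i.
rewrite (_ : _ \o _ = fun x => - tnth x i).
  by apply: measurableT_comp => //; exact: measurable_tnth.
by apply/funext => x /=; rewrite tnth_mktuple.
Qed.

Lemma ge0_integral_topp m (F : m.-tuple R -> \bar R) :
  measurable_fun [set: m.-tuple R] F -> (forall x, 0 <= F x)%E ->
  (\int[lebesgue_tuple m]_x F (topp x) = \int[lebesgue_tuple m]_x F x)%E.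
Proof.
elim: m F => [|m IH] F mF F0.
  by apply: eq_integral => x _; congr F; rewrite (tuple0 x) (tuple0 (topp _)).
have mFt := measurableT_comp mF (@measurable_topp m.+1).
rewrite !ge0_integral_tcons//.
under eq_integral => x _.
  under eq_integral do rewrite topp_tcons.
  rewrite (IH (fun y => F (tcons (- x, y)))); first over.
    apply: (measurableT_comp mF); exact: measurable_tconsr.
  by move=> y; exact: F0.
rewrite (@ge0_integral_opp _ (fun x => \int[lebesgue_tuple m]_y F (tcons (x, y)))%E)//.
  exact: measurable_inner_integral.
by move=> x; apply: integral_ge0.
Qed.

Definition dot m (f x : m.-tuple R) : R := \sum_(l < m) tnth f l * tnth x l.

Definition sqnorm m (x : m.-tuple R) : R := \sum_(l < m) tnth x l ^+ 2.

Lemma sqnorm_ge0 m (x : m.-tuple R) : 0 <= sqnorm x.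
Proof. by apply: sumr_ge0 => l _; exact: sqr_ge0. Qed.

Lemma dot_tcons m a (f : m.-tuple R) x (y : m.-tuple R) :
  dot (tcons (a, f)) (tcons (x, y)) = a * x + dot f y.
Proof.
rewrite /dot big_ord_recl !tnth_tcons0; congr (_ + _).
by apply: eq_bigr => i _; rewrite !tnth_tconsS.
Qed.

Lemma sqnorm_tcons m x (y : m.-tuple R) :
  sqnorm (tcons (x, y)) = x ^+ 2 + sqnorm y.
Proof.
rewrite /sqnorm big_ord_recl !tnth_tcons0; congr (_ + _).
by apply: eq_bigr => i _; rewrite !tnth_tconsS.
Qed.

Lemma dot_topp m (f x : m.-tuple R) : dot f (topp x) = - dot f x.
Proof.
by rewrite /dot -sumrN; apply: eq_bigr => l _; rewrite tnth_mktuple mulrN.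
Qed.

Lemma sqnorm_topp m (x : m.-tuple R) : sqnorm (topp x) = sqnorm x.
Proof. by apply: eq_bigr => l _; rewrite tnth_mktuple sqrrN. Qed.

Lemma dot0 m (x : m.-tuple R) : dot [tuple 0 | _ < m] x = 0.
Proof. by rewrite /dot big1// => l _; rewrite tnth_mktuple mul0r. Qed.

Lemma sqnorm0 m : sqnorm [tuple 0 | _ < m] = 0.
Proof. by rewrite /sqnorm big1// => l _; rewrite tnth_mktuple expr0n. Qed.

Lemma measurable_dot m (f : m.-tuple R) : measurable_fun [set: m.-tuple R] (dot f).
Proof.
apply: measurable_sum => l; apply: measurable_funM => //.
exact: measurable_tnth.
Qed.

Lemma measurable_sqnorm m : measurable_fun [set: m.-tuple R] (@sqnorm m).
Proof.
by apply: measurable_sum => l; apply: measurable_funX; exact: measurable_tnth.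
Qed.

Lemma tcons_eta m (f : m.+1.-tuple R) :
  exists a (f' : m.-tuple R), f = tcons (a, f').
Proof. by exists (thead f), [tuple of behead f]; exact: tuple_eta. Qed.

End tuple_integral.

(** * Even parts of binomial expansions *)

Section even_binomial.
Context {R : numFieldType}.

Lemma rising1 n : rising (1 : R) n = n`!%:R.
Proof.
elim: n => [|n IH]; first by rewrite rising0 fact0.
by rewrite risingSr IH factS natrM mulrC nat1r.
Qed.

Lemma rising_half n : rising (2^-1 : R) n = (2 * n)`!%:R / (4 ^+ n * n`!%:R).
Proof.
have := rising_double (2^-1 : R) n; rewrite divff// rising1.
rewrite (_ : 2^-1 + 2^-1 = 1); last by field.
rewrite rising1 => ->.
have n0 : n`!%:R != 0 :> R by rewrite pnatr_eq0 -lt0n fact_gt0.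
have n4 : 4 ^+ n != 0 :> R by rewrite expf_neq0.
by move: (4 ^+ n) n4 => u u0; field; rewrite n0 u0.
Qed.

(** This relation between the even Gaussian moments turns the even binomial coefficients of (a x +
    w)^(2m) into those of (a^2 + |f'|^2)^m; through it the radial moments depend on f only by its
    norm. *)
Lemma bin_rising_half m r : (r <= m)%N ->
  'C(2 * m, 2 * r)%:R * (rising (2^-1 : R) (m - r) * rising 2^-1 r) =
  'C(m, r)%:R * rising 2^-1 m.
Proof.
move=> rm; rewrite !rising_half.
have f0 n : n`!%:R != 0 :> R by rewrite pnatr_eq0 -lt0n fact_gt0.
have := bin_fact rm => /(congr1 (fun n => n%:R : R)).
have := @bin_fact (2 * m) (2 * r) => /(_ _)/(congr1 (fun n => n%:R : R)).
rewrite leq_mul2l rm orbT -mulnBr => /(_ isT); rewrite !natrM => <- <-.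
have e4 : 4 ^+ m = 4 ^+ (m - r) * 4 ^+ r :> R by rewrite -exprD subnK.
have n4 n : 4 ^+ n != 0 :> R by rewrite expf_neq0.
rewrite e4; move: (4 ^+ (m - r)) (4 ^+ r) (n4 (m - r)%N) (n4 r) => u v u0 v0.
have : 'C(m, r)%:R != 0 :> R by rewrite pnatr_eq0 -lt0n bin_gt0.
move: ('C(2 * m, 2 * r)%:R) ('C(m, r)%:R) => b1 b2 b20.
move: (f0 r) (f0 (m - r)%N) (f0 (2 * r)%N) (f0 (2 * (m - r))%N).
move: (r`!%:R) ((m - r)`!%:R) ((2 * r)`!%:R) ((2 * (m - r))`!%:R).
move=> w x y z w0 x0 y0 z0.
by field; rewrite u0 v0 w0 x0 b20.
Qed.

Lemma sum_even m (g : nat -> R) : (forall i, odd i -> g i = 0) ->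
  \sum_(i < (2 * m).+1) g i = \sum_(r < m.+1) g (2 * r)%N.
Proof.
move=> g0; elim: m => [|m IH]; first by rewrite !big_ord1.
rewrite (_ : (2 * m.+1).+1 = (2 * m).+3)%N; last by lia.
rewrite !big_ord_recr/= -[X in _ = X + _](big_ord_recr _ (fun r => g (2 * r)%N))/=.
rewrite -IH big_ord_recr/= [g (2 * m).+1]g0 ?addr0; last first.
  by rewrite /= mul2n odd_double.
by congr (_ + g _); lia.
Qed.

Lemma even_binomial m (a w : R) :
  (a + w) ^+ (2 * m) + (- a + w) ^+ (2 * m) =
  2 * \sum_(r < m.+1) 'C(2 * m, 2 * r)%:R * a ^+ (2 * (m - r)) * w ^+ (2 * r).
Proof.
rewrite !exprDn -big_split/=.
pose g i := (a ^+ (2 * m - i) * w ^+ i + (- a) ^+ (2 * m - i) * w ^+ i) *+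
  ('C(2 * m, i)).
transitivity (\sum_(i < (2 * m).+1) g i).
  by apply: eq_bigr => i _; rewrite /g mulrnDl.
rewrite sum_even => [|i oi].
  rewrite mulr_sumr; apply: eq_bigr => r _; rewrite /g -mulnBr.
  rewrite !(exprM (- a)) sqrrN -exprM -mulrDl -mulr2n -mulr_natl.
  by rewrite -(mulr_natl (a ^+ _) 2); ring.
rewrite /g; have [im|im] := leqP i (2 * m); last by rewrite bin_small ?mulr0n.
rewrite [(- a) ^+ _]exprNn -signr_odd oddB// oi mul2n odd_double/= expr1.
by rewrite mulN1r mulNr subrr mul0rn.
Qed.

End even_binomial.

(** * Radial functions integrated against a linear form *)

Section radial.
Context (R : realType).
Local Notation mu := (@lebesgue_measure R).
Implicit Types phi : R -> \bar R.

Lemma mule2_inj (x y : \bar R) : (2%:E * x = 2%:E * y -> x = y)%E.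
Proof.
move/(congr1 (mule 2^-1%:E)); rewrite !muleA -!EFinM mulVf ?pnatr_eq0//.
by rewrite !mul1e.
Qed.

(** Dual form of the convolution rule, tested on a function of the sum of the two variables. *)
Lemma nhpow_conv_fun k l phi :
  measurable_fun [set: R] phi -> (forall x, 0 <= phi x)%E ->
  (\int[mu]_u ((nhpow k.+1 u)%:E *
     \int[mu]_s ((nhpow l.+1 s)%:E * phi (u + s)%R)) =
   \int[mu]_s ((nhpow (k.+1 + l.+1) s)%:E * phi s))%E.
Proof.
move=> mphi phi0.
have mn j : measurable_fun [set: R] (fun s : R => (nhpow j s)%:E).
  by apply/measurable_EFinP; exact: measurable_nhpow.
have n0 j s : (0 <= (nhpow j.+1 s : R)%:E)%E by rewrite lee_fin nhpow_ge0.
have mnB j (s : R) : measurable_fun [set: R] (fun u : R => (nhpow j (s - u))%:E).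
  apply: (measurableT_comp (mn j)); exact: measurable_funB.
transitivity (\int[mu]_u \int[mu]_s
    ((nhpow k.+1 u)%:E * (nhpow l.+1 (s - u))%:E * phi s))%E.
  apply: eq_integral => u _.
  have mP : measurable_fun [set: R] (fun s => (nhpow l.+1 s)%:E * phi (u + s)%R)%E.
    apply: emeasurable_funM; first exact: mn.
    by apply: (measurableT_comp mphi); exact: measurable_funD.
  rewrite -ge0_integralZl//; last by move=> s _; rewrite mule_ge0.
  rewrite -[LHS](@ge0_integral_shift _ _ (- u)); last 2 first.
  - by apply: emeasurable_funM => //; exact: measurable_cst.
  - by move=> s; rewrite !mule_ge0.
  by apply: eq_integral => s _; rewrite -muleA [(u + _)%R]addrC subrK.
rewrite tonelli_swap; last 2 first.
- apply: emeasurable_funM; last exact: (measurableT_comp mphi).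
  apply: emeasurable_funM; first exact: (measurableT_comp (mn _)).
  apply: (measurableT_comp (mn _)); exact: measurable_funB.
- by move=> u s; rewrite !mule_ge0.
apply: eq_integral => s _.
have mP : measurable_fun [set: R]
    (fun u => (nhpow k.+1 u)%:E * (nhpow l.+1 (s - u))%:E)%E.
  by apply: emeasurable_funM.
rewrite ge0_integralZr//; last by move=> u _; rewrite mule_ge0.
by rewrite -nhpow_conv.
Qed.

Let measurable_radial d (f : d.-tuple R) m phi :
  measurable_fun [set: R] phi ->
  measurable_fun [set: d.-tuple R]
    (fun x => (dot f x ^+ (2 * m))%:E * phi (sqnorm x))%E.
Proof.
move=> mphi; apply: emeasurable_funM.
  by apply/measurable_EFinP; apply: measurable_funX; exact: measurable_dot.
by apply: (measurableT_comp mphi); exact: measurable_sqnorm.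
Qed.

Let radial_ge0 d (f : d.-tuple R) m phi x : (forall x, 0 <= phi x)%E ->
  (0 <= (dot f x ^+ (2 * m))%:E * phi (sqnorm x))%E.
Proof.
by move=> phi0; rewrite mule_ge0// lee_fin exprM exprn_ge0// sqr_ge0.
Qed.

Lemma hGamma_odd m : hGamma R (2 * m).+1 = rising 2^-1 m * Num.sqrt pi.
Proof. by rewrite -add1n hGamma_rising mul1r hGamma1. Qed.

(** For m = 0 this is integration in polar coordinates. The induction splits off one coordinate x,
    symmetrizes in x to keep only even powers, substitutes x^2, and merges the resulting kernel with
    that of the other coordinates. *)
Lemma integral_radial_moment d (f : d.+1.-tuple R) m phi :
  measurable_fun [set: R] phi -> (forall x, 0 <= phi x)%E ->
  (\int[lebesgue_tuple d.+1]_x ((dot f x ^+ (2 * m))%:E * phi (sqnorm x)) =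
   (rising 2^-1 m * Num.sqrt pi ^+ d.+1 * sqnorm f ^+ m)%:E *
   \int[mu]_s ((nhpow (d.+1 + 2 * m) s)%:E * phi s))%E.
Proof.
elim: d f m phi => [|d IH] f m phi mphi phi0.
  have [a [f' ->]] := tcons_eta f.
  rewrite ge0_integral_tcons; last 2 first.
  - exact: measurable_radial.
  - by move=> x; exact: radial_ge0.
  transitivity (\int[mu]_x ((a ^+ (2 * m))%:E * ((x ^+ (2 * m))%:E * phi (x ^+ 2)%R)))%E.
    apply: eq_integral => x _; rewrite ge0_integral_tuple0; last first.
      apply: (measurableT_comp (measurable_radial (tcons (a, f')) m mphi)).
      exact: measurable_tconsr.
    by rewrite dot_tcons sqnorm_tcons /dot /sqnorm !big_ord0 !addr0 exprMn EFinM muleA.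
  have mP : measurable_fun [set: R] (fun x => (x ^+ (2 * m))%:E * phi (x ^+ 2)%R)%E.
    apply: emeasurable_funM; first by apply/measurable_EFinP; exact: measurable_funX.
    by apply: (measurableT_comp mphi); exact: measurable_funX.
  have mQ : measurable_fun [set: R] (fun x => (nhpow (1 + 2 * m) x)%:E * phi x)%E.
    by apply: emeasurable_funM => //; apply/measurable_EFinP; exact: measurable_nhpow.
  rewrite ge0_integralZl//; last 2 first.
  - by move=> x _; rewrite mule_ge0// lee_fin exprM exprn_ge0// sqr_ge0.
  - by rewrite lee_fin exprM exprn_ge0// sqr_ge0.
  rewrite ge0_integral_even_sqr//.
  have hx x : (0 <= (hpow (2 * m).+1 x)%:E * phi x)%E.
    by rewrite mule_ge0// lee_fin hpow_ge0.
  have mhx : measurable_fun [set: R] (fun x => (hpow (2 * m).+1 x)%:E * phi x)%E.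
    by apply: emeasurable_funM => //; apply/measurable_EFinP; exact: measurable_hpow.
  have nx x : (0 <= (nhpow (1 + 2 * m) x)%:E * phi x)%E.
    by rewrite mule_ge0// lee_fin nhpow_ge0.
  have ha : (0 <= (a ^+ (2 * m))%:E)%E.
    by rewrite lee_fin exprM exprn_ge0// sqr_ge0.
  rewrite -[LHS]ge0_integralZl// -[RHS]ge0_integralZl//; last first.
    rewrite lee_fin !mulr_ge0 ?exprn_ge0 ?sqrtr_ge0 ?sqnorm_ge0//.
    by rewrite ltW// rising_gt0.
  apply: eq_integral => x _; rewrite !muleA -!EFinM; congr (_%:E * _)%E.
  rewrite sqnorm_tcons /sqnorm big_ord0 addr0 -exprM expr1 -hGamma_odd /nhpow add1n.
  have := hGamma_gt0 R (2 * m); move: (hGamma _ _) => g g0.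
  by field; rewrite gt_eqF.
have [a [f' ->]] := tcons_eta f.
have mF := measurable_radial (tcons (a, f')) m mphi.
have F0 x := radial_ge0 (tcons (a, f')) m x phi0.
set F := fun x => _ in mF F0.
have mG := measurable_inner_integral mF F0.
have G0 x : (0 <= \int[lebesgue_tuple d.+1]_y F (tcons (x, y)))%E.
  by apply: integral_ge0 => y _; exact: F0.
set G := fun x => _ in mG G0.
have mGN : measurable_fun [set: R] (fun x => G (- x)).
  by apply: (measurableT_comp mG).
have mFx x : measurable_fun [set: d.+1.-tuple R] (fun y => F (tcons (x, y))).
  by apply: (measurableT_comp mF); exact: measurable_tconsr.
have mphiD x : measurable_fun [set: R] (fun s => phi (x + s)).
  by apply: (measurableT_comp mphi); exact: measurable_funD.
(* [c r] gathers the r-th even binomial coefficient and the constant of the induction hypothesis,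
   which is applied with [phi] translated by x^2; [H r] is the integral it leaves. *)
pose c r : R := 2 * 'C(2 * m, 2 * r)%:R * a ^+ (2 * (m - r)) *
  (rising 2^-1 r * Num.sqrt pi ^+ d.+1 * sqnorm f' ^+ r).
have xE k (x : R) : 0 <= x ^+ (2 * k) by rewrite exprM exprn_ge0// sqr_ge0.
have c0 r : 0 <= c r.
  rewrite !mulr_ge0 ?xE// ?exprn_ge0 ?sqrtr_ge0 ?sqnorm_ge0//.
  by rewrite ltW// rising_gt0.
pose H r (x : R) := (\int[mu]_s ((nhpow (d.+1 + 2 * r) s)%:E * phi (x + s)%R))%E.
have H0 r x : (0 <= H r x)%E.
  by apply: integral_ge0 => s _; rewrite mule_ge0// lee_fin nhpow_ge0.
have mH r : measurable_fun [set: R] (H r).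
  apply: (@measurable_fun_fubini_tonelli_F _ _ _ _ _ mu
    (fun p : R * R => ((nhpow (d.+1 + 2 * r) p.2)%:E * phi (p.1 + p.2)%R)%E)).
    apply: emeasurable_funM; last first.
      by apply: (measurableT_comp mphi); exact: measurable_funD.
    apply/measurable_EFinP; apply: (measurableT_comp (@measurable_nhpow R _)).
    exact: measurable_snd.
  by move=> p; rewrite mule_ge0// lee_fin nhpow_ge0.
have GD x : (G x + G (- x)%R =
    \sum_(r < m.+1) (c r * x ^+ (2 * (m - r)))%:E * H r (x ^+ 2)%R)%E.
  rewrite /G -ge0_integralD//; [|by move=> y _; exact: F0..].
  transitivity (\int[lebesgue_tuple d.+1]_y \sum_(r < m.+1)
    ((2 * 'C(2 * m, 2 * r)%:R * (a * x) ^+ (2 * (m - r)))%:E *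
      ((dot f' y ^+ (2 * r))%:E * phi (x ^+ 2 + sqnorm y)%R)))%E.
    apply: eq_integral => y _; rewrite /F !dot_tcons !sqnorm_tcons sqrrN.
    rewrite -ge0_muleDl ?lee_fin; last 2 first.
    - by rewrite exprM exprn_ge0// sqr_ge0.
    - by rewrite exprM exprn_ge0// sqr_ge0.
    rewrite -EFinD mulrN even_binomial mulr_sumr -sumEFin ge0_sume_distrl.
      by apply: eq_bigr => r _; rewrite muleA -EFinM; congr (_%:E * _)%E; ring.
    move=> r _; rewrite lee_fin !mulr_ge0//; rewrite exprM exprn_ge0// sqr_ge0//.
  rewrite ge0_integral_sum//; last 2 first.
  - move=> r; apply: emeasurable_funM; first exact: measurable_cst.
    exact: (measurable_radial f' r (mphiD (x ^+ 2))).
  - move=> r y _; rewrite mule_ge0//; last exact: (radial_ge0 f' r y (fun s => phi0 _)).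
    by rewrite lee_fin !mulr_ge0// exprM exprn_ge0// sqr_ge0.
  apply: eq_bigr => r _; rewrite ge0_integralZl//; last 3 first.
  - exact: (measurable_radial f' r (mphiD (x ^+ 2))).
  - by move=> y _; exact: (radial_ge0 f' r y (fun s => phi0 _)).
  - by rewrite lee_fin !mulr_ge0// exprM exprn_ge0// sqr_ge0.
  rewrite (IH f' r (fun s => phi (x ^+ 2 + s)))// muleA -EFinM; congr (_%:E * _)%E.
  by rewrite /c exprMn; ring.
(* Twice the integral is the integral of G(x) + G(-x), so no odd term, possibly negative, is ever
   integrated. *)
have L2 : (2%:E * \int[lebesgue_tuple d.+2]_x F x =
    \sum_(r < m.+1) (c r * hGamma R (2 * (m - r)).+1)%:E *
      \int[mu]_s ((nhpow (d.+2 + 2 * m) s)%:E * phi s))%E.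
  rewrite ge0_integral_tcons//.
  rewrite (_ : 2%:E = 1 + 1)%E// ge0_muleDl// mul1e -{2}(ge0_integral_opp mG G0).
  rewrite -ge0_integralD//; last by move=> x _; exact: G0.
  transitivity (\int[mu]_x \sum_(r < m.+1)
      ((c r * x ^+ (2 * (m - r)))%:E * H r (x ^+ 2)%R))%E.
    by apply: eq_integral => x _; exact: GD.
  have mx k : measurable_fun [set: R] (fun x : R => (x ^+ (2 * k))%:E).
    by apply/measurable_EFinP; exact: measurable_funX.
  have mHX r : measurable_fun [set: R] (fun x => H r (x ^+ 2)).
    by apply: (measurableT_comp (mH r)); exact: measurable_funX.
  rewrite ge0_integral_sum//; last 2 first.
  - move=> r; apply: emeasurable_funM; last exact: mHX.
    apply/measurable_EFinP.
    by apply: measurable_funM => //; exact: measurable_funX.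
  - by move=> r x _; rewrite mule_ge0// lee_fin mulr_ge0.
  apply: eq_bigr => r _.
  under eq_integral do rewrite EFinM -muleA.
  rewrite ge0_integralZl//; last 3 first.
  - by apply: emeasurable_funM; [exact: mx|exact: mHX].
  - by move=> x _; rewrite mule_ge0// lee_fin.
  - by rewrite lee_fin.
  rewrite ge0_integral_even_sqr// (EFinM (c r)) -muleA; congr (_ * _)%E.
  (* The two indices have a sum independent of r, so one integral factors out of the whole sum. *)
  rewrite (_ : (d.+2 + 2 * m)%N = ((2 * (m - r)).+1 + (d + 2 * r).+1)%N); last first.
    by have := ltn_ord r; lia.
  rewrite -nhpow_conv_fun// -ge0_integralZl//; last 3 first.
  - apply: emeasurable_funM; first by apply/measurable_EFinP; exact: measurable_nhpow.
    exact: mH.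
  - by move=> x _; rewrite mule_ge0 ?lee_fin ?nhpow_ge0//; exact: H0.
  - by rewrite lee_fin ltW// hGamma_gt0.
  apply: eq_integral => x _; rewrite muleA -EFinM; congr (_%:E * _)%E.
  by rewrite /nhpow mulrC divfK// gt_eqF// hGamma_gt0.
have I0 : (0 <= \int[mu]_s ((nhpow (d.+2 + 2 * m) s)%:E * phi s))%E.
  by apply: integral_ge0 => s _; rewrite mule_ge0// lee_fin nhpow_ge0.
apply: mule2_inj.
rewrite L2 -ge0_sume_distrl; last first.
  by move=> r _; rewrite lee_fin mulr_ge0// ltW// hGamma_gt0.
rewrite muleA sumEFin -EFinM; congr (_%:E * _)%E.
rewrite sqnorm_tcons exprDn mulrA !mulr_sumr; apply: eq_bigr => r _.
have rm : (r <= m)%N by rewrite -ltnS ltn_ord.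
rewrite /c hGamma_odd -exprM -(mulr_natr _ 'C(m, r)) (exprS (Num.sqrt pi) d.+1).
have := @bin_rising_half R m r rm.
move: (Num.sqrt pi) (Num.sqrt pi ^+ d.+1) ('C(2 * m, 2 * r)%:R) ('C(m, r)%:R)
  (a ^+ _) (sqnorm f' ^+ r) => p w b1 b2 u v hb.
transitivity (2 * (b1 * (rising 2^-1 (m - r) * rising 2^-1 r)) *
  (u * w * v * p)).
  by ring.
by rewrite hb; ring.
Qed.

(** Adding the image under x -> -x replaces exp by 2 cosh, a series of nonnegative terms that can be
    integrated termwise. The radial factor [g] serves two cases: constant for the ball, u / sqrt s
    for normalized directions. *)
Lemma integral_radial_exp d (f : d.+1.-tuple R) (g : R -> R) phi :
  measurable_fun [set: R] g ->
  measurable_fun [set: R] phi -> (forall x, 0 <= phi x)%E ->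
  (\int[lebesgue_tuple d.+1]_x
     ((expR (g (sqnorm x) * dot f x))%:E * phi (sqnorm x)) =
   \sum_(0 <= m <oo) (Num.sqrt pi ^+ d.+1 * (sqnorm f / 4) ^+ m / m`!%:R)%:E *
     \int[mu]_s ((nhpow (d.+1 + 2 * m) s)%:E * ((g s ^+ (2 * m))%:E * phi s)))%E.
Proof.
move=> mg mphi phi0.
pose F (x : d.+1.-tuple R) :=
  ((expR (g (sqnorm x) * dot f x))%:E * phi (sqnorm x))%E.
have mgs : measurable_fun [set: d.+1.-tuple R] (fun x => g (sqnorm x)).
  by apply: (measurableT_comp mg); exact: measurable_sqnorm.
have mps : measurable_fun [set: d.+1.-tuple R] (fun x => phi (sqnorm x)).
  by apply: (measurableT_comp mphi); exact: measurable_sqnorm.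
have mF : measurable_fun [set: d.+1.-tuple R] F.
  apply: emeasurable_funM => //; apply/measurable_EFinP.
  apply: measurableT_comp => //; apply: measurable_funM => //.
  exact: measurable_dot.
have F0 x : (0 <= F x)%E by rewrite mule_ge0// lee_fin expR_ge0.
have mFN := measurableT_comp mF (@measurable_topp R d.+1).
apply: mule2_inj.
rewrite [LHS](_ : _ = \int[lebesgue_tuple d.+1]_x F x +
    \int[lebesgue_tuple d.+1]_x F x)%E; last first.
  by rewrite (_ : 2%:E = 1 + 1)%E// ge0_muleDl// mul1e.
rewrite -{2}(ge0_integral_topp mF F0) -ge0_integralD//.
have mgm m : measurable_fun [set: R] (fun s => (g s ^+ (2 * m))%:E * phi s)%E.
  by apply: emeasurable_funM => //; apply/measurable_EFinP; exact: measurable_funX.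
have gm0 m s : (0 <= (g s ^+ (2 * m))%:E * phi s)%E.
  by rewrite mule_ge0// lee_fin exprM exprn_ge0// sqr_ge0.
transitivity (\int[lebesgue_tuple d.+1]_x \sum_(0 <= m <oo)
  ((2 / ((2 * m)`!)%:R)%:E * ((dot f x ^+ (2 * m))%:E *
     ((g (sqnorm x) ^+ (2 * m))%:E * phi (sqnorm x)))))%E.
  apply: eq_integral => x _; rewrite /F dot_topp sqnorm_topp mulrN.
  rewrite -ge0_muleDl ?lee_fin ?expR_ge0// -EFinD cosh_series muleC.
  rewrite -ge0_nneseriesZl//; last first.
    move=> m; rewrite lee_fin divr_ge0// mulr_ge0// exprM exprn_ge0// sqr_ge0//.
  apply: eq_eseriesr => m _; rewrite muleC !muleA -!EFinM; congr (_%:E * _)%E.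
  by rewrite exprMn; ring.
rewrite integral_nneseries//; last 2 first.
- move=> m; apply: emeasurable_funM; first exact: measurable_cst.
  exact: (measurable_radial f m (mgm m)).
- move=> m x _; rewrite mule_ge0 ?lee_fin ?divr_ge0//.
  exact: (radial_ge0 f m x (gm0 m)).
rewrite -ge0_nneseriesZl//; last first.
  move=> m; rewrite mule_ge0//.
    rewrite lee_fin divr_ge0// mulr_ge0// exprn_ge0 ?sqrtr_ge0//.
    by rewrite divr_ge0// sqnorm_ge0.
  by apply: integral_ge0 => s _; rewrite mule_ge0// lee_fin nhpow_ge0.
apply: eq_eseriesr => m _.
rewrite ge0_integralZl//; last 2 first.
- exact: (measurable_radial f m (mgm m)).
- by move=> x _; exact: (radial_ge0 f m x (gm0 m)).
rewrite (integral_radial_moment f m (mgm m) (gm0 m)) !muleA -!EFinM.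
congr (_%:E * _)%E; rewrite rising_half expr_div_n.
have f0 n : n`!%:R != 0 :> R by rewrite pnatr_eq0 -lt0n fact_gt0.
have n4 : 4 ^+ m != 0 :> R by rewrite expf_neq0.
move: (4 ^+ m) n4 ((2 * m)`!%:R) (f0 (2 * m)%N) => u u0 v v0.
by field; rewrite u0 v0 f0.
Qed.

End radial.

(** * Laplace transforms of the sphere and of the ball *)

Section laplace.
Context (R : realType).
Local Notation mu := (@lebesgue_measure R).

Lemma nhpow_shift k m (x : R) :
  nhpow (k.+1 + 2 * m) x = nhpow k.+1 x * x ^+ m / rising (k.+1%:R / 2) m.
Proof.
rewrite /nhpow -hpowX hGamma_rising.
have := hGamma_gt0 R k.
have : 0 < rising (k.+1%:R / 2 : R) m by rewrite rising_gt0// divr_gt0.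
move: (hGamma _ _) (rising _ _) => a b b0 a0.
by field; rewrite !gt_eqF.
Qed.

(** In the variable s = |x|^2 the density is itself a kernel in r^2 - s, so each term of the series
    is one more convolution. *)
Lemma ball_laplace d l (f : d.+1.-tuple R) (r : R) :
  (\int[lebesgue_tuple d.+1]_x
     ((expR (dot f x))%:E * (nhpow l.+1 (r ^+ 2 - sqnorm x))%:E) =
   (Num.sqrt pi ^+ d.+1 * nhpow (d.+1 + l.+1) (r ^+ 2))%:E *
     sphere_laplace (d.+1 + l.+1) (sqnorm f) r)%E.
Proof.
transitivity (\int[lebesgue_tuple d.+1]_x
   ((expR (1 * dot f x))%:E * (nhpow l.+1 (r ^+ 2 - sqnorm x))%:E))%E.
  by apply: eq_integral => x _; rewrite mul1r.
rewrite (integral_radial_exp f (g := cst 1)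
  (phi := fun s => (nhpow l.+1 (r ^+ 2 - s))%:E))//; last 2 first.
- apply/measurable_EFinP; apply: (measurableT_comp (@measurable_nhpow R _)).
  exact: measurable_funB.
- by move=> s; rewrite lee_fin nhpow_ge0.
have sq0 : 0 <= Num.sqrt pi ^+ d.+1 :> R by rewrite exprn_ge0// sqrtr_ge0.
rewrite -ge0_nneseriesZl; last 2 first.
- by rewrite lee_fin mulr_ge0// addSn nhpow_ge0.
- by move=> m; rewrite lee_fin sphere_laplace_term_ge0// sqnorm_ge0.
apply: eq_eseriesr => m _.
under eq_integral => s _ do rewrite /= expr1n mul1e -EFinM.
rewrite [in LHS]addSn nhpow_conv -!EFinM; congr EFin.
rewrite (_ : ((d + 2 * m).+1 + l.+1 = (d + l.+1).+1 + 2 * m)%N); last by lia.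
rewrite nhpow_shift -[(d.+1 + l.+1)%N]/(d + l.+1).+1 -exprM.
have f0 : m`!%:R != 0 :> R by rewrite pnatr_eq0 -lt0n fact_gt0.
have : 0 < rising ((d + l.+1).+1%:R / 2 : R) m by rewrite rising_gt0// divr_gt0.
move: (rising _ _) (m`!%:R) f0 ((sqnorm f / 4) ^+ m) (r ^+ (2 * m)) => a b b0 u v a0.
by field; rewrite b0 gt_eqF.
Qed.

Definition direction d (x : d.-tuple R) : d.-tuple R :=
  [tuple tnth x l / enorm x | l < d].

Lemma enormE d (x : d.-tuple R) : enorm x = Num.sqrt (sqnorm x).
Proof. by []. Qed.

Lemma measurable_sqrt : measurable_fun [set: R] (@Num.sqrt R).
Proof. by apply: continuous_measurable_fun; exact: sqrt_continuous. Qed.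

Lemma measurable_sqrtV : measurable_fun [set: R] (fun s : R => (Num.sqrt s)^-1).
Proof.
rewrite (_ : (fun s => _) = (fun y : R => y `^ (- 1)) \o @Num.sqrt R).
  by apply: measurableT_comp => //; exact: measurable_sqrt.
by apply/funext => s /=; rewrite powR_inv1// sqrtr_ge0.
Qed.

Lemma measurable_enorm d : measurable_fun [set: d.-tuple R] (@enorm R d).
Proof.
by apply: (measurableT_comp measurable_sqrt); exact: measurable_sqnorm.
Qed.

Lemma measurable_direction d : measurable_fun [set: d.-tuple R] (@direction d).
Proof.
apply/measurable_fun_tnthP => i.
rewrite (_ : _ \o _ = fun x => tnth x i * (Num.sqrt (sqnorm x))^-1); last first.
  by apply/funext => x /=; rewrite tnth_mktuple.
apply: measurable_funM; first exact: measurable_tnth.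
by apply: (measurableT_comp measurable_sqrtV); exact: measurable_sqnorm.
Qed.

Lemma dot_direction d (f x : d.-tuple R) :
  dot f (direction x) = (Num.sqrt (sqnorm x))^-1 * dot f x.
Proof.
rewrite /dot mulr_sumr; apply: eq_bigr => l _.
by rewrite tnth_mktuple enormE mulrA mulrC.
Qed.

Definition punctured_ball d : set (d.-tuple R) := [set x | 0 < enorm x < 1].

Lemma punctured_ballE d (x : d.-tuple R) :
  \1_(@punctured_ball d) x = hpow 2 (sqnorm x) * hpow 2 (1 - sqnorm x).
Proof.
rewrite !hpow2 subr_gt0 -natrM mulnb indicE; congr (_%:R); congr nat_of_bool.
rewrite (_ : (x \in _) = (0 < enorm x < 1)); last by apply/idP/idP; rewrite inE.
rewrite enormE sqrtr_gt0; case: (ltP 0 (sqnorm x)) => //= x0.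
by rewrite -[X in _ < X]sqrtr1 ltr_sqrt.
Qed.

Lemma measurable_punctured_ball d : measurable (@punctured_ball d).
Proof.
rewrite (_ : @punctured_ball d = @enorm R d @^-1` `]0, 1[%classic).
  by rewrite -[X in measurable X]setTI; apply: measurable_enorm.
by apply/seteqP; split => x /=; rewrite in_itv.
Qed.

(** The volume of the unit ball in dimension D = d + 1, since [nhpow (D + 2) 1] is 1 / Gamma(D/2 +
    1). *)
Let vol d := Num.sqrt pi ^+ d.+1 * nhpow (d.+1 + 2) 1 : R.

Let vol_gt0 d : 0 < vol d.
Proof.
rewrite mulr_gt0 ?exprn_gt0 ?sqrtr_gt0 ?pi_gt0//.
by rewrite divr_gt0 ?hpow_gt0// addnC hGamma_gt0.
Qed.

(** Normalizing x divides the m-th term by s^m, which undoes the shift of the kernel by 2m; every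
    term then carries the same volume. *)
Lemma sphere_laplace_cone d (f : d.+1.-tuple R) (u : R) :
  (\int[lebesgue_tuple d.+1]_x ((expR (u * dot f (direction x)))%:E *
       (\1_(@punctured_ball d.+1) x)%:E) =
   (vol d)%:E * sphere_laplace d.+1 (sqnorm f) u)%E.
Proof.
have m2 : measurable_fun [set: R] (fun s : R => hpow 2 s * hpow 2 (1 - s)).
  apply: measurable_funM; first exact: measurable_hpow.
  apply: (measurableT_comp (@measurable_hpow R 2)); exact: measurable_funB.
transitivity (\int[lebesgue_tuple d.+1]_x
   ((expR (u / Num.sqrt (sqnorm x) * dot f x))%:E *
    (hpow 2 (sqnorm x) * hpow 2 (1 - sqnorm x))%:E))%E.
  by apply: eq_integral => x _; rewrite punctured_ballE dot_direction mulrA.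
rewrite (integral_radial_exp f (g := fun s => u / Num.sqrt s)
  (phi := fun s => (hpow 2 s * hpow 2 (1 - s))%:E)); last 3 first.
- by apply: measurable_funM => //; exact: measurable_sqrtV.
- exact/measurable_EFinP.
- by move=> s; rewrite lee_fin mulr_ge0 ?hpow_ge0.
rewrite -ge0_nneseriesZl; last 2 first.
- by rewrite lee_fin ltW.
- by move=> m; rewrite lee_fin sphere_laplace_term_ge0// sqnorm_ge0.
apply: eq_eseriesr => m _.
have r0 : 0 < rising (d.+1%:R / 2 : R) m by rewrite rising_gt0// divr_gt0.
have u0 : 0 <= u ^+ (2 * m) / rising (d.+1%:R / 2 : R) m.
  by rewrite divr_ge0 ?(ltW r0)// exprM exprn_ge0// sqr_ge0.
transitivity ((Num.sqrt pi ^+ d.+1 * (sqnorm f / 4) ^+ m / m`!%:R)%:E *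
  \int[mu]_s ((u ^+ (2 * m) / rising (d.+1%:R / 2) m)%:E *
     (nhpow d.+1 s * nhpow 2 (1 - s))%:E))%E.
  congr (_ * _)%E; apply: eq_integral => s _; rewrite -!EFinM; congr EFin.
  have n2 y : nhpow 2 y = hpow 2 y :> R by rewrite /nhpow hGamma2 divr1.
  rewrite nhpow_shift n2 [hpow 2 s]hpow2.
  case: ltP => s0; last by rewrite /nhpow hpow_le0// !(mul0r, mulr0).
  rewrite mul1r.
  have -> : (u / Num.sqrt s) ^+ (2 * m) = u ^+ (2 * m) / s ^+ m.
    by rewrite expr_div_n (exprM (Num.sqrt s)) sqr_sqrtr// ltW.
  have : 0 < s ^+ m by rewrite exprn_gt0.
  move: (s ^+ m) (u ^+ (2 * m)) (nhpow _ _) (hpow _ _) => a b v w a0.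
  by field; rewrite !gt_eqF.
rewrite ge0_integralZl//; last 2 first.
- apply/measurable_EFinP; apply: measurable_funM; first exact: measurable_nhpow.
  apply: (measurableT_comp (@measurable_nhpow R 2)); exact: measurable_funB.
- by move=> s _; rewrite lee_fin mulr_ge0 ?nhpow_ge0.
rewrite nhpow_conv -!EFinM; congr EFin; rewrite /vol.
have f0 : m`!%:R != 0 :> R by rewrite pnatr_eq0 -lt0n fact_gt0.
move: (rising _ _) r0 {u0} (m`!%:R) f0 ((sqnorm f / 4) ^+ m) (u ^+ (2 * m)) => a a0 b b0 w v.
by field; rewrite b0 gt_eqF.
Qed.

Let volE d : lebesgue_tuple d.+1 (@punctured_ball d.+1) = (vol d)%:E.
Proof.
have := sphere_laplace_cone ([tuple 0 | l < d.+1]) 0.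
rewrite sqnorm0 sphere_laplace0 mule1 => <-.
under eq_integral do rewrite mul0r expR0 mul1e.
by rewrite integral_indic ?setIT//; exact: measurable_punctured_ball.
Qed.

Let ballE d : lebesgue_tuple d.+1 (@eball R d.+1 1) = (vol d)%:E.
Proof.
have := ball_laplace 1 ([tuple 0 | l < d.+1]) 1.
rewrite sqnorm0 sphere_laplace0 mule1 expr1n => <-.
have mb : measurable (@eball R d.+1 1).
  rewrite (_ : @eball R d.+1 1 = @enorm R d.+1 @^-1` `]-oo, 1[%classic).
    by rewrite -[X in measurable X]setTI; apply: measurable_enorm.
  by apply/seteqP; split => x /=; rewrite in_itv.
rewrite -[in LHS](setIT (eball 1)) -integral_indic//.
apply: eq_integral => x _; rewrite dot0 expR0 mul1e; congr EFin; rewrite /nhpow hGamma2 divr1 hpow2 subr_gt0.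
rewrite indicE; congr (_%:R); congr nat_of_bool.
rewrite (_ : (x \in _) = (enorm x < 1)); last by apply/idP/idP; rewrite inE.
by rewrite enormE -[X in _ < X]sqrtr1 ltr_sqrt.
Qed.

(** The cone definition presents [sigma] as the image under [direction] of the uniform law on the
    punctured ball. *)
Lemma sphere_uniform_laplace d (sigma : {measure set (d.+1.-tuple R) -> \bar R})
    (f : d.+1.-tuple R) (u : R) :
  (forall A, measurable A -> sigma A = sphere_uniform A) ->
  (\int[sigma]_v (expR (u * dot f v))%:E = sphere_laplace d.+1 (sqnorm f) u)%E.
Proof.
move=> hs.
have mi : measurable_fun [set: d.+1.-tuple R]
    (fun x => (vol d)^-1 * \1_(@punctured_ball d.+1) x).
  apply: measurable_funM => //; apply: measurable_indic.
  exact: measurable_punctured_ball.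
have v0 : 0 <= (vol d)^-1 by rewrite invr_ge0 ltW.
have i0 x : 0 <= (vol d)^-1 * \1_(@punctured_ball d.+1) x by rewrite mulr_ge0.
have me : measurable_fun [set: d.+1.-tuple R] (fun v => expR (u * dot f v)).
  by apply: measurableT_comp => //; apply: measurable_funM => //; exact: measurable_dot.
rewrite (ge0_integral_density_transfer (mu := lebesgue_tuple d.+1)
  (phi := @direction d.+1) _ mi i0); last 4 first.
- exact: measurable_direction.
- move=> A mA; rewrite hs// /sphere_uniform ballE/=.
  have mD : measurable (@direction d.+1 @^-1` A).
    by rewrite -[X in measurable X]setTI; exact: measurable_direction.
  transitivity ((vol d)^-1%:E * \int[lebesgue_tuple d.+1]_(x in @direction d.+1 @^-1` A)
     (\1_(@punctured_ball d.+1) x)%:E)%E; last first.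
    rewrite -ge0_integralZl//; last first.
      apply/measurable_EFinP/measurable_funTS; apply: measurable_indic.
      exact: (@measurable_punctured_ball d.+1).
  rewrite integral_indic//; last exact: (@measurable_punctured_ball d.+1).
  rewrite mulrC EFinM; congr (_ * _)%E.
  rewrite fineK// ge0_fin_numE// (@le_lt_trans _ _ (vol d)%:E) ?ltry//.
  rewrite -volE; apply: le_measure; rewrite ?inE.
  + by apply: measurableI => //; exact: measurable_punctured_ball.
  + exact: measurable_punctured_ball.
  + by move=> x [].
- exact/measurable_EFinP.
- by move=> v; rewrite lee_fin expR_ge0.
transitivity ((vol d)^-1%:E * ((vol d)%:E * sphere_laplace d.+1 (sqnorm f) u))%E; last first.
  by rewrite muleA -EFinM mulVf ?mul1e// gt_eqF.
rewrite -sphere_laplace_cone -ge0_integralZl//; last first.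
  apply: emeasurable_funM; last first.
    by apply/measurable_EFinP/measurable_indic; exact: measurable_punctured_ball.
  apply/measurable_EFinP.
  exact: (measurableT_comp me (@measurable_direction d.+1)).
by apply: eq_integral => x _; rewrite EFinM muleCA.
Qed.

End laplace.

(** * Generalized Dirichlet integrals *)

Section sphere_laplace_regularity.
Context (R : realType).

(** For D >= 2 the rising factorials are at least 1, and the series is dominated by exp(z t^2 /
    4). *)
Lemma sphere_laplace_lty D (z t : R) : (1 < D)%N -> 0 <= z ->
  (sphere_laplace D z t < +oo)%E.
Proof.
move=> D1 z0; have D0 : (0 < D)%N by exact: ltnW.
pose x := z / 4 * t ^+ 2.
have x0 : 0 <= x by rewrite mulr_ge0 ?sqr_ge0// divr_ge0.
have le n : (\sum_(0 <= m < n)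
    ((z / 4) ^+ m * t ^+ (2 * m) / (m`!%:R * rising (D%:R / 2) m))%:E <=
    (expR x)%:E)%E.
  rewrite sumEFin lee_fin.
  apply: le_trans (_ : series (exp_coeff x) n <= _); last first.
    apply: nondecreasing_cvgn_le; last exact: is_cvg_series_exp_coeff.
    by apply: nondecreasing_series => k _ _; exact: exp_coeff_ge0.
  rewrite seriesEnat/=; apply: ler_sum => m _.
  rewrite [exp_coeff x m]/(x ^+ m / m`!%:R) /x [in X in _ <= X]exprMn (exprM t).
  have f0 : 0 < m`!%:R :> R by rewrite ltr0n fact_gt0.
  rewrite ler_wpM2l//.
    by apply: mulr_ge0; apply: exprn_ge0; [exact: divr_ge0|exact: sqr_ge0].
  have r1 : 1 <= rising (D%:R / 2 : R) m.
    elim: m {f0} => [|m IH]; first by rewrite rising0.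
    rewrite risingSr mulr_ege1// ler_wpDr//.
    by rewrite ler_pdivlMr// mul1r ler_nat.
  rewrite lef_pV2 ?posrE//; last by rewrite mulr_gt0// (lt_le_trans ltr01).
  by rewrite ler_peMr// ltW.
apply: le_lt_trans (ltry (expR x)).
apply: lime_le; last by apply: nearW => n; exact: le.
apply: is_cvg_ereal_nneg_natsum => m _.
by rewrite lee_fin sphere_laplace_term_ge0.
Qed.

Lemma measurable_sphere_laplace D (z : R) : (0 < D)%N -> 0 <= z ->
  measurable_fun [set: R] (sphere_laplace D z).
Proof.
move=> D0 z0; apply: ge0_emeasurable_sum.
  by move=> m t _ _; rewrite lee_fin sphere_laplace_term_ge0.
move=> m _; apply/measurable_EFinP; apply: measurable_funM => //.
by apply: measurable_funM => //; exact: measurable_funX.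
Qed.

Definition rsphere_laplace D (z t : R) : R := fine (sphere_laplace D z t).

Lemma rsphere_laplaceE D (z t : R) : (1 < D)%N -> 0 <= z ->
  (rsphere_laplace D z t)%:E = sphere_laplace D z t.
Proof.
move=> D1 z0; rewrite fineK// ge0_fin_numE ?sphere_laplace_lty//.
by rewrite sphere_laplace_ge0// ltnW.
Qed.

Lemma rsphere_laplace_ge0 D (z t : R) : (1 < D)%N -> 0 <= z ->
  0 <= rsphere_laplace D z t.
Proof.
by move=> D1 z0; rewrite fine_ge0// sphere_laplace_ge0// ltnW.
Qed.

Lemma measurable_rsphere_laplace D (z : R) : (0 < D)%N -> 0 <= z ->
  measurable_fun [set: R] (rsphere_laplace D z).
Proof.
move=> D0 z0; apply: (measurableT_comp (f := fine)).
  exact: fine_measurable.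
exact: measurable_sphere_laplace.
Qed.

End sphere_laplace_regularity.

Section dirichlet.
Context (R : realType).
Local Notation mu := (@lebesgue_measure R).
Implicit Types (n : nat) (t x : R) (a b : nat -> R) (psi : R -> R).

Lemma simplex_indic n t (s : n.-tuple R) :
  \1_(simplex t) s =
  (\prod_(k < n) hpow 2 (tnth s k)) * hpow 2 (t - \sum_(k < n) tnth s k) :> R.
Proof.
rewrite hpow2 subr_gt0.
under eq_bigr do rewrite hpow2.
rewrite indicE; have [sP|sP] := boolP (s \in _).
  move: sP; rewrite inE => -[s0 ->]; rewrite mulr1 big1// => k _.
  by rewrite s0.
apply/esym/eqP; rewrite mulf_eq0; apply/orP.
have [st|_] := ltP (\sum_(k < n) tnth s k) t; last by right.
left; apply/eqP; have [k sk] : exists k, ~ 0 < tnth s k.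
  apply/existsNP => s0; move/negP: sP; apply; rewrite inE; split => //.
by rewrite (bigD1 k)//= (negbTE (introN idP sk)) mul0r.
Qed.

Lemma prod_durations n t (s : n.-tuple R) psi :
  \prod_(k < n.+1) psi (tnth (durations t s) k) =
  (\prod_(k < n) psi (tnth s k)) * psi (t - \sum_(k < n) tnth s k).
Proof.
by rewrite -(big_tuple _ _ (durations t s) xpredT) big_rcons/= big_tuple mulrC.
Qed.

(** Once the first duration x is removed, the weight has the same form with horizon t - x and
    shifted parameters; this is the source of the iterated convolutions. *)
Lemma GD_weight_tcons n t a b x (s : n.-tuple R) :
  GD_weight t a b (tcons (x, s)) =
  x `^ (a 1%N - 1) * (t - x) `^ (b 1%N - 1) *
  GD_weight (t - x) (fun k => a k.+1) (fun k => b k.+1) s.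
Proof.
rewrite /GD_weight big_ord_recl tnth_tcons0; congr (_ * _ * _).
  rewrite (big_pred1 ord0) ?tnth_tcons0// => l.
  by rewrite leqn0.
apply: eq_bigr => k _; rewrite tnth_tconsS lift0; congr (_ * _ `^ _).
rewrite big_mkcond big_ord_recl/= tnth_tcons0 opprD addrA; congr (_ - _).
rewrite [RHS]big_mkcond; apply: eq_bigr => l _.
by rewrite tnth_tconsS /bump/= add1n ltnS.
Qed.

Definition GD_integrand n t a b psi (s : n.-tuple R) : R :=
  \1_(simplex t) s * (GD_weight t a b s *
    \prod_(k < n.+1) psi (tnth (durations t s) k)).

Definition GD_integral n t a b psi : \bar R :=
  (\int[lebesgue_tuple n]_s (GD_integrand t a b psi s)%:E)%E.

Lemma GD_integrand_tcons n t a b psi x (s : n.-tuple R) :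
  GD_integrand t a b psi (tcons (x, s)) =
  hpow 2 x * x `^ (a 1%N - 1) * (t - x) `^ (b 1%N - 1) * psi x *
  GD_integrand (t - x) (fun k => a k.+1) (fun k => b k.+1) psi s.
Proof.
rewrite /GD_integrand GD_weight_tcons !prod_durations !simplex_indic.
have tE (phi : R -> R) :
    \prod_(k < n) phi (tnth (tcons (x, s)) (lift ord0 k)) = \prod_(k < n) phi (tnth s k).
  by apply: eq_bigr => k _; rewrite tnth_tconsS.
have sE : \sum_(k < n) tnth (tcons (x, s)) (lift ord0 k) = \sum_(k < n) tnth s k.
  by apply: eq_bigr => k _; rewrite tnth_tconsS.
rewrite !big_ord_recl !tnth_tcons0 !tE sE opprD addrA/=.
ring.
Qed.

Lemma GD_weight_ge0 n t a b (s : n.-tuple R) : 0 <= GD_weight t a b s.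
Proof. by apply: prodr_ge0 => k _; rewrite mulr_ge0// powR_ge0. Qed.

Lemma GD_integrand_ge0 n t a b psi (s : n.-tuple R) : (forall u, 0 <= psi u) ->
  0 <= GD_integrand t a b psi s.
Proof.
by move=> psi0; rewrite !mulr_ge0 ?GD_weight_ge0//; exact: prodr_ge0.
Qed.

Lemma measurable_tuple_sum n (P : pred 'I_n) :
  measurable_fun [set: n.-tuple R] (fun s => \sum_(l < n | P l) tnth s l).
Proof.
under eq_fun do rewrite big_mkcond.
apply: measurable_sum => l; case: (P l) => //; exact: measurable_tnth.
Qed.

Lemma measurable_GD_weight n t a b :
  measurable_fun [set: n.-tuple R] (GD_weight t a b).
Proof.
apply: measurable_prod => k _; apply: measurable_funM.
  exact: (measurableT_comp (measurable_powR _) (measurable_tnth k)).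
apply: (measurableT_comp (measurable_powR _)); apply: measurable_funB => //.
exact: measurable_tuple_sum.
Qed.

Lemma measurable_simplex_indic n t :
  measurable_fun [set: n.-tuple R] (\1_(simplex t) : n.-tuple R -> R).
Proof.
rewrite (_ : \1_ _ = fun s : n.-tuple R => (\prod_(k < n) hpow 2 (tnth s k)) *
    hpow 2 (t - \sum_(k < n) tnth s k)); last first.
  by apply/funext => s; rewrite simplex_indic.
apply: measurable_funM.
  apply: measurable_prod => k _.
  exact: (measurableT_comp (@measurable_hpow R 2) (measurable_tnth k)).
apply: (measurableT_comp (@measurable_hpow R 2)); apply: measurable_funB => //.
exact: measurable_tuple_sum.
Qed.

Lemma measurable_duration n t (k : 'I_n.+1) :
  measurable_fun [set: n.-tuple R] (fun s => tnth (durations t s) k).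
Proof.
have [kn|kn] := ltnP k n.
  rewrite (_ : (fun s => _) = fun s => tnth s (Ordinal kn)).
    exact: measurable_tnth.
  apply/funext => s; rewrite (tnth_nth 0) (tnth_nth 0)/= nth_rcons.
  by rewrite size_tuple kn.
rewrite (_ : (fun s => _) = fun s => t - \sum_(k < n) tnth s k).
  by apply: measurable_funB => //; exact: measurable_tuple_sum.
apply/funext => s; rewrite (tnth_nth 0)/= nth_rcons size_tuple ltnNge kn/=.
by rewrite ifT// eqn_leq kn -ltnS ltn_ord.
Qed.

Lemma measurable_GD_integrand n t a b psi : measurable_fun [set: R] psi ->
  measurable_fun [set: n.-tuple R] (GD_integrand t a b psi).
Proof.
move=> mpsi; apply: measurable_funM; first exact: measurable_simplex_indic.
apply: measurable_funM; first exact: measurable_GD_weight.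
apply: measurable_prod => k _.
exact: (measurableT_comp mpsi (@measurable_duration n t k)).
Qed.

Lemma GD_integral0 t a b psi : measurable_fun [set: R] psi ->
  GD_integral 0 t a b psi = (hpow 2 t * psi t)%:E.
Proof.
move=> mpsi; rewrite /GD_integral ge0_integral_tuple0; last first.
  by apply/measurable_EFinP; exact: measurable_GD_integrand.
rewrite /GD_integrand prod_durations simplex_indic /GD_weight !big_ord0 subr0.
by rewrite !mul1r.
Qed.

Lemma GD_integral_le0 n t a b psi : t <= 0 -> GD_integral n t a b psi = 0%E.
Proof.
move=> t0; rewrite /GD_integral integral0_eq// => s _.
rewrite /GD_integrand simplex_indic.
have [s0|] := pselect (forall k, 0 < tnth s k).
  rewrite [hpow 2 (t - _)]hpow_le0 ?mulr0 ?mul0r// subr_le0 (le_trans t0)//.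
  by apply: sumr_ge0 => k _; rewrite ltW.
move=> /existsNP[k /negP]; rewrite -leNgt => sk.
by rewrite (bigD1 k)//= hpow_le0// !mul0r.
Qed.

Lemma GD_integralS n t (A B : nat) a b psi :
  a 1%N = A%:R / 2 -> b 1%N = B%:R / 2 ->
  measurable_fun [set: R] psi -> (forall u, 0 <= psi u) ->
  (GD_integral n.+1 t a b psi =
   \int[mu]_x ((hpow A x * psi x)%:E * ((hpow B (t - x))%:E *
     GD_integral n (t - x) (fun k => a k.+1) (fun k => b k.+1) psi)))%E.
Proof.
move=> aE bE mpsi psi0; rewrite {1}/GD_integral ge0_integral_tcons; last 2 first.
- by apply/measurable_EFinP; exact: measurable_GD_integrand.
- by move=> s; rewrite lee_fin GD_integrand_ge0.
apply: eq_integral => x _; rewrite /GD_integral.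
under eq_integral do rewrite GD_integrand_tcons EFinM.
rewrite ge0_integralZl//; last 3 first.
- by apply/measurable_EFinP; exact: measurable_GD_integrand.
- by move=> s _; rewrite lee_fin GD_integrand_ge0.
- by rewrite lee_fin !mulr_ge0 ?powR_ge0 ?hpow_ge0.
rewrite -/(GD_integral _ _ _ _ _) muleA -EFinM.
(* For x >= t the power [powR] may differ from [hpow], but the remaining integral is then 0. *)
have [xt|tx] := ltP 0 (t - x); last by rewrite GD_integral_le0// !mule0.
congr (_%:E * _)%E; rewrite aE bE hpow2 !hpowE xt.
by case: ltP => x0; rewrite ?mul0r// mul1r mulrAC.
Qed.

End dirichlet.

(** * Transforms of generalized Dirichlet weights *)

Section dirichlet_laplace.
Context (R : realType).
Local Notation mu := (@lebesgue_measure R).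
Implicit Types (a b : nat -> R).

(** The constant may not depend on z or t: uniformity in t feeds the next convolution, and
    uniformity in z lets the value at z = 0 eliminate it. *)
Let GD_laplace d n a b k D := exists2 C : R, 0 <= C & forall z t : R, 0 <= z ->
  GD_integral n t a b (rsphere_laplace d z) =
    (C%:E * ((nhpow k t)%:E * sphere_laplace D z t))%E.

(** The factor (t - x)^(b_1 - 1) first moves the index of the inner function from k to k'; the
    convolution with the first duration is performed afterwards. *)
Let GD_laplace_step d n a b k D (A B k' D' k2 : nat) :
  (1 < d)%N -> (0 < D)%N -> (0 < A)%N -> (0 < k')%N -> (0 < k)%N ->
  a 1%N = A%:R / 2 -> b 1%N = B%:R / 2 -> (B + k = k' + 2)%N ->
  (forall z t : R, (0 <= z)%R ->
     \int[mu]_s ((nhpow A s)%:E * sphere_laplace d z s *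
       ((nhpow k' (t - s))%:E * sphere_laplace D z (t - s))) =
     (nhpow k2 t)%:E * sphere_laplace D' z t)%E ->
  GD_laplace d n (fun i => a i.+1) (fun i => b i.+1) k D ->
  GD_laplace d n.+1 a b k2 D'.
Proof.
move=> d1 D0 A0 k'0 k0 aE bE Bk conv [C C0 IH].
have G0 j : (0 < j)%N -> 0 < hGamma R j by case: j => // j _; exact: hGamma_gt0.
have n0 j (s : R) : (0 < j)%N -> (0 <= (nhpow j s)%:E)%E.
  by case: j => // j _; rewrite lee_fin nhpow_ge0.
exists (C * hGamma R A * hGamma R k' / hGamma R k).
  by rewrite !mulr_ge0 ?invr_ge0 ?(ltW (G0 _ _)).
move=> z t z0; rewrite (GD_integralS _ _ aE bE); last 2 first.
- by apply: measurable_rsphere_laplace => //; exact: ltnW.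
- by move=> u; exact: rsphere_laplace_ge0.
have mP D1 j : (0 < D1)%N ->
    measurable_fun [set: R] (fun s => (nhpow j s)%:E * sphere_laplace D1 z s)%E.
  move=> D10; apply: emeasurable_funM.
    by apply/measurable_EFinP; exact: measurable_nhpow.
  exact: measurable_sphere_laplace.
rewrite -conv// -ge0_integralZl//; last 3 first.
- apply: emeasurable_funM; first by apply: mP; exact: ltnW.
  apply: (measurableT_comp (mP D k' D0)); exact: measurable_funB.
- move=> s _; rewrite !mule_ge0 ?n0 ?sphere_laplace_ge0//; exact: ltnW.
- by rewrite lee_fin !mulr_ge0 ?invr_ge0 ?(ltW (G0 _ _)).
apply: eq_integral => s _; rewrite IH// EFinM rsphere_laplaceE//.
have -> : (hpow A s)%:E = ((hGamma R A)%:E * (nhpow A s)%:E)%E.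
  by rewrite -EFinM /nhpow mulrC divfK// gt_eqF// G0.
set L := sphere_laplace d z s; set L' := sphere_laplace D z (t - s).
have hk : ((hpow B (t - s))%:E * (C%:E * (nhpow k (t - s))%:E) =
    (C * hGamma R k' / hGamma R k)%:E * (nhpow k' (t - s))%:E)%E.
  rewrite -!EFinM; congr EFin; rewrite /nhpow -(hpowM _ Bk).
  have := G0 _ k0; have := G0 _ k'0.
  move: (hGamma _ k') (hGamma _ k) => u v u0 v0.
  by field; rewrite !gt_eqF.
rewrite [(C%:E * (_ * _))%E]muleA [(_ * (_ * L'))%E in LHS]muleA hk.
rewrite (_ : C * _ * _ / _ = hGamma R A * (C * hGamma R k' / hGamma R k)); last first.
  by ring.
rewrite [in RHS]EFinM -!muleA; congr (_ * _)%E.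
by rewrite [RHS]muleCA; congr (_ * _)%E; rewrite muleCA.
Qed.

(** Durations after the j-th, with e = d - 2. The last exponent b_L moves the index 2 of the bare
    remaining time to e + 2 eps, a value admissible for Rothe or Hagen; the others are neutral. *)
Let GD_laplace_tail e eps L a b : (0 < e)%N -> (eps <= 1)%N -> (0 < L)%N ->
  (forall k, (1 <= k <= L)%N -> a k = e%:R / 2) ->
  (forall k, (1 <= k < L)%N -> b k = 1) -> b L = (e + 2 * eps)%:R / 2 ->
  GD_laplace e.+2 L a b (L.+1 * e + 2 * eps) (L.+1 * e).+2.
Proof.
move=> e0 eps1; elim: L a b => // -[_|L IH] a b _ ha hb hbL.
  apply: (@GD_laplace_step e.+2 0 a b 2 e.+2 e (e + 2 * eps) (e + 2 * eps)) => //.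
  - by rewrite addn_gt0 e0.
  - exact: ha.
  - move=> z t z0; rewrite (_ : (2 * e + 2 * eps = e + e + 2 * eps)%N); last by lia.
    rewrite (_ : (2 * e = e + e)%N); last by lia.
    by apply: sphere_laplace_conv_half => //; rewrite addn_gt0 e0.
  exists 1 => // z t z0; rewrite GD_integral0; last first.
    exact: measurable_rsphere_laplace.
  by rewrite mul1e EFinM rsphere_laplaceE// /nhpow hGamma2 divr1.
have q0 : (0 < L.+2 * e)%N by rewrite muln_gt0 e0.
apply: (@GD_laplace_step e.+2 L.+1 a b (L.+2 * e + 2 * eps) (L.+2 * e).+2 e 2
  (L.+2 * e + 2 * eps)) => //.
- by rewrite addn_gt0 q0.
- by rewrite addn_gt0 q0.
- exact: ha.
- by rewrite hb// divff.
- by rewrite addnC.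
- move=> z t z0; rewrite (mulSn L.+2).
  by apply: sphere_laplace_conv_half => //; rewrite addn_gt0 q0.
apply: IH => //.
- by move=> k /andP[k1 kL]; apply: ha; rewrite !ltnS kL.
- by move=> k /andP[k1 kL]; apply: hb; exact: kL.
Qed.

(** First j durations. Put q = (L+1) e + 1, so that the tail has D = q + 1. The value of b_J sends
    its index (L+1) e + 2 eps to 2 (q + h), as Vandermonde requires; eps disappears at this
    point. *)
Let GD_laplace_head e eps h L J a b : (0 < e)%N -> (eps <= 1)%N -> (h <= 1)%N ->
  (0 < L)%N -> (0 < J)%N ->
  (forall k, (1 <= k <= J)%N -> a k = (2 * e.+1)%:R / 2) ->
  (forall k, (1 <= k <= L)%N -> a (J + k)%N = e%:R / 2) ->
  (forall k, (1 <= k < J)%N -> b k = 1) ->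
  b J = (L.+1 * e + 2 * (1 - eps) + 2 * h + 2)%:R / 2 ->
  (forall k, (1 <= k < L)%N -> b (J + k)%N = 1) ->
  b (J + L)%N = (e + 2 * eps)%:R / 2 ->
  GD_laplace e.+2 (J + L) a b
    (2 * (J * e.+1 + (L.+1 * e).+1 + h)) (J * e.+1 + (L.+1 * e).+1).+1.
Proof.
move=> e0 eps1 h1 L0; elim: J a b => // -[_|J IH] a b _ haJ haL hbJ hbj hbL hbn.
  rewrite add1n.
  apply: (@GD_laplace_step e.+2 L a b (L.+1 * e + 2 * eps) (L.+1 * e).+2
    (2 * e.+1) (L.+1 * e + 2 * (1 - eps) + 2 * h + 2)
    (2 * ((L.+1 * e).+1 + h))) => //.
  - by rewrite addn_gt0 muln_gt0 e0.
  - exact: haJ.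
  - by move: eps1; lia.
  - move=> z t z0; rewrite mul1n.
    exact: sphere_laplace_conv_double.
  exact: GD_laplace_tail.
rewrite addSn.
apply: (@GD_laplace_step e.+2 (J.+1 + L) a b (2 * (J.+1 * e.+1 + (L.+1 * e).+1 + h))
  (J.+1 * e.+1 + (L.+1 * e).+1).+1 (2 * e.+1) 2
  (2 * (J.+1 * e.+1 + (L.+1 * e).+1 + h))) => //.
- exact: haJ.
- by rewrite hbJ// divff.
- by rewrite addnC.
- move=> z t z0; rewrite (mulSn J.+1) -(addnA e.+1).
  by apply: sphere_laplace_conv_double.
apply: (IH (fun i => a i.+1) (fun i => b i.+1)) => //.
- by move=> k /andP[k1 kJ]; apply: haJ.
- by move=> k /andP[k1 kJ]; apply: hbJ.
Qed.

Lemma GD_integral_laplace d h i n j : (3 <= d)%N -> (h <= 1)%N -> (i <= 1)%N ->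
  (1 <= j <= n - 1)%N ->
  exists2 C : R, 0 <= C & forall z t : R, 0 <= z ->
    GD_integral n t (GD_a R d j) (GD_b R d h i n j) (rsphere_laplace d z) =
    (C%:E * ((nhpow (2 * (n.+1 * (d - 2) + j + 1 + h)) t)%:E *
      sphere_laplace (n.+1 * (d - 2) + j + 2) z t))%E.
Proof.
move=> d3 h1 i1 /andP[j1 jn].
have [e dE] : exists e, d = e.+2 by exists (d - 2)%N; lia.
have e0 : (0 < e)%N by lia.
rewrite dE subn2/=.
(* The flag of the tail is 1 - i, because b_n = d/2 - i = (e + 2 (1 - i)) / 2. *)
have := @GD_laplace_head e (1 - i) h (n - j) j (GD_a R e.+2 j) (GD_b R e.+2 h i n j) e0.
rewrite subnKC; last by lia.
have e2 : e.+2%:R / 2 - 1 = e%:R / 2 :> R by rewrite -addn2 natrD; field.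
have -> : (j * e.+1 + ((n - j).+1 * e).+1 + h = n.+1 * e + j + 1 + h)%N by nia.
have -> : (j * e.+1 + ((n - j).+1 * e).+1).+1 = (n.+1 * e + j + 2)%N by nia.
apply => //.
- by lia.
- by lia.
- move=> k /andP[_ kj]; rewrite /GD_a kj natrM -[e.+2%:R]natr1 addrK.
  by rewrite mulrAC divff// mul1r.
- by move=> k /andP[k1 _]; rewrite /GD_a leqNgt -addn1 leq_add2l k1.
- move=> k /andP[_ kj]; rewrite /GD_b ltn_eqF// ifF//.
  by apply/negbTE; move: kj jn; lia.
- rewrite /GD_b eqxx e2 addn1 subKn//.
  by rewrite !natrD !natrM; field.
- move=> k /andP[k1 kn]; rewrite /GD_b !ifF//; apply/negbTE; lia.
- rewrite /GD_b ifF; last by apply/negbTE; lia.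
  rewrite eqxx [in RHS]natrD natrM natrB//; field=> //.
Qed.

End dirichlet_laplace.

(** * Independence *)

Section bounded_integral.
Context dO (T : measurableType dO) (R : realType).

Lemma ge0_bounded_integral_lty (nu : {finite_measure set T -> \bar R}) (f : T -> R) M :
  measurable_fun [set: T] f -> (forall x, 0 <= f x) -> (forall x, f x <= M) ->
  (\int[nu]_x (f x)%:E < +oo)%E.
Proof.
move=> mf f0 fM; apply: (@le_lt_trans _ _ (\int[nu]_x (cst M%:E) x)%E).
  apply: ge0_le_integral => //.
  - by move=> x _; rewrite lee_fin.
  - exact/measurable_EFinP.
  - by move=> x _; rewrite lee_fin.
have M0 := le_trans (f0 point) (fM point).
rewrite integral_cst// lte_mul_pinfty ?lee_fin//.
by rewrite -ge0_fin_numE// fin_num_measure.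
Qed.

End bounded_integral.

(** The existential form lets the image measure enter later proofs as a variable known only by its
    values. *)
Lemma exists_pushforward d1 d2 (T1 : measurableType d1) (T2 : measurableType d2)
    (R : realType) (m : {measure set T1 -> \bar R}) (phi : T1 -> T2) :
  measurable_fun setT phi ->
  exists m' : {measure set T2 -> \bar R}, forall A, m' A = m (phi @^-1` A).
Proof.
move=> mphi.
by unshelve refine (ex_intro _ (pushforward m phi : {measure set T2 -> \bar R}) _).
Qed.

Section exchange.
Context d0 d1 d2 (Omega : measurableType d0) (S : measurableType d1)
  (T : measurableType d2) (R : realType).
Variables (nu : {finite_measure set Omega -> \bar R})
  (sigma : {finite_measure set S -> \bar R}).
Variables (X : Omega -> S) (Y : Omega -> T) (H H' : Omega -> R) (M : R).
Hypotheses (mX : measurable_fun setT X) (mY : measurable_fun setT Y).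
Hypotheses (mH : measurable_fun setT H) (mH' : measurable_fun setT H').
Hypotheses (H0 : forall w, 0 <= H w) (H'0 : forall w, 0 <= H' w).
Hypothesis (H'M : forall w, H' w <= M).
Hypothesis XY : forall A C, measurable A -> measurable C ->
  (\int[nu]_w (\1_C (Y w) * (\1_A (X w) * H w))%:E =
   sigma A * \int[nu]_w (\1_C (Y w) * H' w)%:E)%E.

Let mXY : measurable_fun setT (fun w => (X w, Y w)).
Proof. exact: measurable_fun_pair. Qed.

Let integral_indicM (g : Omega -> R) (D : set Omega) : measurable D ->
  (\int[nu]_(w in D) (g w)%:E = \int[nu]_w (\1_D w * g w)%:E)%E.
Proof.
move=> mD; rewrite integral_mkcond; apply: eq_integral => w _.
by rewrite epatch_indic EFinM muleC.
Qed.

(** Both sides integrate [G]: one against the law of (X, Y) weighted by [H], the other against the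
    product of [sigma] with the law of Y weighted by [H']. By [XY] these measures agree on
    rectangles, hence everywhere. *)
Lemma independent_exchange (G : S * T -> \bar R) :
  measurable_fun setT G -> (forall p, 0 <= G p)%E ->
  (\int[nu]_w (G (X w, Y w) * (H w)%:E) =
   \int[nu]_w ((\int[sigma]_v G (v, Y w)) * (H' w)%:E))%E.
Proof.
move=> mG G0.
have [mu1 mu1E] := exists_pushforward (density_measure nu mH H0) mXY.
have [mu2 mu2E'] := exists_pushforward (density_measure nu mH' H'0) mY.
have mYC C : measurable C -> measurable (Y @^-1` C).
  by move=> mC; rewrite -[X in measurable X]setTI; exact: mY.
have mu2E C : measurable C -> mu2 C = (\int[nu]_w (\1_C (Y w) * H' w)%:E)%E.
  move=> mC; rewrite mu2E'; transitivity (\int[nu]_w (\1_(Y @^-1` C) w * H' w)%:E)%E.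
    by apply: integral_indicM; exact: mYC.
  by apply: eq_integral => w _; rewrite !indicE -[Y w \in C]/(w \in Y @^-1` C).
have mu2_lty : (mu2 setT < +oo)%E.
  rewrite mu2E//; under eq_integral do rewrite indicT mul1r.
  exact: ge0_bounded_integral_lty H'M.
(* Restriction to the full set changes no value; it supplies the finiteness needed to form the
   product measure. *)
pose q : {finite_measure set T -> \bar R} := mfrestr measurableT mu2_lty.
have qE C : q C = mu2 C by rewrite /q /= /mfrestr /mrestr setIT.
rewrite -(@ge0_integral_density_transfer _ _ _ _ _ nu mu1
  (fun w => (X w, Y w)) H G)//.
transitivity (\int[sigma \x q]_p G p)%E.
  apply/esym; apply: eq_measure_integral => A mA _.
  apply: product_measure_unique => // B C mB mC.
  rewrite [X in _ = (_ * X)%E](_ : _ = mu2 C); last exact: qE.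
  rewrite mu2E// -XY//.
  rewrite mu1E /= /density_measure [LHS]integral_indicM.
    apply: eq_integral => w _; rewrite mulrA; congr (_ * _)%:E.
    rewrite !indicE -natrM mulnb andbC; congr (_ %:R); congr nat_of_bool.
    by apply/idP/andP => [|[]]; rewrite !inE.
  by rewrite -[X in measurable X]setTI; apply: mXY => //; exact: measurableX.
rewrite fubini_tonelli2//.
rewrite -(@ge0_integral_density_transfer _ _ _ _ _ nu q Y H'
  (fun y => \int[sigma]_v G (v, y))%E)//.
- by move=> A mA; transitivity (mu2 A); [exact: qE|exact: mu2E'].
- exact: measurable_fun_fubini_tonelli_G.
- by move=> y; exact: integral_ge0.
Qed.

End exchange.

Lemma prod_bool_natr (R : comPzSemiRingType) (I : finType) (b : I -> bool) :
  \prod_k (b k)%:R = [forall k, b k]%:R :> R.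
Proof.
case: forallP => [h|h]; first by rewrite big1// => k _; rewrite h.
have [k bk] : exists k, ~ b k by exact/existsNP.
by rewrite (bigD1 k)//= (negbTE (introN idP bk)) mul0r.
Qed.

Section independent_integral.
Context d0 d1 d2 (Omega : measurableType d0) (S : measurableType d1)
  (T : measurableType d2) (R : realType) (K : nat).
Variables (nu : {finite_measure set Omega -> \bar R})
  (sigma : 'I_K -> probability S R) (V : 'I_K -> Omega -> S) (tau : Omega -> T).
Hypotheses (mV : forall k, measurable_fun setT (V k)) (mtau : measurable_fun setT tau).
Hypothesis V_tau : forall (B : 'I_K -> set S) C,
  (forall k, measurable (B k)) -> measurable C ->
  nu ((\bigcap_k (V k @^-1` B k)) `&` tau @^-1` C) =
  (\prod_(k < K) sigma k (B k) * nu (tau @^-1` C))%E.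

Definition averaged (s : probability S R) (g : S * T -> R) (y : T) : R :=
  fine (\int[s]_v (g (v, y))%:E)%E.

Let bounded_kernel M (g : S * T -> R) :=
  measurable_fun setT g /\ forall p, 0 <= g p <= M.

Let averagedE M s g y : bounded_kernel M g ->
  (averaged s g y)%:E = (\int[s]_v (g (v, y))%:E)%E.
Proof.
move=> [mg gM]; have g0 p : 0 <= g p by case/andP: (gM p).
have i0 : (0 <= \int[s]_v (g (v, y))%:E)%E.
  by apply: integral_ge0 => v _; rewrite lee_fin.
rewrite /averaged fineK// ge0_fin_numE//.
apply: (@ge0_bounded_integral_lty _ _ _ s _ M) => //.
- exact: (measurableT_comp mg (measurable_pair2 y)).
- by move=> v; case/andP: (gM (v, y)).
Qed.

Let bounded_averaged M s g y : bounded_kernel M g -> 0 <= averaged s g y <= M.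
Proof.
move=> bg; have [mg gM] := bg; have g0 p : 0 <= g p by case/andP: (gM p).
rewrite -!lee_fin (averagedE _ _ bg) integral_ge0/=; last first.
  by move=> v _; rewrite lee_fin.
apply: (@le_trans _ _ (\int[s]_v (cst M%:E) v)%E); last first.
  rewrite integral_cst//.
  rewrite [X in (_ * X <= _)%E](_ : _ = 1%E); last exact: probability_setT.
  by rewrite mule1.
apply: ge0_le_integral => //.
- by move=> x _; rewrite lee_fin.
- by apply/measurable_EFinP; exact: (measurableT_comp mg (measurable_pair2 y)).
- by move=> x _; rewrite lee_fin; case/andP: (gM (x, y)).
Qed.

Lemma measurable_averaged M s (g : S * T -> R) : measurable_fun setT g ->
  (forall p, 0 <= g p <= M) -> measurable_fun setT (averaged s g).
Proof.
move=> mg gM; apply: (measurableT_comp (f := fine)).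
  exact: fine_measurable.
apply: (@measurable_fun_fubini_tonelli_G _ _ _ _ _ s (fun p => (g p)%:E)).
  exact/measurable_EFinP.
by move=> p; rewrite lee_fin; case/andP: (gM p).
Qed.

Let mixed m (g : 'I_K -> S * T -> R) (B : 'I_K -> set S) (k : 'I_K) (p : S * T) : R :=
  if (k < m)%N then g k p else \1_(B k) p.1.

(** Independence is known for indicators, so the kernels are introduced one at a time: [mixed m]
    uses the first m kernels and indicators for the rest. *)
Lemma independent_integral (g : 'I_K -> S * T -> R) M :
  (forall k, measurable_fun setT (g k)) -> (forall k p, 0 <= g k p <= M) ->
  (\int[nu]_w (\prod_(k < K) g k (V k w, tau w))%:E =
   \int[nu]_w (\prod_(k < K) averaged (sigma k) (g k) (tau w))%:E)%E.
Proof.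
move=> mg gM.
have [K0|[k0]] : (K = 0)%N \/ inhabited 'I_K.
  by case: (posnP K) => [->|K0]; [left|right; exists; exact: (Ordinal K0)].
  by apply: eq_integral => w _; rewrite !big1// => k; move: (ltn_ord k); rewrite [X in (_ < X)%N]K0.
have M0 : 0 <= M by case/andP: (gM k0 point); exact: le_trans.
(* A common bound for kernels and indicators. *)
pose L := Num.max M 1.
have bg k : bounded_kernel L (g k).
  split=> // p; have /andP[-> pM] /= := gM k p.
  by rewrite le_max pM.
have bi (B : set S) : measurable B -> bounded_kernel L (fun p : S * T => \1_B p.1).
  move=> mB; split; last by move=> p; rewrite indicE le_max ler0n lern1 leq_b1 orbT.
  exact: (measurableT_comp (measurable_indic mB)).
have bm m B k : (forall k, measurable (B k)) -> bounded_kernel L (mixed m g B k).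
  move=> mB; have [km|mk] := ltnP k m.
    rewrite (_ : mixed m g B k = g k); first exact: bg.
    by apply/funext => p; rewrite /mixed km.
  rewrite (_ : mixed m g B k = fun p => \1_(B k) p.1); first exact: bi.
  by apply/funext => p; rewrite /mixed ltnNge mk.
have mpV k (f : S * T -> R) : measurable_fun setT f ->
    measurable_fun setT (fun w => f (V k w, tau w)).
  by move=> mf; apply: (measurableT_comp mf); exact: measurable_fun_pair.
(* [B] and [C] stay arbitrary: the rectangle hypothesis of [independent_exchange] for the next
   variable is the induction hypothesis with one set [B i] replaced. *)
suff main m B C : (m <= K)%N -> (forall k, measurable (B k)) -> measurable C ->
    (\int[nu]_w (\1_C (tau w) * \prod_(k < K) mixed m g B k (V k w, tau w))%:E =
     \int[nu]_w (\1_C (tau w) *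
       \prod_(k < K) averaged (sigma k) (mixed m g B k) (tau w))%:E)%E.
  have := main K (fun=> setT) setT (leqnn _) (fun=> measurableT) measurableT.
  under eq_integral do rewrite indicT mul1r.
  under [in X in _ = X -> _]eq_integral do rewrite indicT mul1r.
  have mK k : mixed K g (fun=> setT) k = g k.
    by apply/funext => p; rewrite /mixed ltn_ord.
  under eq_integral do under eq_bigr do rewrite mK.
  by under [in X in _ = X -> _]eq_integral do under eq_bigr do rewrite mK.
elim: m B C => [|m IH] B C mK mB mC.
  have mVB k : measurable (V k @^-1` B k).
    by rewrite -[X in measurable X]setTI; exact: mV.
  have mtC : measurable (tau @^-1` C) by rewrite -[X in measurable X]setTI; exact: mtau.
  have mVC : measurable ((\bigcap_k (V k @^-1` B k)) `&` tau @^-1` C).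
    by apply: measurableI => //; exact: fin_bigcap_measurable.
  transitivity (nu ((\bigcap_k (V k @^-1` B k)) `&` tau @^-1` C)).
    rewrite -[in RHS](setIT (_ `&` _)) -integral_indic//; apply: eq_integral => w _.
    congr EFin; rewrite (eq_bigr (fun k => (V k w \in B k)%:R)) => [|k _]; last first.
      by rewrite /mixed indicE.
    rewrite prod_bool_natr !indicE -natrM mulnb in_setI andbC; congr (_ && _)%:R.
    apply/forallP/idP => [h|]; first by rewrite inE => k _; apply/set_mem; exact: h.
    by rewrite inE => h k; apply/mem_set; exact: h.
  rewrite V_tau// (eq_bigr (fun k => (fine (sigma k (B k)))%:E)) => [|k _]; last first.
    by rewrite fineK// fin_num_measure.
  rewrite prodEFin -[tau @^-1` C]setIT -integral_indic// -ge0_integralZl//; last 2 first.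
  - exact/measurable_EFinP/measurable_indic.
  - by rewrite lee_fin prodr_ge0// => k _; exact: fine_ge0.
  apply: eq_integral => w _; rewrite EFinM muleC -EFinM -EFinM; congr (_ * _)%:E.
  apply: eq_bigr => k _; rewrite /averaged /mixed/= integral_indic// setIT.
  by [].
pose i := Ordinal mK.
pose a := mixed m.+1 g B.
have ba k : bounded_kernel L (a k) by exact: bm.
pose H w := \prod_(k < K | k != i) a k (V k w, tau w).
pose H' w := \prod_(k < K | k != i) averaged (sigma k) (a k) (tau w).
have mH : measurable_fun setT H.
  rewrite /H; under eq_fun do rewrite big_mkcond.
  apply: measurable_prod => k _; case: (k != i) => //.
  by apply: mpV; case: (ba k).
have mH' : measurable_fun setT H'.
  rewrite /H'; under eq_fun do rewrite big_mkcond.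
  apply: measurable_prod => k _; case: (k != i) => //.
  apply: (measurableT_comp _ mtau); case: (ba k); exact: measurable_averaged.
have H0 w : 0 <= H w by apply: prodr_ge0 => k _; case: (ba k) => _ /(_ (V k w, tau w))/andP[].
have H'0 w : 0 <= H' w.
  by apply: prodr_ge0 => k _; case/andP: (bounded_averaged (sigma k) (tau w) (ba k)).
have H'M w : H' w <= \prod_(k < K | k != i) L.
  by apply: ler_prod => k _; exact: bounded_averaged.
have m1C : measurable_fun setT (fun w => \1_C (tau w) : R).
  exact: (measurableT_comp (measurable_indic mC)).
have XY A D : measurable A -> measurable D ->
  (\int[nu]_w (\1_D (tau w) * (\1_A (V i w) * H w))%:E =
   sigma i A * \int[nu]_w (\1_D (tau w) * H' w)%:E)%E.
  move=> mA mD.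
  pose B' k := if k == i then A else B k.
  have mB' k : measurable (B' k) by rewrite /B'; case: ifP.
  have mixE k : k != i -> mixed m g B' k = a k.
    move=> ki; apply/funext => p; rewrite /a /mixed /B' (negbTE ki) [in RHS]ltnS [in RHS]leq_eqVlt.
    by rewrite -[(k == m :> nat)]/(k == i) (negbTE ki).
  have mixi : mixed m g B' i = fun p => \1_A p.1.
    by apply/funext => p; rewrite /mixed /B' eqxx ltnn.
  have := IH B' D (ltnW mK) mB' mD.
  under eq_integral do rewrite (bigD1 i)//= mixi.
  under [in X in _ = X -> _]eq_integral do rewrite (bigD1 i)//= mixi.
  under eq_integral do under [X in _ * (_ * X)]eq_bigr => k ki do rewrite mixE//.
  under [in X in _ = X -> _]eq_integral do under [X in _ * (_ * X)]eq_bigr => k ki do rewrite mixE//.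
  move=> ->.
  have aA w : averaged (sigma i) (fun p => \1_A p.1) (tau w) = fine (sigma i A).
    by rewrite /averaged /= integral_indic// setIT.
  under eq_integral do rewrite aA mulrCA EFinM fineK ?fin_num_measure//.
  rewrite ge0_integralZl//.
  - by apply/measurable_EFinP; apply: measurable_funM => //; exact: (measurableT_comp (measurable_indic mD)).
  - by move=> w _; rewrite lee_fin mulr_ge0//; exact: H'0.
have mG : measurable_fun setT (fun p : S * T => (\1_C p.2 * a i p)%:E).
  apply/measurable_EFinP; apply: measurable_funM; last by case: (ba i).
  exact: (measurableT_comp (measurable_indic mC)).
have G0 (p : S * T) : (0 <= (\1_C p.2 * a i p)%:E)%E.
  by rewrite lee_fin mulr_ge0//; case: (ba i) => _ /(_ p)/andP[].
have := independent_exchange (mV i) mtau mH mH' H0 H'0 H'M XY mG G0.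
under eq_integral => w _ do rewrite -EFinM -mulrA.
under [in X in _ -> X = _]eq_integral do rewrite (bigD1 i)//=.
under [in X in _ -> _ = X]eq_integral do rewrite (bigD1 i)//=.
move=> ->; apply: eq_integral => w _; rewrite /= mulrA !EFinM; congr (_ * _)%E.
rewrite (averagedE _ _ (ba i)) -ge0_integralZl//.
- by apply/measurable_EFinP; case: (ba i) => mai _; exact: (measurableT_comp mai (measurable_pair2 _)).
- by move=> v _; rewrite lee_fin; case: (ba i) => _ /(_ (v, tau w))/andP[].
Qed.

End independent_integral.

(** * Determination by the Laplace transform *)

Section orthants.
Context (R : realType) (m : nat).

Definition orthant (a : 'I_m -> R) : set (m.-tuple R) :=
  [set x | forall l, tnth x l <= a l].

Definition orthants : set (set (m.-tuple R)) :=
  [set orthant a | a in [set: 'I_m -> R]].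

Lemma orthantI : setI_closed orthants.
Proof.
move=> _ _ [a _ <-] [b _ <-]; exists (fun l => Num.min (a l) (b l)) => //.
apply/seteqP; split => [x xab|x [xa xb] l].
  by split=> l; have := xab l; rewrite le_min => /andP[].
by rewrite le_min xa xb.
Qed.

Lemma orthant_cover : \bigcup_k (orthant (fun=> k%:R)) = setT.
Proof.
apply/seteqP; split => // x _; pose s := \sum_(l < m) `|tnth x l|.
exists (Num.bound s) => // l; apply: le_trans (ltW (archi_boundP _)); last first.
  by apply: sumr_ge0 => i _.
apply: le_trans (ler_norm _) _; rewrite /s (bigD1 l)//= lerDl.
exact: sumr_ge0.
Qed.

Lemma measurable_orthant a : measurable (orthant a).
Proof.
rewrite (_ : orthant a = \bigcap_(l in [set: 'I_m])
    (fun x => tnth x l) @^-1` `]-oo, a l]%classic); last first.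
  by apply/seteqP; split => x h l => [_|]; have := h l; rewrite /= in_itv/=; exact.
apply: fin_bigcap_measurable => // l _; rewrite -[X in measurable X]setTI.
exact: measurable_tnth.
Qed.

Lemma measurable_orthants : measurable = <<s orthants >>.
Proof.
apply/seteqP; split; last first.
  apply: smallest_sub; first exact: sigma_algebra_measurable.
  by move=> _ [a _ <-]; exact: measurable_orthant.
apply: smallest_sub; first exact: smallest_sigma_algebra.
have tnth_orthants (l : 'I_m) : measurable_fun setT
    (fun x : g_sigma_algebraType orthants => tnth (x : m.-tuple R) l).
  apply: (@measurability _ _ (g_sigma_algebraType orthants) _ setT _ _ (RGenOInfty.measurableE R)).
  move=> _ [_ [b ->] <-]; rewrite setTI.
  rewrite (_ : _ @^-1` _ = ~` \bigcup_k
    (orthant (fun i => if i == l then b else k%:R))).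
    apply: measurableC; apply: bigcupT_measurable => k.
    by apply: sub_sigma_algebra; eexists.
  apply/seteqP; split => x /=.
    rewrite in_itv/= andbT => bx [k _ /(_ l)]; rewrite eqxx leNgt bx.
    by [].
  move=> h; rewrite in_itv/= andbT ltNge; apply/negP => xb; apply: h.
  have [k _ kx] : (\bigcup_k orthant (fun=> k%:R)) x by rewrite orthant_cover.
  by exists k => // i; case: eqP => [->//|_]; exact: kx.
elim/big_ind : _ => [//|A B hA hB X [/hA|/hB]//|l _ _ [B mB <-]].
exact: tnth_orthants.
Qed.

End orthants.

(** * Half-line indicators as limits of exponential sums *)

Section step_approximation.
Context (R : realType).
Implicit Types (a x u : R).

(** Bernoulli's inequality from below gives the limit 1 where u tends to 0; the bound exp(-u) from
    above gives the limit 0 where u tends to infinity. *)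
Lemma exp_pow_bounds (N : nat) u : (0 < N)%N -> 0 <= u <= N%:R ->
  [/\ 0 <= (1 - u / N%:R) ^+ N, 1 - u <= (1 - u / N%:R) ^+ N,
      (1 - u / N%:R) ^+ N <= expR (- u) & (1 - u / N%:R) ^+ N <= 1].
Proof.
move=> N0 /andP[u0 uN]; have N0' : 0 < N%:R :> R by rewrite ltr0n.
have v0 : 0 <= u / N%:R by rewrite divr_ge0.
have v1 : u / N%:R <= 1 by rewrite ler_pdivrMr ?mul1r.
have w0 : 0 <= 1 - u / N%:R by rewrite subr_ge0.
split.
- exact: exprn_ge0.
- rewrite [X in 1 - X](_ : u = N%:R * (u / N%:R)); last by rewrite mulrCA divff ?mulr1// gt_eqF.
  move: (u / N%:R) v0 v1 w0 => v v0 v1 w0 {uN u0 u N0 N0'}.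
  elim: N => [|N IH]; first by rewrite mul0r subr0 expr0.
  rewrite exprS; apply: le_trans (ler_wpM2l w0 IH).
  rewrite -natr1; have : 0 <= N%:R * v * v by rewrite !mulr_ge0.
  by lra.
- rewrite (_ : - u = N%:R * (- (u / N%:R))); last first.
    by rewrite mulrN mulrCA divff ?mulr1// gt_eqF.
  rewrite expRM_natl; apply: lerXn2r => //; rewrite ?nnegrE ?expR_ge0//.
  exact: expR_ge1Dx.
- by apply: exprn_ile1 => //; rewrite lerBlDr lerDl.
Qed.

(** The shift by k makes the height tend to 0 at x = a too, so the limit is the closed indicator;
    the square dominates that shift as soon as x > a. *)
Definition step_height a k x : R := expR (k%:R ^+ 2 * (x - a) - k%:R).

(** Larger than the height at M, so that the base 1 - u/N lies in [0, 1] for all x <= M. *)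
Definition step_degree (M : R) a k : nat := (Num.bound (step_height a k M)).+1.

(* Tends pointwise on ]-oo, M] to the indicator of ]-oo, a]. *)
Definition step_approx (M : R) a k x : R :=
  (1 - step_height a k x / (step_degree M a k)%:R) ^+ step_degree M a k.

Lemma step_height_bounds M a k x : x <= M ->
  0 <= step_height a k x <= (step_degree M a k)%:R.
Proof.
move=> xM; rewrite expR_ge0/=; apply: (@le_trans _ _ (step_height a k M)).
  by rewrite ler_expR lerD2r ler_wpM2l ?sqr_ge0// lerB.
apply: le_trans (ltW (archi_boundP (expR_ge0 _))) _.
by rewrite ler_nat.
Qed.

Lemma step_approx_bounds M a k x : x <= M -> 0 <= step_approx M a k x <= 1.
Proof.
move=> xM; have [|h1 _ _ h2] := @exp_pow_bounds (step_degree M a k) _ _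
  (step_height_bounds a k xM) => //.
by rewrite h1 h2.
Qed.

Lemma cvg_step_approx M a x : x <= M ->
  step_approx M a k x @[k --> \oo] --> ((x <= a)%R%:R : R).
Proof.
move=> xM; have b k := @exp_pow_bounds (step_degree M a k) _ isT
  (step_height_bounds a k xM).
have [xa|ax] := leP x a.
  apply: (@squeeze_cvgr _ _ _ _ (fun k => 1 - expR (- k%:R)) (cst 1)).
  - apply: nearW => k; have [_ h1 _ h2] := b k; rewrite h2 andbT.
    apply: le_trans h1; rewrite lerB// ler_expR gerDr.
    by rewrite mulr_ge0_le0 ?sqr_ge0// subr_le0.
  - rewrite -[X in _ --> X]subr0; apply: cvgB; first exact: cvg_cst.
    exact: cvgn_expR.
  - exact: cvg_cst.
apply: (@squeeze_cvgr _ _ _ _ (cst 0) (fun k => expR (- k%:R))).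
- near=> k; have [-> _ h _] := b k; apply: le_trans h _.
  rewrite ler_expR lerNl opprK; apply: le_trans (_ : 1 + k%:R <= _).
    by rewrite lerDr.
  apply: le_trans (expR_ge1Dx _) _; rewrite ler_expR.
  have k2 : 2 <= k%:R * (x - a).
    rewrite -ler_pdivrMr ?subr_gt0//; near: k; exact: nbhs_infty_ger.
  have : k%:R * 2 <= k%:R * (k%:R * (x - a)) by rewrite ler_wpM2l.
  by rewrite mulrA -expr2; lra.
- exact: cvg_cst.
- exact: cvgn_expR.
Unshelve. all: end_near. Qed.

Lemma step_approxE M a k : exists c : nat -> R, forall x,
  step_approx M a k x =
  \sum_(i < (step_degree M a k).+1) c i * expR (i%:R * k%:R ^+ 2 * x).
Proof.
pose N := step_degree M a k.
exists (fun i => (-1) ^+ i * expR (i%:R * (- k%:R ^+ 2 * a - k%:R)) / N%:R ^+ i *+ 'C(N, i)) => y.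
rewrite /step_approx exprBn; apply: eq_bigr => i _.
rewrite expr1n mulr1 [RHS]mulrnAl -/N; congr (_ *+ 'C(_, _)).
rewrite expr_div_n -expRM_natl -!mulrA; congr (_ * _).
rewrite [RHS]mulrCA -expRD mulrC; congr (_ * expR _); ring.
Qed.

End step_approximation.

(** * Finite measures on a cube are determined by exponentials *)

Section determination.
Context (R : realType) (m : nat).
Variables (mu nu : {finite_measure set (m.-tuple R) -> \bar R}) (M : R).

Definition cube : set (m.-tuple R) := [set x | forall l, `|tnth x l| <= M].

Hypotheses (mu0 : mu (~` cube) = 0%E) (nu0 : nu (~` cube) = 0%E).

Lemma measurable_cube : measurable cube.
Proof.
rewrite (_ : cube = \bigcap_(l in [set: 'I_m])
    (fun x => tnth x l) @^-1` `[- M, M]%classic); last first.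
  apply/seteqP; split => x h l => [_|]; have := h l; rewrite /= in_itv/= ler_norml //.
  by apply.
apply: fin_bigcap_measurable => // l _; rewrite -[X in measurable X]setTI.
exact: measurable_tnth.
Qed.
#[local] Hint Resolve measurable_cube : core.

(** Boundedness is asked on the cube alone, as exponentials are unbounded outside; it yields
    integrability and dominated convergence. *)
Let good (h : m.-tuple R -> R) := [/\ measurable_fun setT h,
  exists C, forall x, cube x -> `|h x| <= C &
  (\int[mu]_(x in cube) (h x)%:E = \int[nu]_(x in cube) (h x)%:E)%E].

Let good_integrable (lambda : {finite_measure set (m.-tuple R) -> \bar R}) h :
  good h -> lambda.-integrable cube (EFin \o h).
Proof.
move=> [mh [C hC] _]; apply: measurable_bounded_integrable => //.
- by rewrite -ge0_fin_numE// fin_num_measure.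
- exact: measurable_funTS.
- exists C; split; first exact: num_real.
  by move=> B CB x /= xc; apply: le_trans (hC x xc) (ltW CB).
Qed.

Let good_scale c h : good h -> good (fun x => c * h x).
Proof.
move=> gh; have [mh [C hC] hE] := gh; split.
- exact: measurable_funM.
- by exists (`|c| * C) => x xc; rewrite normrM ler_wpM2l// hC.
- under eq_integral do rewrite EFinM.
  rewrite integralZl//; last exact: good_integrable.
  rewrite hE -integralZl//; last exact: good_integrable.
Qed.

Let good_add h1 h2 : good h1 -> good h2 -> good (fun x => h1 x + h2 x).
Proof.
move=> g1 g2; have [m1 [C1 hC1] E1] := g1; have [m2 [C2 hC2] E2] := g2; split.
- exact: measurable_funD.
- exists (C1 + C2) => x xc; apply: le_trans (ler_normD _ _) _.
  by rewrite lerD ?hC1 ?hC2.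
- under eq_integral do rewrite EFinD.
  under [RHS]eq_integral do rewrite EFinD.
  rewrite !integralD//; [|exact: good_integrable..].
  by rewrite E1 E2.
Qed.

Let good_sum n (h : 'I_n -> m.-tuple R -> R) : (forall i, good (h i)) ->
  good (fun x => \sum_(i < n) h i x).
Proof.
elim: n h => [|n IH] h gh.
  under eq_fun do rewrite big_ord0.
  split => //; first by exists 0 => x _; rewrite normr0.
  by rewrite !integral0.
under eq_fun do rewrite big_ord_recl.
by apply: good_add => //; exact: IH.
Qed.

Let good_limit (h : nat -> m.-tuple R -> R) (h' : m.-tuple R -> R) C :
  measurable_fun setT h' -> (forall x, cube x -> `|h' x| <= C) ->
  (forall k, good (h k)) -> (forall k x, cube x -> `|h k x| <= C) ->
  (forall x, cube x -> h k x @[k --> \oo] --> h' x) -> good h'.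
Proof.
move=> mh' h'C gh hC hh'.
have lim (lambda : {finite_measure set (m.-tuple R) -> \bar R}) :
    (\int[lambda]_(x in cube) (h k x)%:E)%E @[k --> \oo] -->
    (\int[lambda]_(x in cube) (h' x)%:E)%E.
  have m1 k : measurable_fun cube (fun x => (h k x)%:E).
    by apply/measurable_EFinP/measurable_funTS; case: (gh k).
  have m2 : measurable_fun cube (fun x => (h' x)%:E).
    exact/measurable_EFinP/measurable_funTS.
  have a1 : {ae lambda, forall x, cube x -> (h k x)%:E @[k --> \oo] --> (h' x)%:E}.
    by apply: aeW => x xc; apply: cvg_EFin; [exact: nearW|exact: hh'].
  have a2 : {ae lambda, forall x k, cube x -> (`|(h k x)%:E| <= (cst C%:E) x)%E}.
    by apply: aeW => x k xc; rewrite lee_fin hC.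
  have iC := finite_measure_integrable_cst lambda C measurable_cube.
  by case: (dominated_convergence measurable_cube m1 m2 a1 iC a2).
split => //.
- by exists C.
- have hmu := lim mu.
  have hnu := lim nu.
  have E : (fun k => \int[nu]_(x in cube) (h k x)%:E)%E =
      (fun k => \int[mu]_(x in cube) (h k x)%:E)%E.
    by apply/funext => k; case: (gh k).
  rewrite E in hnu; exact: (cvg_unique _ hmu hnu).
Qed.

Lemma exp_determination :
  (forall f : m.-tuple R, (\int[mu]_(x in cube) (expR (dot f x))%:E =
     \int[nu]_(x in cube) (expR (dot f x))%:E)%E) ->
  forall A, measurable A -> mu A = nu A.
Proof.
move=> hexp.
(* Coordinates are converted one by one from exponentials to half-line indicators; at k = m the
   product is the indicator of an orthant, and orthants form a generating pi-system. *)
pose factor k (a f : 'I_m -> R) (x : m.-tuple R) (l : 'I_m) :=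
  if (l < k)%N then (tnth x l <= a l)%R%:R else expR (f l * tnth x l).
have mfactor k a f l : measurable_fun setT (fun x => factor k a f x l).
  rewrite /factor; case: (l < k)%N.
    rewrite (_ : (fun x => _) = \1_((fun x : m.-tuple R => tnth x l) @^-1` `]-oo, a l])).
      apply: measurable_indic; rewrite -[X in measurable X]setTI.
      exact: measurable_tnth.
    apply/funext => x; rewrite indicE; congr (_ %:R); congr nat_of_bool.
    by apply/idP/idP; rewrite inE/= in_itv.
  apply: measurableT_comp => //; apply: measurable_funM => //.
  exact: measurable_tnth.
have bfactor k a f l x : cube x -> 0 <= factor k a f x l <= expR (`|f l| * M).
  move=> xc; have M0 : 0 <= M by apply: le_trans (xc l).
  rewrite /factor; case: ifP => _.
    rewrite ler0n/= (@le_trans _ _ 1)//; first by rewrite lern1 leq_b1.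
    by rewrite -expR0 ler_expR mulr_ge0.
  rewrite expR_ge0/= ler_expR; apply: le_trans (ler_norm _) _.
  by rewrite normrM ler_wpM2l// xc.
suff main k a f : (k <= m)%N -> good (fun x => \prod_(l < m) factor k a f x l).
  move=> A; apply: (measure_unique (@orthants R m) (fun k => orthant (fun=> k%:R))).
  - exact: measurable_orthants.
  - exact: orthantI.
  - by move=> k; exists (fun=> k%:R).
  - exact: orthant_cover.
  - move=> _ [a _ <-].
    have cubeE (l : {finite_measure set (m.-tuple R) -> \bar R}) : l (~` cube) = 0%E ->
        l (orthant a) = (\int[l]_(x in cube) (\prod_(i < m) factor m a (fun=> 0) x i)%:E)%E.
      move=> l0; rewrite (_ : (fun x => _) = EFin \o \1_(orthant a)); last first.
        apply/funext => x /=; congr EFin.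
        rewrite indicE -[RHS](_ : [forall i, tnth x i <= a i]%:R = _).
          rewrite -prod_bool_natr; apply: eq_bigr => i _.
          by rewrite /factor ltn_ord.
        congr (_ %:R); congr nat_of_bool.
        apply/forallP/idP => [h|]; first by rewrite inE.
        by rewrite inE.
      rewrite integral_indic//; last exact: measurable_orthant.
      have mo := measurable_orthant a.
      rewrite -[X in l X = _](setIT (orthant a)) -(setUv cube) setIUr measureU//.
      - rewrite [X in (_ + X)%E](_ : _ = 0%E) ?adde0//.
        apply: (subset_measure0 _ _ _ l0) => //.
        + by apply: measurableI => //; exact: measurableC.
        + exact: measurableC.
      - exact: measurableI.
      - by apply: measurableI => //; exact: measurableC.
      - by rewrite setIACA setICr setI0.
    apply: etrans (cubeE mu mu0) _; apply: etrans (esym (cubeE nu nu0)).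
    by case: (main m a (fun=> 0) (leqnn m)).
  - by move=> k; rewrite -ge0_fin_numE// fin_num_measure//; exact: measurable_orthant.
elim: k a f => [|k IH] a f km.
  have ef x : \prod_(l < m) factor 0 a f x l = expR (dot [tuple f l | l < m] x).
    rewrite /dot expR_sum; apply: eq_bigr => l _.
    by rewrite tnth_mktuple.
  split.
  - exact: measurable_prod.
  - exists (\prod_(l < m) expR (`|f l| * M)) => x xc; rewrite ger0_norm; last first.
      by apply: prodr_ge0 => l _; case/andP: (bfactor 0 a f l x xc).
    by apply: ler_prod => l _; exact: bfactor.
  - under eq_integral do rewrite ef.
    by under [RHS]eq_integral do rewrite ef.
pose i := Ordinal km.
pose H x := \prod_(l < m | l != i) factor k a f x l.
(* As [f] is arbitrary in the induction hypothesis, the rate b of the i-th exponential is free, and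
   every combination of such exponentials times [H] is good. *)
have HE b x : \prod_(l < m) factor k a (fun l => if l == i then b else f l) x l =
    expR (b * tnth x i) * H x.
  rewrite (bigD1 i)//= {1}/factor ltnn eqxx; congr (_ * _).
  by apply: eq_bigr => l li; rewrite /factor (negbTE li).
have HS x : \prod_(l < m) factor k.+1 a f x l = (tnth x i <= a i)%R%:R * H x.
  rewrite (bigD1 i)//= {1}/factor ltnSn; congr (_ * _).
  apply: eq_bigr => l li; rewrite /factor ltnS leq_eqVlt.
  by rewrite (_ : (l == k :> nat) = false) //; apply/negbTE.
have gH b : good (fun x => expR (b * tnth x i) * H x).
  under eq_fun do rewrite -HE.
  by apply: IH; exact: ltnW.
pose C := \prod_(l < m | l != i) expR (`|f l| * M).
have HC x : cube x -> 0 <= H x <= C.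
  move=> xc; apply/andP; split.
    by apply: prodr_ge0 => l _; case/andP: (bfactor k a f l x xc).
  by apply: ler_prod => l _; exact: bfactor.
apply: (@good_limit (fun j x => step_approx M (a i) j (tnth x i) * H x) _ C).
- exact: measurable_prod.
- move=> x xc; rewrite HS; have /andP[H0 H1] := HC x xc.
  rewrite ger0_norm ?mulr_ge0//; apply: (le_trans _ H1).
  by rewrite -[leRHS]mul1r ler_wpM2r// lern1 leq_b1.
- move=> j; have [c cE] := step_approxE M (a i) j.
  under eq_fun do rewrite cE mulr_suml.
  apply: good_sum => r; under eq_fun do rewrite -mulrA.
  exact: good_scale.
- move=> j x xc; have xM : tnth x i <= M by apply: le_trans (ler_norm _) (xc i).
  have /andP[s0 s1] := step_approx_bounds (a i) j xM.
  have /andP[H0 H1] := HC x xc.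
  rewrite ger0_norm; last exact: mulr_ge0.
  apply: (le_trans _ H1).
  by rewrite -[leRHS]mul1r ler_wpM2r.
- move=> x xc; rewrite HS; apply: cvgM; last exact: cvg_cst.
  by apply: cvg_step_approx; apply: le_trans (ler_norm _) (xc i).
Qed.

End determination.

(** * The random flight *)

Section random_flight.
Context (R : realType).

Lemma sphere_laplace_scale D (z c t : R) :
  sphere_laplace D z (c * t) = sphere_laplace D (c ^+ 2 * z) t.
Proof.
apply: eq_eseriesr => m _; congr EFin; rewrite [(c * t) ^+ _]exprMn (exprM c).
rewrite -(mulrA (c ^+ 2)) [(c ^+ 2 * _) ^+ m]exprMn; congr (_ / _).
by rewrite mulrA (mulrC (_ ^+ m)).
Qed.

Lemma sqnorm_direction d (x : d.-tuple R) : 0 < enorm x -> sqnorm (direction x) = 1.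
Proof.
move=> x0; rewrite /sqnorm /direction.
under eq_bigr do rewrite tnth_mktuple expr_div_n.
rewrite -mulr_suml -/(sqnorm x) enormE sqr_sqrtr ?sqnorm_ge0// divff//.
by move: x0; rewrite enormE sqrtr_gt0 => /gt_eqF ->.
Qed.

(** A normalized vector has norm 1, so the cone over the complement of the sphere is empty. *)
Lemma sphere_uniform_sqnorm d : sphere_uniform [set v : d.-tuple R | sqnorm v != 1] = 0%E.
Proof.
rewrite /sphere_uniform [X in lebesgue_tuple _ X](_ : _ = set0) ?measure0 ?mul0r//.
apply/seteqP; split => // x [/andP[x0 _]] /=.
by rewrite -[X in sqnorm X]/(direction x) sqnorm_direction// eqxx.
Qed.

Lemma ae_sqnorm d (sigma : {measure set (d.-tuple R) -> \bar R}) :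
  (forall A, measurable A -> sigma A = sphere_uniform A) ->
  {ae sigma, forall v, sqnorm v = 1}.
Proof.
move=> sU.
have mS : measurable [set v : d.-tuple R | sqnorm v != 1].
  rewrite (_ : [set _ | _] = @sqnorm R d @^-1` (~` [set 1])).
    rewrite -[X in measurable X]setTI; apply: measurable_sqnorm => //.
    exact: measurableC.
  by apply/seteqP; split => v /= /eqP.
exists [set v : d.-tuple R | sqnorm v != 1]; split => //.
- by rewrite sU// sphere_uniform_sqnorm.
- by move=> v /= /eqP.
Qed.

Lemma tnth_le_sqnorm d (v : d.-tuple R) l : sqnorm v = 1 -> `|tnth v l| <= 1.
Proof.
move=> v1; rewrite -ler_sqr ?nnegrE// expr1n real_normK ?num_real// -v1.
by rewrite /sqnorm (bigD1 l)//= lerDl sumr_ge0// => i _; exact: sqr_ge0.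
Qed.

Lemma sum_durations n t (s : n.-tuple R) (psi : R -> R) :
  \sum_(k < n.+1) psi (tnth (durations t s) k) =
  (\sum_(k < n) psi (tnth s k)) + psi (t - \sum_(k < n) tnth s k).
Proof.
by rewrite -(big_tuple _ _ (durations t s) xpredT) big_rcons/= big_tuple addrC.
Qed.

Lemma duration_ge0 n t (s : n.-tuple R) k : simplex t s -> 0 <= tnth (durations t s) k.
Proof.
move=> [s0 st]; have : tnth (durations t s) k \in durations t s by exact: mem_tnth.
rewrite mem_rcons inE => /orP[/eqP ->|/tnthP[i ->]]; last exact: ltW.
by rewrite subr_ge0 ltW.
Qed.

Lemma duration_le n t (s : n.-tuple R) k : simplex t s -> tnth (durations t s) k <= t.
Proof.
move=> st; have := sum_durations t s id; rewrite addrCA subrr addr0 => sE.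
rewrite -[leRHS]sE (bigD1 k)//= lerDl sumr_ge0// => i _; exact: duration_ge0.
Qed.

Lemma dot_position d n c t (v : 'I_n.+1 -> d.-tuple R) (s : n.-tuple R) f :
  dot f (position c t v s) = \sum_(k < n.+1) c * tnth (durations t s) k * dot f (v k).
Proof.
rewrite /dot; under eq_bigr do rewrite tnth_mktuple 2!mulr_sumr.
rewrite exchange_big/=; apply: eq_bigr => k _; rewrite mulr_sumr.
by apply: eq_bigr => l _; ring.
Qed.

Lemma measurable_simplex n t : measurable (@simplex R n t).
Proof.
rewrite (_ : simplex t = (\1_(simplex t) : n.-tuple R -> R) @^-1` [set 1]).
  by rewrite -[X in measurable X]setTI; exact: measurable_simplex_indic.
apply/seteqP; split => s /=; rewrite indicE; first by move/mem_set => ->.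
case: (boolP (s \in _)) => [/set_mem//|_ /esym/eqP].
by rewrite oner_eq0.
Qed.

Lemma position_le d n c t (v : 'I_n.+1 -> d.-tuple R) (s : n.-tuple R) l :
  0 <= c -> simplex t s -> (forall k, sqnorm (v k) = 1) ->
  `|tnth (position c t v s) l| <= c * t.
Proof.
move=> c0 st v1; rewrite tnth_mktuple normrM ger0_norm// ler_wpM2l//.
apply: le_trans (ler_norm_sum _ _ _) _.
have := sum_durations t s id; rewrite addrCA subrr addr0 => sE.
rewrite -[leRHS]sE; apply: ler_sum => k _; rewrite normrM -[leRHS]mul1r.
by rewrite (ger0_norm (duration_ge0 _ st)) ler_wpM2r ?duration_ge0// tnth_le_sqnorm.
Qed.

Context dO (Omega : measurableType dO) (Q : {finite_measure set Omega -> \bar R}).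
Variables (d n : nat) (c t K : R) (a b : nat -> R)
  (sigma : 'I_n.+1 -> probability (d.+1.-tuple R) R)
  (V : 'I_n.+1 -> Omega -> d.+1.-tuple R) (tau : Omega -> n.-tuple R)
  (X : Omega -> d.+1.-tuple R).
Hypotheses (d0 : (0 < d)%N) (c0 : 0 <= c) (Q1 : Q setT = 1%E).
Hypotheses (mV : forall k, measurable_fun setT (V k))
  (mtau : measurable_fun setT tau) (mX : measurable_fun setT X).
Hypothesis sigmaU : forall k A, measurable A -> sigma k A = sphere_uniform A.
Hypothesis V_tau : forall (B : 'I_n.+1 -> set (d.+1.-tuple R)) C,
  (forall k, measurable (B k)) -> measurable C ->
  Q ((\bigcap_k (V k @^-1` B k)) `&` tau @^-1` C) =
  (\prod_(k < n.+1) sigma k (B k) * Q (tau @^-1` C))%E.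
Hypothesis XE : {ae Q, forall w, X w = position c t (fun k => V k w) (tau w)}.
Hypothesis tau0 : forall s : n.-tuple R, 0 <= \1_(simplex t) s * (K * GD_weight t a b s).
Hypothesis tauE : forall A, measurable A -> Q (tau @^-1` A) =
  (\int[lebesgue_tuple n]_(s in A) (\1_(simplex t) s * (K * GD_weight t a b s))%:E)%E.

Lemma ae_simplex : {ae Q, forall w, simplex t (tau w)}.
Proof.
have mS := measurableC (@measurable_simplex n t).
exists (tau @^-1` (~` simplex t)); split => //.
  by rewrite -[X in measurable X]setTI; exact: mtau.
apply: etrans (tauE mS) _; apply: integral0_eq => s /= sS.
by rewrite indicE memNset// mul0r.
Qed.

Lemma law_of_direction k B : measurable B -> Q (V k @^-1` B) = sigma k B.
Proof.
move=> mB; have := V_tau (B := fun i => if i == k then B else setT) (C := setT).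
rewrite preimage_setT setIT Q1 mule1 => /(_ _ measurableT) VE.
rewrite (bigD1 k)//= eqxx big1 ?mule1 in VE; last first.
  by move=> i /negbTE ->; exact: probability_setT.
rewrite -VE; last by move=> i; case: ifP.
have -> : \bigcap_i (V i @^-1` (if i == k then B else setT)) = V k @^-1` B.
  apply/seteqP; split => w h; first by have := h k Logic.I; rewrite /= eqxx.
  by move=> i _ /=; case: eqP => [->|].
by [].
Qed.

Lemma ae_direction : {ae Q, forall w, forall k, sqnorm (V k w) = 1}.
Proof.
apply: filter_forall => k.
have [N [mN N0 sN]] := ae_sqnorm (@sigmaU k).
exists (V k @^-1` N); split.
- by rewrite -[X in measurable X]setTI; exact: mV.
- exact: etrans (law_of_direction k mN) N0.
- by move=> w h; exact: sN.
Qed.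

Section transform.
Variable f : d.+1.-tuple R.

Let M := expR (c * t * \sum_(l < d.+1) `|tnth f l|).

(** The truncation at [M] makes the kernel bounded everywhere, as [independent_integral] demands. It
    is inactive almost surely: directions have norm 1 and durations lie in [0, t]. *)
Let kernel (k : 'I_n.+1) (p : d.+1.-tuple R * n.-tuple R) : R :=
  Num.min M (expR (c * tnth (durations t p.2) k * dot f p.1)).

Let measurable_kernel k : measurable_fun setT (kernel k).
Proof.
apply: measurable_minr => //; apply: measurableT_comp => //.
apply: measurable_funM; last exact: (measurableT_comp (measurable_dot f)).
apply: measurable_funM => //.
exact: (measurableT_comp (@measurable_duration R n t k)).
Qed.

Let kernel_bounds k p : 0 <= kernel k p <= M.
Proof. by rewrite le_min !expR_ge0 ge_min lexx. Qed.

Let kernelE k v s : simplex t s -> sqnorm v = 1 ->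
  kernel k (v, s) = expR (c * tnth (durations t s) k * dot f v).
Proof.
move=> st v1; apply/min_idPr; rewrite ler_expR.
apply: le_trans (_ : c * tnth (durations t s) k * \sum_(l < d.+1) `|tnth f l| <= _).
  rewrite ler_wpM2l ?mulr_ge0 ?duration_ge0//; apply: ler_sum => l _.
  apply: le_trans (ler_norm _) _; rewrite normrM -[leRHS]mulr1.
  by rewrite ler_wpM2l// tnth_le_sqnorm.
by rewrite ler_wpM2r ?sumr_ge0// ler_wpM2l// duration_le.
Qed.

Let averaged_kernel k s : simplex t s -> averaged (sigma k) (kernel k) s =
  rsphere_laplace d.+1 (c ^+ 2 * sqnorm f) (tnth (durations t s) k).
Proof.
move=> st; rewrite /averaged /rsphere_laplace; congr fine.
rewrite -sphere_laplace_scale -(sphere_uniform_laplace f _ (@sigmaU k)).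
apply: ge0_ae_eq_integral => //.
- apply/measurable_EFinP.
  exact: (measurableT_comp (@measurable_kernel k) (measurable_pair2 s)).
- apply/measurable_EFinP; apply: measurableT_comp => //.
  by apply: measurable_funM => //; exact: measurable_dot.
- by move=> v _; rewrite lee_fin; case/andP: (kernel_bounds k (v, s)).
by apply: filterS (ae_sqnorm (@sigmaU k)) => v v1 _; rewrite kernelE.
Qed.

Lemma flight_laplace : (\int[Q]_w (expR (dot f (X w)))%:E =
  K%:E * GD_integral n t a b (rsphere_laplace d.+1 (c ^+ 2 * sqnorm f)))%E.
Proof.
have z0 : 0 <= c ^+ 2 * sqnorm f by rewrite mulr_ge0 ?sqr_ge0 ?sqnorm_ge0.
set psi := rsphere_laplace _ _.
have mpsi : measurable_fun setT psi by exact: measurable_rsphere_laplace.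
have psi0 u : 0 <= psi u by exact: rsphere_laplace_ge0.
pose Psi s := \prod_(k < n.+1) psi (tnth (durations t s) k).
have mPsi : measurable_fun setT Psi.
  apply: measurable_prod => k _.
  exact: (measurableT_comp mpsi (@measurable_duration R n t k)).
have Psi0 s : 0 <= Psi s by exact: prodr_ge0.
transitivity (\int[Q]_w (\prod_(k < n.+1) kernel k (V k w, tau w))%:E)%E.
  apply: ge0_ae_eq_integral => //.
  - apply/measurable_EFinP; apply: measurableT_comp => //.
    exact: (measurableT_comp (measurable_dot f) mX).
  - apply/measurable_EFinP; apply: measurable_prod => k _.
    apply: (measurableT_comp (@measurable_kernel k)); exact: measurable_fun_pair.
  - move=> w _; rewrite lee_fin prodr_ge0// => k _.
    by case/andP: (kernel_bounds k (V k w, tau w)).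
  have aeS := ae_simplex; have aeV := ae_direction.
  near=> w => _; have st : simplex t (tau w) by near: w.
  have v1 k : sqnorm (V k w) = 1 by move: k; near: w.
  have -> : X w = position c t (fun k => V k w) (tau w) by near: w.
  by rewrite dot_position expR_sum; congr EFin; apply: eq_bigr => k _; rewrite kernelE.
rewrite (independent_integral mV mtau V_tau measurable_kernel kernel_bounds).
transitivity (\int[Q]_w (Psi (tau w))%:E)%E.
  apply: ge0_ae_eq_integral => //.
  - apply/measurable_EFinP; apply: measurable_prod => k _.
    apply: (measurableT_comp _ mtau).
    exact: measurable_averaged (@measurable_kernel k) (@kernel_bounds k).
  - exact/measurable_EFinP/(measurableT_comp mPsi mtau).
  - move=> w _; rewrite lee_fin prodr_ge0// => k _.
    apply: fine_ge0; apply: integral_ge0 => v _.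
    by rewrite lee_fin; case/andP: (kernel_bounds k (v, tau w)).
  - by move=> w _; rewrite lee_fin.
  apply: filterS ae_simplex => w st _; congr EFin.
  by apply: eq_bigr => k _; rewrite averaged_kernel.
have [q qE] := exists_pushforward Q mtau.
rewrite -(@ge0_integral_transfer _ _ _ _ _ Q q tau (fun s => (Psi s)%:E))//; last exact/measurable_EFinP.
have mW : measurable_fun setT (fun s : n.-tuple R => \1_(simplex t) s * (K * GD_weight t a b s)).
  apply: measurable_funM; first exact: measurable_simplex_indic.
  by apply: measurable_funM => //; exact: measurable_GD_weight.
rewrite (@ge0_integral_density_transfer _ _ _ _ _ (lebesgue_tuple n) q id _ _ _ mW tau0)//; last 2 first.
- by move=> A mA; apply: etrans (qE _) _; exact: tauE.
- exact/measurable_EFinP.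
(* A negative [K] would make the density, which is nonnegative, vanish identically, against total
   mass 1. *)
have K0 : 0 <= K.
  rewrite leNgt; apply/negP => K0.
  have : Q setT = 0%E.
    rewrite -(preimage_setT tau) tauE//; apply: integral0_eq => s _.
    congr EFin; apply/eqP; rewrite eq_le tau0 andbT mulrCA mulr_le0_ge0 ?(ltW K0)//.
    by rewrite mulr_ge0// GD_weight_ge0.
  by rewrite Q1 => /eqP; rewrite onee_eq0.
rewrite /GD_integral -ge0_integralZl//; last 2 first.
- by apply/measurable_EFinP; exact: measurable_GD_integrand.
- by move=> s _; rewrite lee_fin GD_integrand_ge0.
apply: eq_integral => s _; rewrite -!EFinM /GD_integrand -/(Psi s); congr EFin.
by ring.
Unshelve. all: end_near. Qed.

End transform.

(** At f = 0 the transform is 1, so the product of [K], [C] and [nhpow k t] must be 1. *)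
Lemma flight_laplace_sphere C k D : (0 < D)%N -> 0 < t ->
  (forall z : R, (0 <= z)%R -> GD_integral n t a b (rsphere_laplace d.+1 z) =
     C%:E * ((nhpow k t)%:E * sphere_laplace D z t))%E ->
  forall f, (\int[Q]_w (expR (dot f (X w)))%:E = sphere_laplace D (sqnorm f) (c * t))%E.
Proof.
move=> D0 t0 GD f; rewrite flight_laplace GD ?mulr_ge0 ?sqr_ge0 ?sqnorm_ge0//.
rewrite sphere_laplace_scale !muleA -!EFinM.
have := flight_laplace [tuple 0 | l < d.+1]; rewrite sqnorm0 mulr0 GD// sphere_laplace0 mule1 -!EFinM.
under eq_integral do rewrite dot0 expR0.
have -> : (\int[Q]_w (cst 1%:E) w = 1)%E by rewrite integral_cst// mul1e; exact: Q1.
by rewrite mulrA => -[<-]; rewrite mul1e.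
Qed.

Lemma flight_cube : Q (X @^-1` (~` @cube R d.+1 (c * t))) = 0%E.
Proof.
apply: measure_negligible.
  rewrite -[X in measurable X]setTI; apply: mX => //.
  by apply: measurableC; exact: measurable_cube.
have aeS := ae_simplex; have aeV := ae_direction.
have : {ae Q, forall w, cube (c * t) (X w)}.
  near=> w; have st : simplex t (tau w) by near: w.
  have v1 k : sqnorm (V k w) = 1 by move: k; near: w.
  have -> : X w = position c t (fun k => V k w) (tau w) by near: w.
  by move=> l; exact: position_le.
by [].
Unshelve. all: end_near. Qed.

End random_flight.

(** * The conditional density *)

Lemma exists_finite_measure d0 (T : measurableType d0) (R : realType)
    (m : {measure set T -> \bar R}) : (m setT < +oo)%E ->
  exists m' : {finite_measure set T -> \bar R}, forall A, m' A = m A.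
Proof.
move=> moo; exists (mfrestr measurableT moo : {finite_measure set T -> \bar R}) => A.
by rewrite /= /mfrestr /mrestr setIT.
Qed.

Lemma exists_conditional d0 (T : measurableType d0) (R : realType)
    (P : probability T R) (E : set T) : measurable E -> (0 < P E)%E ->
  exists Q : {finite_measure set T -> \bar R},
    forall A, measurable A -> Q A = (fine (P (A `&` E)) / fine (P E))%:E.
Proof.
move=> mE E0; have k0 : 0 <= (fine (P E))^-1 by rewrite invr_ge0 fine_ge0// ltW.
pose m : {measure set T -> \bar R} := mscale (NngNum k0) (mrestr P mE).
have mA A : measurable A -> m A = (fine (P (A `&` E)) / fine (P E))%:E.
  move=> mA; have mAE : measurable (A `&` E) by exact: measurableI.
  rewrite /m /= /mscale /mrestr/= mulrC EFinM fineK//.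
  exact: fin_num_measure.
have [|Q QE] := exists_finite_measure (m := m).
  by rewrite mA// ltry.
by exists Q => A /mA <-.
Qed.

(** The complement of the cube being null, transforms over the whole space are transforms over the
    cube. *)
Lemma exp_determination_measure (R : realType) m (mu nu : {measure set (m.-tuple R) -> \bar R}) (M : R) :
  (mu setT < +oo)%E -> (nu setT < +oo)%E ->
  mu (~` @cube R m M) = 0%E -> nu (~` @cube R m M) = 0%E ->
  (forall f : m.-tuple R, (\int[mu]_x (expR (dot f x))%:E =
     \int[nu]_x (expR (dot f x))%:E)%E) ->
  forall A, measurable A -> mu A = nu A.
Proof.
move=> muoo nuoo mu0 nu0 h A mA.
have [mu' muE] := exists_finite_measure muoo.
have [nu' nuE] := exists_finite_measure nuoo.
have integral_cube (l : {measure set (m.-tuple R) -> \bar R})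
    (l' : {finite_measure set (m.-tuple R) -> \bar R}) f :
    (forall A, l' A = l A) -> l (~` @cube R m M) = 0%E ->
    (\int[l']_(x in cube M) (expR (dot f x))%:E = \int[l]_x (expR (dot f x))%:E)%E.
  move=> lE l0; have mC := measurableC (@measurable_cube R m M).
  have me : measurable_fun setT (fun x => (expR (dot f x))%:E).
    apply/measurable_EFinP; apply: measurableT_comp => //; exact: measurable_dot.
  rewrite [RHS](ge0_negligible_integral mC)//.
  rewrite setTD setCK; apply: eq_measure_integral => B mB _; exact: lE.
rewrite -muE -nuE; apply: (@exp_determination R m mu' nu' M) => //.
- by apply: etrans (muE _) _.
- by apply: etrans (nuE _) _.
- by move=> f; rewrite (integral_cube mu)// (integral_cube nu).
Qed.

(** * The candidate density and its transform *)

Section target.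
Context (R : realType).
Variables (d n j : nat) (c t : R).
Hypotheses (d3 : (3 <= d.+1)%N) (j0 : (0 < j)%N) (ct0 : 0 < c * t).

(** The density has exponent l/2 - 1, and the dimension plus l is the parameter (n+1)(dimension - 2)
    + j + 2 reached by the flight. *)
Let l := (n * (d.+1 - 2) + j)%N.

Let Z : R := Num.sqrt pi ^+ d.+1 * nhpow (d.+1 + l) ((c * t) ^+ 2).

Let target (x : d.+1.-tuple R) : R :=
  \1_(eball (c * t)) x * conditional_density n j c t x.

Let l0 : (0 < l)%N. Proof. by rewrite addn_gt0 j0 orbT. Qed.

Let lE : l = l.-1.+1. Proof. by rewrite prednK. Qed.

Let Z0 : 0 < Z.
Proof.
rewrite mulr_gt0 ?exprn_gt0 ?sqrtr_gt0 ?pi_gt0// addSn.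
by rewrite divr_gt0 ?hGamma_gt0// hpow_gt0// exprn_gt0.
Qed.

Lemma targetE x : target x = Z^-1 * nhpow l ((c * t) ^+ 2 - sqnorm x).
Proof.
rewrite /target indicE (_ : (x \in eball (c * t)) = (0 < (c * t) ^+ 2 - sqnorm x)); last first.
  rewrite subr_gt0 (_ : (x \in _) = (enorm x < c * t)); last by apply/idP/idP; rewrite inE.
  rewrite enormE -[in LHS](ger0_norm (ltW ct0)) -sqrtr_sqr ltr_sqrt//.
  by rewrite exprn_gt0.
rewrite /conditional_density /nhpow hpowE; case: ifP => y0; last by rewrite !mul0r mulr0.
rewrite mul1r.
have d2 : (d.+1 - 2)%:R = d.+1%:R - 2 :> R by rewrite natrB//; exact: ltnW.
have -> : n%:R * (d.+1%:R / 2 - 1) + j%:R / 2 = l%:R / 2 :> R.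
  by rewrite /l natrD natrM d2; field.
have -> : n.+1%:R * (d.+1%:R / 2 - 1) + j%:R / 2 + 1 = (d.+1 + l)%:R / 2 :> R.
  by rewrite /l !natrD natrM d2 -natr1; field.
rewrite !GammaE /Z /nhpow.
have -> : pi `^ (d.+1%:R / 2) = Num.sqrt pi ^+ d.+1 :> R.
  by rewrite mulrC powRrM powR12_sqrt ?pi_ge0// powR_mulrn// sqrtr_ge0.
have -> : (c * t) `^ (2 * n.+1%:R * (d.+1%:R / 2 - 1) + j%:R) = hpow (d.+1 + l) ((c * t) ^+ 2).
  rewrite hpowE exprn_gt0// -powR_mulrn ?ltW// -powRrM; congr (_ `^ _).
  by rewrite /l !natrD natrM d2 -natr1; field.
rewrite -exprMn -[enorm x ^+ 2]/((Num.sqrt (sqnorm x)) ^+ 2) sqr_sqrtr ?sqnorm_ge0//.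
have := hGamma_gt0 R (d + l); rewrite -addSn.
have := hGamma_gt0 R l.-1; rewrite -lE.
have : 0 < Num.sqrt pi ^+ d.+1 :> R by rewrite exprn_gt0// sqrtr_gt0 pi_gt0.
have : 0 < hpow (d.+1 + l) ((c * t) ^+ 2) by rewrite hpow_gt0// exprn_gt0.
move: (hGamma _ _) (hGamma _ _) (hpow _ _) (Num.sqrt pi ^+ _) (_ `^ _).
by move=> u v w x' y u0 v0 w0 x0; field; rewrite !gt_eqF.
Qed.

Lemma target_ge0 x : 0 <= target x.
Proof.
by rewrite targetE mulr_ge0 ?invr_ge0 ?(ltW Z0)// lE nhpow_ge0.
Qed.

Lemma measurable_target : measurable_fun setT target.
Proof.
rewrite (_ : target = fun x => Z^-1 * nhpow l ((c * t) ^+ 2 - sqnorm x)); last first.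
  by apply/funext => x; rewrite targetE.
apply: measurable_funM => //.
apply: (measurableT_comp (@measurable_nhpow R l)).
by apply: measurable_funB => //; exact: measurable_sqnorm.
Qed.

Lemma target_laplace (f : d.+1.-tuple R) :
  (\int[lebesgue_tuple d.+1]_x ((expR (dot f x))%:E * (target x)%:E) =
   sphere_laplace (n.+1 * (d.+1 - 2) + j + 2) (sqnorm f) (c * t))%E.
Proof.
have n0 x : (0 <= (expR (dot f x))%:E * (nhpow l ((c * t) ^+ 2 - sqnorm x))%:E)%E.
  by rewrite mule_ge0// lee_fin ?expR_ge0// lE nhpow_ge0.
transitivity (Z^-1%:E * \int[lebesgue_tuple d.+1]_x
    ((expR (dot f x))%:E * (nhpow l ((c * t) ^+ 2 - sqnorm x))%:E))%E.
  rewrite -ge0_integralZl//; last 2 first.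
  - apply: emeasurable_funM; apply/measurable_EFinP.
      by apply: measurableT_comp => //; exact: measurable_dot.
    apply: (measurableT_comp (@measurable_nhpow R l)).
    by apply: measurable_funB => //; exact: measurable_sqnorm.
  - by rewrite lee_fin invr_ge0 ltW.
  by apply: eq_integral => x _; rewrite targetE EFinM muleCA.
rewrite lE ball_laplace -lE muleA -/Z -EFinM mulVf ?gt_eqF// mul1e.
congr sphere_laplace; rewrite /l; move: d3; nia.
Qed.

Lemma target_cube x : ~ cube (c * t) x -> target x = 0.
Proof.
move=> xc; rewrite targetE /nhpow hpow_le0 ?mul0r ?mulr0//.
rewrite leNgt; apply/negP; rewrite subr_gt0 => h; apply: xc => k.
rewrite -ler_sqr ?nnegrE ?(ltW ct0)// real_normK ?num_real//.
apply: le_trans (ltW h); rewrite /sqnorm (bigD1 k)//= lerDl sumr_ge0// => i _.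
exact: sqr_ge0.
Qed.

End target.

Theorem theorem5 (R : realType) (dO : measure_display)
    (Omega : measurableType dO) (P : probability Omega R)
    (d h i n j : nat) (c t : R)
    (N : {RV P >-> nat})
    (V : 'I_n.+1 -> {RV P >-> d.-tuple R})
    (tau : {RV P >-> n.-tuple R})
    (X : {RV P >-> d.-tuple R})
    (hd : (3 <= d)%N) (hh : (h <= 1)%N) (hi : (i <= 1)%N)
    (hn : (2 <= n)%N) (hj : (1 <= j <= n - 1)%N)
    (ht : 0 < t) (hc : 0 < c)
    (hN : (0 < P (N @^-1` [set n]))%E)
    (hV : forall (k : 'I_n.+1) (A : set (d.-tuple R)), measurable A ->
       distribution P (V k) A = sphere_uniform A)
    (htau : generalized_dirichlet t (GD_a R d j) (GD_b R d h i n j)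
       (cond_law tau (N @^-1` [set n])))
    (hind : mutually_independent V tau N)
    (hX : forall w : Omega, N w = n ->
       X w = position c t (fun k => V k w) (tau w)) :
  has_density (cond_law X (N @^-1` [set n]))
    (fun x => \1_(eball (c * t)) x * conditional_density n j c t x).
Proof.
case: d hd V X hV htau hind hX => // d d3 V X hV htau hind hX.
have ct0 : 0 < c * t by rewrite mulr_gt0.
have j0 : (0 < j)%N by case/andP: hj.
set E := N @^-1` [set n].
have mpre d' (T : measurableType d') (f : {RV P >-> T}) A : measurable A -> measurable (f @^-1` A).
  by move=> mA; rewrite -[X in measurable X]setTI; exact: measurable_funP.
have mE : measurable E by exact: mpre.
have [Q QE] := exists_conditional mE hN.
have PE0 : fine (P E) != 0.
  by rewrite gt_eqF// fine_gt0// hN ltey_eq fin_num_measure.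
have Q1 : Q setT = 1%E by rewrite QE// setTI divff.
have cond_lawE d' (T : measurableType d') (f : {RV P >-> T}) A : measurable A ->
    cond_law f E A = Q (f @^-1` A).
  by move=> mA; rewrite QE//; exact: mpre.
have [K [mf f0 tauE]] := htau.
pose sigma (k : 'I_n.+1) : probability (d.+1.-tuple R) R := distribution P (V k).
have V_tau (B : 'I_n.+1 -> set (d.+1.-tuple R)) C :
    (forall k, measurable (B k)) -> measurable C ->
    Q ((\bigcap_k (V k @^-1` B k)) `&` tau @^-1` C) =
    (\prod_(k < n.+1) sigma k (B k) * Q (tau @^-1` C))%E.
  move=> mB mC; rewrite !QE//; last 2 first.
  - exact: mpre.
  - apply: measurableI; last exact: mpre.
    by apply: fin_bigcap_measurable => // k _; exact: mpre.
  rewrite hind//.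
  (* Full sets for the directions isolate the independence of [tau] and [N], which allows the factor
     P(E) to be divided out. *)
  have := hind (fun=> setT) C [set n] (fun=> measurableT) mC.
  rewrite (_ : \bigcap_k _ = setT); last by apply/seteqP; split.
  rewrite setTI big1 ?mul1e => [/(_ _)->//|k _]; last first.
    by rewrite preimage_setT probability_setT.
  have pfin A : measurable A -> P A = (fine (P A))%:E.
    by move=> mA; rewrite fineK// fin_num_measure.
  have -> : (\prod_(k < n.+1) P (V k @^-1` B k) =
      (\prod_(k < n.+1) fine (P (V k @^-1` B k)))%:E)%E.
    by rewrite -prodEFin; apply: eq_bigr => k _; rewrite -pfin//; exact: mpre.
  rewrite (pfin (tau @^-1` C)); last exact: mpre.
  move: (pfin E mE); rewrite -/E; move: (fine (P E)) => e ->.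
  by rewrite -!EFinM /= !mulrA.
(* The formula for [X] is known only on [E], whose complement is null for the conditional law. *)
have XE : {ae Q, forall w, X w = position c t (fun k => V k w) (tau w)}.
  exists (~` E); split.
  - exact: measurableC.
  - by rewrite QE ?setICl ?measure0 ?mul0r//; exact: measurableC.
  - by move=> w /= h1 h2; apply: h1; exact: hX.
have tauQ A : measurable A -> Q (tau @^-1` A) = (\int[lebesgue_tuple n]_(s in A)
    (\1_(simplex t) s * (K * GD_weight t (GD_a R d.+1 j) (GD_b R d.+1 h i n j) s))%:E)%E.
  by move=> mA; rewrite -cond_lawE// tauE.
have [C0 _ GD] := @GD_integral_laplace R d.+1 h i n j d3 hh hi hj.
have mV k : measurable_fun setT (V k) by exact: measurable_funP.
have mtau : measurable_fun setT tau by exact: measurable_funP.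
have mX : measurable_fun setT X by exact: measurable_funP.
have D0 : (0 < n.+1 * (d.+1 - 2) + j + 2)%N by rewrite addn2.
have lap := flight_laplace_sphere (sigma := sigma) (ltnW d3) (ltW hc) Q1 mV mtau mX
  hV V_tau XE f0 tauQ D0 ht (fun z => GD z t).
have cub := flight_cube (sigma := sigma) (ltW hc) Q1 mV mtau mX hV V_tau XE tauQ.
have mT := @measurable_target R d n j c t d3 j0 ct0.
have T0 := @target_ge0 R d n j c t d3 j0 ct0.
split => // A mA; rewrite cond_lawE//.
have [law lawE] := exists_pushforward Q mX.
pose nu : {measure set (d.+1.-tuple R) -> \bar R} := density_measure (lebesgue_tuple d.+1) mT T0.
rewrite -lawE -[RHS]/(nu A).
have nu_lap f : (\int[nu]_x (expR (dot f x))%:E =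
    sphere_laplace (n.+1 * (d.+1 - 2) + j + 2) (sqnorm f) (c * t))%E.
  rewrite ge0_integral_density.
  - exact: target_laplace.
  - by apply/measurable_EFinP; apply: measurableT_comp => //; exact: measurable_dot.
  - by move=> x; rewrite lee_fin expR_ge0.
apply: (@exp_determination_measure _ _ law nu (c * t)) => //.
- have -> : law setT = 1%E by apply: etrans (lawE _) Q1.
  exact: ltry.
(* The total mass of the candidate is its transform at 0, equal to 1. *)
- have := nu_lap [tuple 0 | l < d.+1].
  under eq_integral do rewrite dot0 expR0.
  by rewrite sqnorm0 sphere_laplace0 integral_cst// mul1e => ->; exact: ltry.
- by apply: etrans (lawE _) cub.
- rewrite /nu /= /density_measure; apply: integral0_eq => x /= xc.
  by rewrite target_cube.
- move=> f; rewrite nu_lap -lap//.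
  apply: (ge0_integral_transfer mX) => //.
  apply/measurable_EFinP; apply: measurableT_comp => //; exact: measurable_dot.
Qed.
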